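(* Let $T>0$, $\theta\in(0,1)$, $\delta>0$, $\varepsilon\in(0,1)$. Let $X=\{X(t),t\in\mathbb{R}\}$ be a separable, mean-square continuous, strictly sub-Gaussian random process which satisfies condition RC, and let $Y(t)=\exp\{X(t)\}$. Assume that $X$ admits the expansion (E) in which the random variables $\xi_{0k},\eta_{jl}$ are independent strictly sub-Gaussian random variables. Let $\phi,\psi$ be the scaling function and wavelet used in (E), and assume additionally: (a) $\hat\phi$ is absolutely continuous on every interval; for each fixed $t$, $u(t,y)$ is absolutely continuous in $y$; the derivatives $u'_y(t,y)$, $\hat\phi'(y)$, $\hat\psi'(y)$ exist; $|\hat\psi'(y)|\le C<\infty$; $|u(t,y)|\le |t|\,u_1(y)$ and $|u'_y(t,y)|\le |t|\,u_2(y)$ for some functions $u_1,u_2\ge 0$ with $\int_{\mathbb{R}}u_1(y)|y|dy<\infty$, $\int_{\mathbb{R}}u_1(y)dy<\infty$, $\int_{\mathbb{R}}u_1(y)|\hat\phi'(y)|dy<\infty$, $\int_{\mathbb{R}}u_1(y)|\hat\phi(y)|dy<\infty$, $\int_{\mathbb{R}}u_2(y)|y|dy<\infty$, $\int_{\mathbb{R}}u_2(y)|\hat\phi(y)|dy<\infty$; and for all $t\in[0,T]$ and all $j=0,1,\dots$: $\lim_{|y|\to\infty}u(t,y)\overline{\hat\psi(y/2^j)}=0$ and $\lim_{|y|\to\infty}u(t,y)\hat\phi(y)=0$. (b) With $S(y)=\overline{\hat\psi(y)}$ and $S_\phi(y)=\overline{\hat\phi(y)}$: $|S'(y)|\le M<\infty$,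 and there exist functions $v,w\ge0$ such that for all $t_1,t_2\in[0,T]$ and $y\in\mathbb{R}$, $|u'_y(t_1,y)-u'_y(t_2,y)|\le |t_2-t_1|\,v(y)$, $|u(t_1,y)-u(t_2,y)|\le|t_2-t_1|\,w(y)$, with $\int|y|v(y)dy$, $\int v(y)|S_\phi(y)|dy$, $\int w(y)|S'_\phi(y)|dy$, $\int w(y)dy$, $\int w(y)|y|dy$, $\int w(y)|S_\phi(y)|dy$ all finite. Define $E_2=\frac{1}{\sqrt{2\pi}}\left(\int u_1|\hat\phi'|dy+\int u_2|\hat\phi|dy\right)$, $F_1=\frac{C}{\sqrt{2\pi}}\int u_1(y)|y|dy$, $F_2=\frac{C}{\sqrt{2\pi}}\int (u_1(y)+|y|u_2(y))dy$, $A^{(1)}=\frac{1}{\sqrt{2\pi}}\left(\int v|S_\phi|dy+\int w|S'_\phi|dy\right)$, $B^{(0)}=\frac{M}{\sqrt{2\pi}}\int w(y)|y|dy$, $B^{(1)}=\frac{M}{\sqrt{2\pi}}\int(w(y)+|y|v(y))dy$, and $\hat\varepsilon=\delta\sqrt{\varepsilon}$, $A(\theta)=\int_{1/(2\theta)}^\infty\frac{\sqrt{v+1}}{v^2}dv$, $\tau_1=\frac{e^{1/2}\hat\varepsilon}{2^{7/4}(64+\hat\varepsilon^2)^{1/4}}$, $\tau_2=(32\ln(1+\hat\varepsilon^2/60))^{1/2}$, $\tau_3=\sqrt{\ln(1+\hat\varepsilon^3/8)}/\sqrt2$, $\tau_*=\min\{\tau_1,\tau_2,\tau_3\}$, $Q=\frac{e^{1/2}\hat\varepsilon\,\theta(1-\theta)}{2^{9/4}A(\theta)T(1+\hat\varepsilon^3/8)}$,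 $N_0^*=1+\frac{8(A^{(1)})^2}{Q^2}$, $N^*=\max\{1+\log_8\frac{4(B^{(0)})^2}{7Q^2},\,3+\log_2\frac{4(B^{(1)})^2}{Q^2}\}$, $M^*=1+16\frac{(B^{(1)})^2}{Q^2}$, $N_0^{**}=\frac{6}{\tau_*^2}E_2^2T^2+1$, $N^{**}=\max\{1+\log_2\frac{72F_2^2T^2}{5\tau_*^2},\,1+\log_8\frac{18F_1^2T^2}{7\tau_*^2}\}$, $M^{**}=1+\frac{12}{\tau_*^2}F_2^2T^2$. Let $N_0,N,M_0,\dots,M_{N-1}$ be positive integers with $N_0>\max\{N_0^*,N_0^{**}\}$, $N>\max\{N^*,N^{**}\}$, $M_j>\max\{M^*,M^{**}\}$ for $j=0,\dots,N-1$, let $\hat X$ and $\hat Y=\exp\{\hat X\}$ be the corresponding models, and suppose $\sup_{t\in[0,T]}\mathsf{E}(X(t)-\hat X(t))^2>0$. Then $$\mathrm{P}\Big\{\sup_{t\in[0,T]}|Y(t)/\hat Y(t)-1|>\delta\Big\}\le\varepsilon .$$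
   Context: A real random variable $\xi$ is sub-Gaussian if there is $a\ge0$ with $\mathsf{E}\exp\{\lambda\xi\}\le\exp\{\lambda^2a^2/2\}$ for all $\lambda\in\mathbb{R}$; $\tau(\xi)$ is the infimum of such $a$. It is strictly sub-Gaussian if $\tau(\xi)=(\mathsf{E}\xi^2)^{1/2}$. A process $\{X(t),t\in\mathbf{T}\}$ is strictly sub-Gaussian if for any finite or countable set of $\xi_i\in\{X(t)\}$ and reals $\lambda_i$, $\tau^2(\sum\lambda_i\xi_i)=\mathsf{E}(\sum\lambda_i\xi_i)^2$. $\phi$ is the scaling function of a multiresolution analysis of $L_2(\mathbb{R})$ with $\{\phi(\cdot-k),k\in\mathbb{Z}\}$ orthonormal, $\psi$ the corresponding wavelet; $\phi_{0k}(x)=\phi(x-k)$, $\psi_{jl}(x)=2^{j/2}\psi(2^jx-l)$; $\hat f$ denotes the Fourier transform. Standing setting: $X$ is a centered process with $\mathsf{E}|X(t)|^2<\infty$, and there is a Borel function $u(t,\lambda)$ with $\int_{\mathbb{R}}|u(t,\lambda)|^2d\lambda<\infty$ for all $t$ and $R(t,s)=\mathsf{E}X(t)\overline{X(s)}=\int_{\mathbb{R}}u(t,\lambda)\overline{u(s,\lambda)}d\lambda$. Set $a_{0k}(t)=\frac1{\sqrt{2\pi}}\int u(t,y)\overline{\hat\phi(y)}e^{iyk}dy$ and $b_{jl}(t)=\frac1{\sqrt{2\pi}}\int u(t,y)2^{-j/2}e^{iyl/2^j}\overline{\hat\psi(y/2^j)}dy$. Expansion (E): $X(t)=\sum_{k\in\mathbb{Z}}\xi_{0k}a_{0k}(t)+\sum_{j=0}^\infty\sum_{l\in\mathbb{Z}}\eta_{jl}b_{jl}(t)$,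 converging in $L_2(\Omega)$ for every $t$, where $\xi_{0k},\eta_{jl}$ are centered with $\mathsf{E}\xi_{0k}\overline{\xi_{0l}}=\delta_{kl}$, $\mathsf{E}\eta_{mk}\overline{\eta_{nl}}=\delta_{mn}\delta_{kl}$, $\mathsf{E}\xi_{0k}\overline{\eta_{nl}}=0$. Condition RC: $X$ is as in the standing setting, $u(t,\cdot)\in L_1(\mathbb{R})\cap L_2(\mathbb{R})$ for each $t$, and the inverse Fourier transform of $u(t,x)$ in $x$ is real (so $a_{0k},b_{jl}$ are real). Models: $\hat X(t)=\sum_{k=-(N_0-1)}^{N_0-1}\xi_{0k}a_{0k}(t)+\sum_{j=0}^{N-1}\sum_{l=-(M_j-1)}^{M_j-1}\eta_{jl}b_{jl}(t)$ and $\hat Y(t)=\exp\{\hat X(t)\}$. *)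

(* Defs.v *)
From HB Require Import structures.
From mathcomp Require Import all_boot all_order all_algebra.
From mathcomp Require Import all_classical all_reals all_analysis.
From mathcomp.real_closed Require Import complex.

Set Implicit Arguments.
Unset Strict Implicit.
Unset Printing Implicit Defensive.

Import Order.TTheory GRing.Theory Num.Theory.
Import numFieldNormedType.Exports.

Local Open Scope classical_set_scope.
Local Open Scope ring_scope.

Notation cre := complex.Re.
Notation cim := complex.Im.

Definition cabs {R : realType} (z : R[i]) : R :=
  Num.sqrt (cre z ^+ 2 + cim z ^+ 2).

Definition cconj {R : realType} (z : R[i]) : R[i] := Complex (cre z) (- cim z).

Definition cexpi {R : realType} (a : R) : R[i] := Complex (cos a) (sin a).

Definition cR {R : realType} (a : R) : R[i] := Complex a 0.

(* Lebesgue integral over R of a real function (real-valued; meaningful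
   for integrable functions). *)
Definition Rint {R : realType} (f : R -> R) : R :=
  fine (\int[@lebesgue_measure R]_x (f x)%:E).

Definition cint {R : realType} (f : R -> R[i]) : R[i] :=
  Complex (Rint (fun x => cre (f x))) (Rint (fun x => cim (f x))).

Definition Rintegrable {R : realType} (f : R -> R) : Prop :=
  (@lebesgue_measure R).-integrable setT (fun x => (f x)%:E).

Definition cL1 {R : realType} (f : R -> R[i]) : Prop :=
  Rintegrable (fun x => cre (f x)) /\ Rintegrable (fun x => cim (f x)).

Definition cL2 {R : realType} (f : R -> R[i]) : Prop :=
  measurable_fun setT (fun x => cre (f x)) /\
  measurable_fun setT (fun x => cim (f x)) /\
  (\int[@lebesgue_measure R]_x ((cabs (f x)) ^+ 2)%:E < +oo)%E.

Definition l2n2 {R : realType} (f : R -> R[i]) : R :=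
  Rint (fun x => cabs (f x) ^+ 2).

Definition cinner {R : realType} (f g : R -> R[i]) : R[i] :=
  cint (fun x => f x * cconj (g x)).

(* Fourier transform, convention  \hat f(y) = int f(x) e^{-ixy} dx,     *)
(* extended to L2 by Plancherel: \hat f is the L2-limit of the Fourier  *)
(* transforms of the truncations f 1_[-n,n].                           *)

Definition trunc_FT {R : realType} (f : R -> R[i]) (n : nat) (y : R) : R[i] :=
  cint (fun x => cR (\1_(`[- (n%:R), n%:R]) x) * f x * cexpi (- (x * y))).

Definition is_FT {R : realType} (f fh : R -> R[i]) : Prop :=
  cL2 f /\ cL2 fh /\
  (fun n => l2n2 (fun y => fh y - trunc_FT f n y)) @ \oo --> (0 : R).

Definition translate {R : realType} (f : R -> R[i]) (k : int) : R -> R[i] :=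
  fun x => f (x - k%:~R).

Definition closed_span_translates {R : realType} (g : R -> R[i]) : set (R -> R[i]) :=
  [set f | cL2 f /\ forall e : R, 0 < e -> exists s : seq (int * R[i]),
      l2n2 (fun x => f x - \sum_(p <- s) p.2 * g (x - p.1%:~R)) < e].

Definition Vsp {R : realType} (phi : R -> R[i]) (j : int) : set (R -> R[i]) :=
  [set f | cL2 f /\
     closed_span_translates phi (fun x => f (x * (2 : R) `^ (- j%:~R)))].

Definition orthonormal_translates {R : realType} (g : R -> R[i]) : Prop :=
  forall k l : int, cinner (translate g k) (translate g l) = cR (k == l)%:R.

Definition MRA_scaling {R : realType} (phi : R -> R[i]) : Prop :=
  [/\ cL2 phi,
      orthonormal_translates phi,
      (forall (j : int) f, Vsp phi j f -> Vsp phi (j + 1) f),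
      (forall f, cL2 f -> forall e : R, 0 < e ->
          exists (j : int) g, Vsp phi j g /\ l2n2 (fun x => f x - g x) < e)
    & (forall f, (forall j : int, Vsp phi j f) -> l2n2 f = 0)].

(* psi is the wavelet corresponding to phi: {psi(. - k)} is an orthonormal
   basis of W_0 = V_1 (-) V_0 *)
Definition MRA_wavelet {R : realType} (phi psi : R -> R[i]) : Prop :=
  [/\ Vsp phi 1 psi,
      orthonormal_translates psi,
      (forall (k : int) f, Vsp phi 0 f -> cinner (translate psi k) f = 0)
    & (forall f, Vsp phi 1 f -> (forall g, Vsp phi 0 g -> cinner f g = 0) ->
          closed_span_translates psi f)].

Definition abs_cont_on {R : realType} (a b : R) (f : R -> R) : Prop :=
  forall e : R, 0 < e -> exists2 d : R, 0 < d &
    forall (n : nat) (l r : nat -> R),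
      (forall i, (i < n)%N -> a <= l i /\ l i <= r i /\ r i <= b) ->
      (forall i, (i.+1 < n)%N -> r i <= l i.+1) ->
      \sum_(i < n) (r i - l i) < d ->
      \sum_(i < n) `|f (r i) - f (l i)| < e.

Definition cabs_cont {R : realType} (f : R -> R[i]) : Prop :=
  forall a b : R, abs_cont_on a b (fun y => cre (f y)) /\
                  abs_cont_on a b (fun y => cim (f y)).

Definition cderiv {R : realType} (f f' : R -> R[i]) : Prop :=
  forall y : R, is_derive y 1 (fun z => cre (f z)) (cre (f' y)) /\
                is_derive y 1 (fun z => cim (f z)) (cim (f' y)).

Definition vanish_at_infty {R : realType} (f : R -> R[i]) : Prop :=
  (fun y => cabs (f y)) @ +oo --> (0 : R) /\
  (fun y => cabs (f y)) @ -oo --> (0 : R).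

Definition sq2pi {R : realType} : R := Num.sqrt (2 * pi).

Definition coef_a {R : realType} (u : R -> R -> R[i]) (phih : R -> R[i])
    (t : R) (k : int) : R[i] :=
  cR (sq2pi^-1) * cint (fun y => u t y * cconj (phih y) * cexpi (y * k%:~R)).

Definition coef_b {R : realType} (u : R -> R -> R[i]) (psih : R -> R[i])
    (t : R) (j : nat) (l : int) : R[i] :=
  cR (sq2pi^-1) * cint (fun y => u t y * cR ((2 : R) `^ (- (j%:R / 2)))
                  * cexpi (y * l%:~R / 2 ^+ j) * cconj (psih (y / 2 ^+ j))).

(* sum over k = -(N-1), ..., N-1 *)
Definition zsum {R : realType} (N : nat) (F : int -> R) : R :=
  \sum_(i < (N.*2).-1) F (i%:Z - (N%:Z - 1)).

Definition borel2 {R : realType} (u : R -> R -> R[i]) : Prop :=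
  measurable_fun setT (fun p : R * R => cre (u p.1 p.2)) /\
  measurable_fun setT (fun p : R * R => cim (u p.1 p.2)).

Section Prob.
Context {d : measure_display} {Omega : measurableType d} {R : realType}.
Variable P : probability Omega R.

Definition E2 (f : Omega -> R) : \bar R := (\int[P]_w ((f w) ^+ 2)%:E)%E.

Definition is_subG_const (xi : Omega -> R) (a : R) : Prop :=
  0 <= a /\ forall lam : R,
    (\int[P]_w (expR (lam * xi w))%:E <= (expR (lam ^+ 2 * a ^+ 2 / 2))%:E)%E.

Definition sub_gaussian (xi : Omega -> R) : Prop :=
  measurable_fun setT xi /\ exists a, is_subG_const xi a.

Definition tau (xi : Omega -> R) : R := inf [set a | is_subG_const xi a].

Definition strictly_sub_gaussian (xi : Omega -> R) : Prop :=
  sub_gaussian xi /\ tau xi = Num.sqrt (fine (E2 xi)).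

Definition strictly_sub_gaussian_process (X : R -> Omega -> R) : Prop :=
  forall (t : nat -> R) (lam : nat -> R) (zeta : Omega -> R),
    measurable_fun setT zeta ->
    (fun n => E2 (fun w => zeta w - \sum_(i < n) lam i * X (t i) w)) @ \oo
      --> 0%E ->
    sub_gaussian zeta /\ tau zeta ^+ 2 = fine (E2 zeta).

Definition mutually_independent {I : eqType} (Z : I -> Omega -> R) : Prop :=
  (forall i, measurable_fun setT (Z i)) /\
  forall (s : seq I), uniq s -> forall B : I -> set R,
    (forall i, measurable (B i)) ->
    fine (P (\bigcap_(i in [set` s]) (Z i @^-1` B i))) =
    \prod_(i <- s) fine (P (Z i @^-1` B i)).

Definition separable_process (X : R -> Omega -> R) : Prop :=
  exists (S : set R) (N : set Omega),
    countable S /\ closure S = setT /\ measurable N /\ P N = 0%E /\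
    forall w, ~ N w -> forall t : R, exists s : nat -> R,
      (forall n, S (s n)) /\ s @ \oo --> t /\
      (fun n => X (s n) w) @ \oo --> X t w.

Definition ms_continuous (X : R -> Omega -> R) : Prop :=
  forall t : R, E2 (fun w => X s w - X t w) @[s --> t] --> 0%E.

Definition standing_setting (X : R -> Omega -> R) (u : R -> R -> R[i]) : Prop :=
  [/\ (forall t, measurable_fun setT (X t) /\ (E2 (X t) < +oo)%E),
      (forall t, (\int[P]_w (X t w)%:E)%E = 0%E),
      borel2 u,
      (forall t, cL2 (u t))
    & (forall t s, cR (fine (\int[P]_w (X t w * X s w)%:E)%E)
                   = cint (fun l => u t l * cconj (u s l)))].

Definition condition_RC (X : R -> Omega -> R) (u : R -> R -> R[i]) : Prop :=
  standing_setting X u /\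
  (forall t, cL1 (u t) /\ cL2 (u t)) /\
  (forall t x : R,
     cim (cR ((2 * pi)^-1) * cint (fun y => u t y * cexpi (x * y))) = 0).

(* the model hat X with parameters N0, N, (M_j) (real parts of the
   coefficients, which are real under RC) *)
Definition Xmodel (u : R -> R -> R[i]) (phih psih : R -> R[i])
    (xi : int -> Omega -> R) (eta : nat -> int -> Omega -> R)
    (N0 N : nat) (M : nat -> nat) (t : R) (w : Omega) : R :=
  zsum N0 (fun k => xi k w * cre (coef_a u phih t k)) +
  \sum_(j < N) zsum (M j) (fun l => eta j l w * cre (coef_b u psih t j l)).

Definition expansion_E (X : R -> Omega -> R) (u : R -> R -> R[i])
    (phih psih : R -> R[i])
    (xi : int -> Omega -> R) (eta : nat -> int -> Omega -> R) : Prop :=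
  [/\ (forall k, (\int[P]_w (xi k w)%:E)%E = 0%E) /\
      (forall j l, (\int[P]_w (eta j l w)%:E)%E = 0%E),
      (forall k l, (\int[P]_w (xi k w * xi l w)%:E)%E = ((k == l)%:R)%:E),
      (forall m n k l, (\int[P]_w (eta m k w * eta n l w)%:E)%E
                        = (((m == n) && (k == l))%:R)%:E),
      (forall k n l, (\int[P]_w (xi k w * eta n l w)%:E)%E = 0%E)
    & (forall t, (fun n => E2 (fun w => X t w -
                     Xmodel u phih psih xi eta n n (fun _ => n) t w)) @ \oo
                 --> 0%E)].

Definition xi_eta (xi : int -> Omega -> R) (eta : nat -> int -> Omega -> R)
    (i : int + (nat * int)) : Omega -> R :=
  match i with inl k => xi k | inr p => eta p.1 p.2 end.

End Prob.

Section Constants.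
Context {R : realType}.

Definition log_b (b x : R) : R := ln x / ln b.

Definition E2c (u1 u2 : R -> R) (phih dphih : R -> R[i]) : R :=
  sq2pi^-1 * (Rint (fun y => u1 y * cabs (dphih y)) +
              Rint (fun y => u2 y * cabs (phih y))).
Definition F1c (C : R) (u1 : R -> R) : R :=
  C / sq2pi * Rint (fun y => u1 y * `|y|).
Definition F2c (C : R) (u1 u2 : R -> R) : R :=
  C / sq2pi * Rint (fun y => u1 y + `|y| * u2 y).
Definition A1c (v w : R -> R) (phih dphih : R -> R[i]) : R :=
  sq2pi^-1 * (Rint (fun y => v y * cabs (cconj (phih y))) +
              Rint (fun y => w y * cabs (cconj (dphih y)))).
Definition B0c (M : R) (w : R -> R) : R := M / sq2pi * Rint (fun y => w y * `|y|).
Definition B1c (M : R) (v w : R -> R) : R :=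
  M / sq2pi * Rint (fun y => w y + `|y| * v y).

Definition eps_hat (delta eps : R) : R := delta * Num.sqrt eps.

Definition A_theta (theta : R) : R :=
  fine (\int[@lebesgue_measure R]_(x in `[(2 * theta)^-1, +oo[%classic)
          (Num.sqrt (x + 1) / x ^+ 2)%:E).

Definition tau1 (eh : R) : R :=
  expR (1 / 2) * eh / ((2 : R) `^ (7 / 4) * (64 + eh ^+ 2) `^ (1 / 4)).
Definition tau2 (eh : R) : R := Num.sqrt (32 * ln (1 + eh ^+ 2 / 60)).
Definition tau3 (eh : R) : R := Num.sqrt (ln (1 + eh ^+ 3 / 8)) / Num.sqrt 2.
Definition tau_star (eh : R) : R := Num.min (tau1 eh) (Num.min (tau2 eh) (tau3 eh)).

Definition Qc (eh theta T : R) : R :=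
  expR (1 / 2) * eh * theta * (1 - theta) /
  ((2 : R) `^ (9 / 4) * A_theta theta * T * (1 + eh ^+ 3 / 8)).

Definition N0_star (A1 Q : R) : R := 1 + 8 * A1 ^+ 2 / Q ^+ 2.
Definition N_star (B0 B1 Q : R) : R :=
  Num.max (1 + log_b 8 (4 * B0 ^+ 2 / (7 * Q ^+ 2)))
          (3 + log_b 2 (4 * B1 ^+ 2 / Q ^+ 2)).
Definition M_star (B1 Q : R) : R := 1 + 16 * B1 ^+ 2 / Q ^+ 2.

Definition N0_2star (E2v ts T : R) : R := 6 / ts ^+ 2 * E2v ^+ 2 * T ^+ 2 + 1.
Definition N_2star (F1 F2 ts T : R) : R :=
  Num.max (1 + log_b 2 (72 * F2 ^+ 2 * T ^+ 2 / (5 * ts ^+ 2)))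
          (1 + log_b 8 (18 * F1 ^+ 2 * T ^+ 2 / (7 * ts ^+ 2))).
Definition M_2star (F2 ts T : R) : R := 1 + 12 / ts ^+ 2 * F2 ^+ 2 * T ^+ 2.

End Constants.

(* Main.v *)
(** Since [|u(t, y)| <= |t| u_1(y)], the process and its model both vanish at
    [t = 0], so the error [Z = X - \hat X] is controlled by its increments alone,
    and the bounds in [\tau_*] are not needed: [N_0^*], [N^*], [M^*] already give
    [E (Z t - Z s)^2 <= Q^2 (t - s)^2].  The increments are [L_2]-limits of finite
    sums of independent strictly sub-Gaussian variables, hence have sub-Gaussian
    tails, and dyadic chaining from [Z 0 = 0] with radii
    [ln (1 + delta) (n + 1) / (4 * 2 ^ n)] bounds [sup |Z|] by [ln (1 + delta)],
    that is [|Y / \hat Y - 1|] by [delta], outside an event of probability [eps].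

    The coefficients are estimated by integration by parts.  For [b_jl] one needs
    [\hat\psi (y / 2 ^ j)] to be small near [y = 0].  Instead of deriving
    [\hat\psi (0) = 0] from the multiresolution analysis, we use that the squares of
    the coefficients are summable (Bessel): this forces
    [Re (conj (\hat\psi 0) * \int u(t, y) e^{ixy} dy)] to vanish for every [x], so
    [\hat\psi] may be replaced by [\hat\psi - \hat\psi (0)] in [b_jl].  *)

Require Import Defs.
From HB Require Import structures.
From mathcomp Require Import all_boot all_order all_algebra.
From mathcomp Require Import all_classical all_reals all_analysis.
From mathcomp.real_closed Require Import complex.
From mathcomp Require Import ring lra zify measurable_realfun.
Import Order.TTheory GRing.Theory Num.Theory.
Import numFieldNormedType.Exports.
Local Open Scope classical_set_scope.
Local Open Scope ring_scope.
Set Implicit Arguments.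
Unset Strict Implicit.
Unset Printing Implicit Defensive.

(** The derivatives of [u t], [phih] and [psih] exist everywhere but need not be continuous, so
    integration by parts rests on a fundamental theorem of calculus for everywhere differentiable
    functions with Lebesgue integrable derivative. Boundary terms disappear through integrability:
    an integrable function is small at suitable points arbitrarily far out.

    Independence is a product rule for events, from which moment generating functions must be
    reached. Upper bounds suffice, so one factor at a time is exchanged for its superlevel sets.

    The constants fit as follows. [Q ^ 2] splits into a quarter for the omitted [xi], a quarter for
    the omitted [eta] on levels below [N] and a half for the levels from [N] on. The radii sum to
    [ln (1 + delta)], and their factor [n + 1] makes the tail on level [n] an [(n + 1)]-st power,
    which pays for the [2 ^ n] intervals there. It remains that [4 * exp (- ln (1 + delta) ^ 2 / (32
    * (Q * T) ^ 2))] is at most [eps]; this follows from [Q * T <= eps_hat / 20] and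
    [Q * T <= 3 / 40], obtained from [A_theta >= 2 * sqrt (2 * theta)]. *)

Lemma le_measureW d (T : measurableType d) (R : realType)
    (m : {measure set T -> \bar R}) (A B : set T) :
  measurable A -> measurable B -> A `<=` B -> (m A <= m B)%E.
Proof. by move=> mA mB AB; apply: le_measure; rewrite ?inE. Qed.

Lemma near_forall_ltn (T : Type) (F : set_system T) (FF : Filter F)
    (P : nat -> set T) m :
  (forall n, (n < m)%N -> F (P n)) -> F [set y | forall n, (n < m)%N -> P n y].
Proof.
elim: m => [|m IH] H; first by apply: nearW.
have {}IH : F [set y | forall n, (n < m)%N -> P n y].
  by apply: IH => n nm; apply: H; exact: ltnW.
apply: filterS (filterI IH (H m (ltnSn m))) => y [Hy Py] n; rewrite ltnS leq_eqVlt => /predU1P[->//|].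
exact: Hy.
Qed.

(** * Increments of everywhere differentiable functions *)

Section FundamentalTheorem.
Context {R : realType}.
Implicit Types (F f h G g : R -> R) (a b x y : R).
Local Notation mu := (@lebesgue_measure R).

Lemma is_derive_near F x (l e : R) : is_derive x 1 F l -> 0 < e ->
  exists2 d : R, 0 < d & forall y : R, `|y - x| < d ->
    `|F y - F x - l * (y - x)| <= e * `|y - x|.
Proof.
move=> [dF dl] e0.
have /cvgrPdist_le/(_ _ e0) := dF.
rewrite /dnbhs near_withinE => /nbhs_ballP[d /= d0 hd].
have {}hd (h : R) : h != 0 -> `|h| < d -> `|l - h^-1 * (F (h + x) - F x)| <= e.
  move=> h0 hlt; rewrite -dl -[X in F (X + x)](mulr1 h).
  by apply: hd => //; rewrite /ball/= sub0r normrN.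
exists d => //= y yd.
have [->|yx] := eqVneq y x; first by rewrite !subrr mulr0 subr0 normr0 mulr0.
have yx0 : y - x != 0 by rewrite subr_eq0.
have := hd (y - x) yx0 yd; rewrite subrK => h.
have -> : F y - F x - l * (y - x) =
   - ((l - (y - x)^-1 * (F y - F x)) * (y - x)) by field.
by rewrite normrN normrM; apply: ler_wpM2r.
Qed.

(** The sum is [eta] times the number of full layers of height [eta] below [y], counted up to [N].
    The induction carries the bound [N * eta] as well: a new full layer raises the sum to at most
    [(N + 1) * eta], which is then at most [y]. *)
Lemma floor_layers_le (eta y : R) N : 0 <= eta -> 0 <= y ->
  \sum_(n < N) eta * (n.+1%:R * eta <= y)%R%:R <= y.
Proof.
move=> eta0 y0.
suff : \sum_(n < N) eta * (n.+1%:R * eta <= y)%R%:R <= Num.min (N%:R * eta) y.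
  by rewrite le_min => /andP[].
elim: N => [|N IH]; first by rewrite big_ord0 mul0r le_min lexx y0.
rewrite big_ord_recr/=; move: IH; rewrite !le_min => /andP[IH1 IH2].
have eN : N.+1%:R * eta = N%:R * eta + eta by rewrite -natr1 mulrDl mul1r.
case: (leP (N.+1%:R * eta) y) => h; rewrite ?mulr1 ?mulr0 ?addr0.
- apply/andP; split; first by rewrite eN lerD2r.
  by apply: le_trans h; rewrite eN lerD2r.
- by rewrite IH2 andbT; apply: le_trans IH1 _; rewrite eN lerDl.
Qed.

(* Real induction; only monotonicity of [Psi] is needed, not continuity. *)
Lemma real_induction_le (F : R -> R) (Psi : R -> \bar R) a b :
  a <= b -> (forall x, continuous_at x F) ->
  (forall x y, a <= x -> x <= y -> y <= b -> (Psi x <= Psi y)%E) ->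
  ((F a)%:E <= Psi a)%E ->
  (forall x, a <= x -> x < b -> ((F x)%:E <= Psi x)%E ->
     exists2 y, x < y <= b & ((F y)%:E <= Psi y)%E) ->
  ((F b)%:E <= Psi b)%E.
Proof.
move=> ab cF mPsi Fa step.
pose S := [set y | a <= y <= b /\ ((F y)%:E <= Psi y)%E].
have Sa : S a by split=> //; rewrite lexx ab.
have hS : has_sup S.
  by split; [exists a | exists b => y [/andP[_ ]]].
set s := sup S.
have as_ : a <= s by apply: ub_le_sup => //; case: hS.
have sb : s <= b by apply: ge_sup; [exists a | move=> y [/andP[_ ]]].
have Fs : ((F s)%:E <= Psi s)%E.
  rewrite leNgt; apply/negP => Psis.
  have [r rE] : exists2 r, (Psi s <= r%:E)%E & r < F s.
    case: (Psi s) Psis => [r||]//; first by rewrite lte_fin => ?; exists r.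
    by move=> _; exists (F s - 1); rewrite ?leNye// gtrBl.
  move=> rFs.
  have e0 : 0 < F s - r by rewrite subr_gt0.
  have /cvgrPdist_lt/(_ _ e0) := cF s.
  move=> /nbhs_ballP[d /= d0 hd].
  have [y Sy sy] := sup_adherent d0 hS.
  have ys : y <= s by apply: ub_le_sup => //; case: hS.
  have : `|F s - F y| < F s - r.
    by apply: hd; rewrite /ball/= ger0_norm ?subr_ge0// ltrBlDr -ltrBlDl.
  rewrite ltr_norml => /andP[_]; rewrite ltrD2l ltrN2 => rFy.
  case: Sy => /andP[ay yb] FPy.
  have : ((F y)%:E <= r%:E)%E.
    by apply: le_trans FPy _; apply: le_trans rE; exact: mPsi.
  by rewrite lee_fin leNgt rFy.
have [->//|nsb] := eqVneq b s.
have sltb : s < b by rewrite lt_neqAle eq_sym nsb.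
have [y /andP[sy yb] Fy] := step s as_ sltb Fs.
have : y <= s by apply: ub_le_sup; [case: hS | split=> //; rewrite yb (le_trans as_ (ltW sy))].
by rewrite leNgt sy.
Qed.

Lemma is_derive_continuous F f : (forall x, is_derive x 1 F (f x)) -> continuous F.
Proof.
move=> dF x; apply: differentiable_continuous; apply/derivable1_diffP.
by have [] := dF x.
Qed.

(** The function [h] is replaced by a majorant built from open sets. Its superlevel sets [E n] at
    multiples of [eta] are enclosed in open sets [V n] of slightly larger measure, and [Psi y] adds
    [eta] times the measure of each [V n] up to [y]. An open set containing [x] contains a
    neighbourhood of [x], so just right of [x] the slope of [Psi] is at least [h x] rounded down to
    a multiple of [eta], while that of [F] is at most [f x + eta]. Real induction then compares [F]
    with [Psi] at a loss of [2 * eta] in slope. *)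
Lemma increment_le_integral (F f h : R -> R) a b : a <= b ->
  (forall x, is_derive x 1 F (f x)) -> (forall x, f x <= h x) ->
  (forall x, 0 <= h x) -> measurable_fun setT h ->
  ((F b - F a)%:E <= \int[mu]_(x in `[a, b]) (h x)%:E)%E.
Proof.
move=> ab dF fh h0 mh.
have cF := is_derive_continuous dF.
apply/lee_addgt0Pr => e e0.
(* The losses are [2 * eta * (b - a)] in slope and [eta] from the excess of the open sets. *)
have [eta eta0 etaE] : exists2 eta, 0 < eta & eta * (2 * (b - a) + 1) = e.
  have den0 : 0 < 2 * (b - a) + 1 by rewrite ltr_wpDl// mulr_ge0// subr_ge0.
  by exists (e / (2 * (b - a) + 1)); rewrite ?divr_gt0// divfK// gt_eqF.
pose E n := `[a, b]%classic `&` [set x | n.+1%:R * eta <= h x].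
have mE n : measurable (E n).
  apply: measurableI => //.
  rewrite (_ : [set x | _] = setT `&` h @^-1` `[n.+1%:R * eta, +oo[%classic).
    by apply: mh => //; exact: measurable_itv.
  by rewrite setTI; apply/seteqP; split => x /=; rewrite in_itv/= andbT.
have mab : (mu `[a, b]%classic = (b - a)%:E)%E.
  rewrite lebesgue_measure_itv/= lte_fin.
  case: ltP => // ba; have -> : b = a by apply/eqP; rewrite eq_le ba ab.
  by rewrite subrr.
have finE n : (mu (E n) < +oo)%E.
  apply: (@le_lt_trans _ _ (mu `[a, b]%classic)); last by rewrite mab ltry.
  apply: le_measureW; [exact: mE|exact: measurable_itv|by move=> x []].
have /choice[V HV] : forall n, exists U : set R, [/\ open U, E n `<=` U &
    (mu (U `\` E n) < (1 / (2 ^ n.+1)%:R)%:E)%E].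
  move=> n; apply: lebesgue_regularity_outer; [exact: mE|exact: finE|].
  by rewrite divr_gt0 ?ltr01 ?ltr0n ?expn_gt0.
have mO n : measurable (V n) by apply: open_measurable; case: (HV n).
have mVI n (i : interval R) : measurable (V n `&` [set` i]).
  by apply: measurableI; [exact: mO|exact: measurable_itv].
pose Psi y := (\sum_(0 <= n <oo) eta%:E * mu (V n `&` `[a, y]))%E.
have term0 n y : (0 <= eta%:E * mu (V n `&` `[a, y]))%E.
  by rewrite mule_ge0// lee_fin ltW.
have mPsi x y : a <= x -> x <= y -> y <= b -> (Psi x <= Psi y)%E.
  move=> ax xy yb; apply: lee_nneseries => // n _.
  apply: lee_wpmul2l; first by rewrite lee_fin ltW.
  apply: le_measureW; [exact: mVI|exact: mVI|].
  apply: setIS => z/=; rewrite !in_itv/= => /andP[-> zx]; exact: le_trans xy.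
have PsiD m x y : a <= x -> x <= y -> (forall n, (n < m)%N -> `]x, y] `<=` V n) ->
    (Psi x + (m%:R * eta * (y - x))%:E <= Psi y)%E.
  move=> ax xy Hm.
  have -> : Psi y = (Psi x + \sum_(0 <= n <oo) eta%:E * mu (V n `&` `]x, y]))%E.
    rewrite /Psi -nneseriesD//; last by move=> i _ _; rewrite mule_ge0// lee_fin ltW.
    apply: eq_eseriesr => n _; rewrite -ge0_muleDr//; congr (_ * _)%E.
    rewrite -measureU; [|exact: mVI|exact: mVI|].
      congr (mu _); rewrite -setIUr; congr (_ `&` _).
      rewrite -itv_bndbnd_setU//= ?bnd_simp//.
    apply/seteqP; split => // z/= [[_]]; rewrite !in_itv/= => /andP[_ zx] [_ /andP[xz _]].
    by move: xz; rewrite ltNge zx.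
  apply: leeD2l.
  apply: le_trans (@nneseries_lim_ge R (fun n => eta%:E * mu (V n `&` `]x, y]))%E
    xpredT 0%N m _); last by move=> *; rewrite mule_ge0// lee_fin ltW.
  rewrite big_mkord.
  under eq_bigr => n _.
    rewrite (_ : V n `&` `]x, y] = `]x, y]%classic); last first.
      by apply/setIidPr; exact: Hm.
    rewrite (_ : (mu `]x, y]%classic = (y - x)%:E)%E); last first.
      rewrite lebesgue_measure_itv/= lte_fin; case: ltP => // yx.
      have -> : y = x by apply/eqP; rewrite eq_le yx xy.
      by rewrite subrr.
    over.
  under eq_bigr => n _ do rewrite -EFinM.
  rewrite sumEFin sumr_const card_ord lee_fin -[leRHS]mulr_natl mulrA; exact: lexx.
have key : ((F b - F a - 2 * eta * (b - a))%:E <= Psi b)%E.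
  apply: (@real_induction_le (fun y => F y - F a - 2 * eta * (y - a)) Psi a b ab) => //.
  - move=> x; apply: cvgB; first by apply: cvgB; [exact: cF|exact: cvg_cst].
    by apply: cvgM; [exact: cvg_cst|apply: cvgB; [exact: cvg_id|exact: cvg_cst]].
  - by rewrite !subrr mulr0 subr0; apply: nneseries_ge0.
  move=> x ax xb Px.
  (* The point [x] lies in [V n] for every [n < m], so [Psi] gains at least [m * eta] per unit
     length just right of [x], whereas [f x <= h x < (m + 1) * eta]. *)
  pose m := Num.trunc (h x / eta).
  have /andP[m1 m2] : m%:R <= h x / eta < m.+1%:R.
    by apply: truncn_itv; rewrite divr_ge0// ltW.
  have nO : \forall y \near x, forall n, (n < m)%N -> V n y.
    apply: near_forall_ltn => n nm.
    have [oO EO _] := HV n.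
    apply: open_nbhs_nbhs; split => //; apply: EO; split.
      by rewrite /= in_itv/= ax ltW.
    rewrite /= -ler_pdivlMr//; apply: le_trans m1; by rewrite ler_nat.
  have [d1 d10 nF] := is_derive_near (dF x) eta0.
  move: nO => /nbhs_ballP[d2 /= d20 nO].
  pose d := Num.min d1 d2.
  have d0 : 0 < d by rewrite lt_min d10.
  pose y := Num.min b (x + d / 2).
  have xy : x < y by rewrite lt_min xb/= ltrDl divr_gt0.
  have yb : y <= b by rewrite ge_min lexx.
  have yd : y < x + d.
    rewrite gt_min; apply/orP; right; rewrite ltrD2l; lra.
  exists y; first by rewrite xy.
  have Bz z : x <= z -> z <= y -> `|z - x| < d.
    move=> xz zy; rewrite ger0_norm ?subr_ge0// ltrBlDl.
    exact: le_lt_trans zy yd.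
  have := nF y (lt_le_trans (Bz _ (ltW xy) (lexx _)) _).
  rewrite ge_min lexx => /(_ isT).
  have yx0 : 0 <= y - x by rewrite subr_ge0 ltW.
  rewrite ler_norml => /andP[_]; rewrite (ger0_norm yx0) => Fy.
  apply: (le_trans _ (PsiD m x y ax (ltW xy) _)); last first.
    move=> n nm z/=; rewrite in_itv/= => /andP[xz zy].
    apply: nO nm; rewrite /ball/= distrC.
    by apply: lt_le_trans (Bz _ (ltW xz) zy) _; rewrite ge_min lexx orbT.
  apply: (@le_trans _ _ ((F x - F a - 2 * eta * (x - a))%:E + (m%:R * eta * (y - x))%:E)%E).
    rewrite -EFinD lee_fin.
    have hx : f x <= m.+1%:R * eta.
      by apply: le_trans (fh x) _; rewrite -ler_pdivrMr// ltW.
    have : f x * (y - x) <= (m%:R + 1) * eta * (y - x).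
      by rewrite ler_pM2r ?subr_gt0// natr1.
    move: Fy; lra.
  by rewrite leeD2r.
(* The excess of [V n] over [E n] is below [1 / 2 ^ (n + 1)], which costs at most [eta] in total;
   the sets [E n] themselves are layers under [h]. *)
have Psib : (Psi b <= \int[mu]_(x in `[a, b]) (h x)%:E + eta%:E)%E.
  apply: (@le_trans _ _ (\sum_(0 <= n <oo) (eta%:E * mu (E n) + (eta / (2 ^ n.+1)%:R)%:E))%E).
    apply: lee_nneseries => // n _.
    rewrite -[X in (_ + X)%E](_ : (eta%:E * (1 / (2 ^ n.+1)%:R)%:E)%E = _); last first.
      by rewrite -EFinM mul1r.
    rewrite -ge0_muleDr ?lee_fin ?divr_ge0//; apply: lee_wpmul2l; first by rewrite lee_fin ltW.
    have [oO EO dO] := HV n.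
    apply: (@le_trans _ _ (mu (E n `|` (V n `\` E n)))).
      apply: le_measureW; [exact: mVI|apply: measurableU|].
      - exact: mE.
      - by apply: measurableD; [exact: mO|exact: mE].
      by move=> z [Vz _]; have [Ez|Ez] := pselect (E n z); [left|right].
    apply: le_trans (measureU2 _ _ _) _.
    - exact: mE.
    - by apply: measurableD; [exact: mO|exact: mE].
    by apply: leeD2l; exact: ltW.
  apply: le_trans (epsilon_trick _ _ _) _.
  - by move=> n; rewrite mule_ge0// lee_fin ltW.
  - exact: ltW.
  rewrite leeD2r//.
  have -> : (\sum_(0 <= n <oo) eta%:E * mu (E n) =
    \sum_(0 <= n <oo) \int[mu]_(x in `[a,b]) ((eta * (n.+1%:R * eta <= h x)%R%:R)%:E))%E.
    apply: eq_eseriesr => n _.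
    rewrite (_ : (mu (E n) = \int[mu]_(x in `[a, b]) (\1_(E n) x)%:E)%E); last first.
      rewrite integral_indic; try exact: measurable_itv; try exact: mE.
      rewrite (_ : E n `&` `[a, b] = E n)//.
      by apply/seteqP; split => [z []//|z Ez]; split=> //; case: Ez.
    rewrite -ge0_integralZl_EFin//; last 2 first.
    - by apply/measurable_EFinP; apply: measurable_indic; exact: mE.
    - exact: ltW.
    apply: eq_integral => x; rewrite inE/= => xab.
    rewrite -EFinM indicE; congr (eta * _)%:E.
    by congr (_%:R); congr nat_of_bool; apply/idP/idP; rewrite inE => //; case.
  have mterm n : measurable_fun (`[a, b]%classic : set R)
      (fun x => (eta * (n.+1%:R * eta <= h x)%R%:R)%:E).
    apply/measurable_EFinP; apply: measurable_funM => //.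
    rewrite (_ : (fun x => _) = (fun x => \1_([set x | n.+1%:R * eta <= h x]) x)); last first.
      by apply/funext => x; rewrite indicE; congr (_%:R); congr nat_of_bool; apply/idP/idP; rewrite inE.
    apply: measurable_indic.
    rewrite (_ : [set x | _] = setT `&` h @^-1` `[n.+1%:R * eta, +oo[%classic).
      by apply: mh => //; exact: measurable_itv.
    by rewrite setTI; apply/seteqP; split => x /=; rewrite in_itv/= andbT.
  rewrite -integral_nneseries//; last first.
    by move=> n x _; rewrite lee_fin mulr_ge0// ltW.
  apply: ge0_le_integral => //.
  - by move=> x _; apply: nneseries_ge0 => n _ _; rewrite lee_fin mulr_ge0// ltW.
  - apply: ge0_emeasurable_sum => [n x *|n _]; last exact: mterm.
    by rewrite lee_fin mulr_ge0// ltW.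
  - by apply/measurable_EFinP; exact: measurable_funTS.
  move=> x _; apply: lime_le.
    by apply: is_cvg_nneseries => n _ _; rewrite lee_fin mulr_ge0// ltW.
  apply: nearW => N; rewrite big_mkord sumEFin lee_fin.
  by apply: floor_layers_le => //; exact: ltW.
have : ((F b - F a)%:E <= \int[mu]_(x in `[a, b]) (h x)%:E + eta%:E + (2 * eta * (b - a))%:E)%E.
  rewrite -leeBlDr//; apply: le_trans Psib; apply: le_trans key.
  by rewrite -EFinB.
move=> /le_trans; apply; rewrite -addeA leeD2l// -EFinD lee_fin.
move: etaE; lra.
Qed.

End FundamentalTheorem.

(** * Integrals of derivatives over an interval and over the line *)

Section FTC.
Context {R : realType}.
Implicit Types (F f h G g : R -> R) (a b x y : R).
Local Notation mu := (@lebesgue_measure R).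

Lemma Rintegrable_measurable f : Rintegrable f -> measurable_fun setT f.
Proof. by move=> /integrableP[/measurable_EFinP]. Qed.

Lemma le_Rintegrable f g : measurable_fun setT f -> Rintegrable g ->
  (forall x, `|f x| <= g x) -> Rintegrable f.
Proof.
move=> mf ig fg; apply: (le_integrable _ _ _ ig) => //.
  exact/measurable_EFinP.
by move=> x _ /=; rewrite lee_fin (le_trans (fg x))// ler_norm.
Qed.

Lemma lebesgue_measure_cc a b : a <= b -> (mu `[a, b]%classic = (b - a)%:E)%E.
Proof.
move=> ab; rewrite lebesgue_measure_itv/= lte_fin.
case: ltP => // ba; have -> : b = a by apply/eqP; rewrite eq_le ba ab.
by rewrite subrr.
Qed.

(** Truncation from below reduces to the nonnegative case: [max (f x) (- n) + n] is nonnegative and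
    dominates the derivative of [F z + n * z]. Dominated convergence with majorant [|f|] removes the
    truncation. *)
Lemma increment_le_integrable F f a b : a <= b ->
  (forall x, is_derive x 1 F (f x)) -> Rintegrable f ->
  ((F b - F a)%:E <= \int[mu]_(x in `[a, b]) (f x)%:E)%E.
Proof.
move=> ab dF If.
have mf := Rintegrable_measurable If.
pose fn (n : nat) x := Num.max (f x) (- n%:R).
have mfn n : measurable_fun setT (fn n) by exact: measurable_maxr.
have fnf n x : `|fn n x| <= `|f x|.
  rewrite /fn; case: (leP (f x) (- n%:R)) => // fx.
  have : n%:R <= - f x by rewrite lerNr.
  by rewrite normrN ger0_norm// -(normrN (f x)) => /le_trans; apply; exact: ler_norm.
have Ifab : mu.-integrable `[a, b] (EFin \o f).
  by apply: integrableS If => //; exact: measurable_itv.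
have Ifn n : mu.-integrable `[a, b] (EFin \o fn n).
  apply: (le_integrable _ _ _ Ifab) => //.
  - by apply/measurable_EFinP; apply: measurable_funTS; exact: mfn.
  - by move=> x _; rewrite /= lee_fin; exact: fnf.
have cstab (c : R) : mu.-integrable `[a, b] (EFin \o (cst c : R -> R)).
  apply/integrableP; split; first by apply/measurable_EFinP; exact: measurable_cst.
  rewrite /= integral_cst; last exact: measurable_itv.
  rewrite [X in (_ * X < _)%E](_ : _ = (b - a)%:E); last exact: lebesgue_measure_cc.
  by rewrite -EFinM ltry.
have bnd n : ((F b - F a)%:E <= \int[mu]_(x in `[a, b]) (fn n x)%:E)%E.
  have dFn x : is_derive x 1 (fun z => F z + n%:R * z) (f x + n%:R).
    apply: is_deriveD.
    rewrite -[X in is_derive _ _ _ X](_ : n%:R *: (1 : R) = n%:R); last exact: mulr1.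
    exact: is_deriveZ.
  have := increment_le_integral ab dFn (h := fun x => fn n x + n%:R).
  move=> /(_ _ _ _)-H.
  have {}H : (((F b + n%:R * b) - (F a + n%:R * a))%:E <=
      \int[mu]_(x in `[a, b]) (fn n x + n%:R)%:E)%E.
    apply: H.
    - by move=> x; rewrite lerD2r le_max lexx.
    - by move=> x; rewrite -lerBlDr sub0r le_max lexx orbT.
    - by apply: measurable_funD; [exact: mfn|exact: measurable_cst].
  have E : (\int[mu]_(x in `[a, b]) (fn n x + n%:R)%:E =
     \int[mu]_(x in `[a, b]) (fn n x)%:E + \int[mu]_(x in `[a, b]) (n%:R)%:E)%E.
    have := @integralD_EFin _ _ R mu _ (measurable_itv _) _ _ (Ifn n) (cstab n%:R).
    exact.
  move: H; rewrite E integral_cst; last exact: measurable_itv.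
  rewrite [X in (_ + _ * X)%E](_ : _ = (b - a)%:E); last exact: lebesgue_measure_cc.
  rewrite -EFinM -leeBlDr// -EFinB.
  by apply: le_trans; rewrite lee_fin; lra.
have [] := @dominated_convergence _ _ _ mu `[a, b]%classic _ (fun n => EFin \o fn n)
    (EFin \o f) (EFin \o (fun x => `|f x|)).
- exact: measurable_itv.
- by move=> n; apply/measurable_EFinP; apply: measurable_funTS; exact: mfn.
- by apply/measurable_EFinP; exact: measurable_funTS.
- apply: aeW => x _; apply: cvg_near_cst.
  near=> n; rewrite /= /fn; congr EFin; apply/max_idPl.
  rewrite lerNl; near: n; exact: nbhs_infty_ger.
- exact: integrable_norm.
- by apply: aeW => x n _ /=; rewrite lee_fin; exact: fnf.
move=> _ _ cv.
apply: (cvge_ge _ cv); exact: nearW.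
Unshelve. all: by end_near. Qed.

Lemma FTC_integrable F f a b : a <= b ->
  (forall x, is_derive x 1 F (f x)) -> Rintegrable f ->
  (\int[mu]_(x in `[a, b]) (f x)%:E = (F b - F a)%:E)%E.
Proof.
move=> ab dF If; apply/eqP; rewrite eq_le increment_le_integrable// andbT.
have dNF x : is_derive x 1 (fun z => - F z) (- f x) by exact: is_deriveN.
have INf : Rintegrable (fun x => - f x).
  by have := integrableN If; apply: eq_integrable.
have := increment_le_integrable ab dNF INf.
have Ifab : mu.-integrable `[a, b] (EFin \o f).
  by apply: integrableS If => //; exact: measurable_itv.
have -> : (\int[mu]_(x in `[a, b]) (- f x)%:E = - \int[mu]_(x in `[a, b]) (f x)%:E)%E.
  by rewrite -integralN//; apply: integrable_add_def => //; exact: measurable_itv.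
by move=> H; rewrite -leeN2 -EFinN; apply: le_trans H; rewrite lee_fin; lra.
Qed.

(** Otherwise [|G| >= e] on intervals of arbitrary length, and its integral would be infinite. The
    sign [s] treats both ends of the line at once. *)
Lemma integrable_small_far G (K e : R) (s : R) : Rintegrable G -> 0 < e ->
  s = 1 \/ s = -1 -> exists2 x, K <= s * x & `|G x| < e.
Proof.
move=> IG e0 s1; apply: contrapT => H.
have {}H x : K <= s * x -> e <= `|G x|.
  by move=> Kx; rewrite leNgt; apply/negP => Gx; apply: H; exists x.
have iN := integrable_norm IG.
have fin : (\int[mu]_x `|(G x)%:E| < +oo)%E by case/integrableP: IG.
have lower (n : nat) : ((e * n%:R)%:E <= \int[mu]_x `|(G x)%:E|)%E.
  pose I : set R := if s == 1 then `[K, K + n%:R]%classic else `[- K - n%:R, - K]%classic.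
  have mI : measurable I by rewrite /I; case: ifP => _; exact: measurable_itv.
  have muI : (mu I = n%:R%:E)%E.
    rewrite /I; case: ifP => _; rewrite lebesgue_measure_cc ?lerDl ?gerBl//.
      by congr (_%:E); lra.
    by congr (_%:E); lra.
  have KI x : I x -> K <= s * x.
    rewrite /I; case: s1 => ->; rewrite ?eqxx.
      by rewrite /= in_itv/= mul1r => /andP[].
    rewrite (_ : (-1 == 1 :> R) = false); last by apply/eqP; lra.
    by rewrite /= in_itv/= mulN1r => /andP[_]; rewrite lerNr.
  apply: (@le_trans _ _ (\int[mu]_(x in I) `|(G x)%:E|)%E); last first.
    apply: ge0_subset_integral => //.
    by apply: measurableT_comp => //; case/integrableP: IG.
  rewrite EFinM -muI -(integral_cst mu mI).
  apply: ge0_le_integral => //.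
  - by move=> x _; rewrite lee_fin ltW.
  - apply: measurable_funTS; apply: measurableT_comp => //; by case/integrableP: IG.
  - by move=> x /KI /H; rewrite /= lee_fin.
case E : (\int[mu]_x `|(G x)%:E|)%E fin lower => [r| |] // _ lower; last first.
  by have := lower 0%N.
have r0 : 0 <= r by have := lower 0%N; rewrite mulr0 lee_fin.
have := lower (Num.trunc (r / e)).+1; rewrite lee_fin mulrC -ler_pdivlMr// leNgt.
by have /andP[_ ->] := truncn_itv (divr_ge0 r0 (ltW e0)).
Qed.

(** Integrability of [G] does the work of a limit at infinity: it yields endpoints [a n <= - n] and
    [b n >= n] at which [|G|] is below [1 / (n + 1)], so the increments of [G] over [[a n, b n]]
    tend to 0. *)
Lemma Rint_derive_eq0 G g : (forall x, is_derive x 1 G (g x)) ->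
  Rintegrable G -> Rintegrable g -> Defs.Rint g = 0.
Proof.
move=> dG IG Ig.
have mg := Rintegrable_measurable Ig.
have e0 n : 0 < n.+1%:R^-1 :> R by rewrite invr_gt0 ltr0n.
have /choice[b Hb] : forall n : nat, exists x, n%:R <= x /\ `|G x| < n.+1%:R^-1.
  move=> n; have [x] := integrable_small_far n%:R IG (e0 n) (or_introl erefl).
  by rewrite mul1r; exists x.
have /choice[a Ha] : forall n : nat, exists x, x <= - n%:R /\ `|G x| < n.+1%:R^-1.
  move=> n; have [x] := integrable_small_far n%:R IG (e0 n) (or_intror erefl).
  by rewrite mulN1r lerNr; exists x.
have ab n : a n <= b n.
  have [+ _] := Ha n; have [+ _] := Hb n; have : 0 <= n%:R :> R by [].
  lra.
have mi n : measurable (`[a n, b n]%classic : set R) by exact: measurable_itv.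
have [] := @dominated_convergence _ _ _ mu setT measurableT
    (fun n => (EFin \o g) \_ (`[a n, b n]%classic))
    (EFin \o g) (EFin \o (fun x => `|g x|)).
- move=> n; apply/(measurable_restrictT _ _).1 => //.
  by apply/measurable_EFinP; exact: measurable_funTS.
- exact/measurable_EFinP.
- apply: aeW => x _.
  apply: cvg_near_cst.
  near=> n; rewrite /patch ifT// inE/= in_itv/=.
  have [Hbn _] := Hb n; have [Han _] := Ha n.
  have xn : `|x| <= n%:R by near: n; exact: nbhs_infty_ger.
  apply/andP; split.
    by apply: le_trans Han _; rewrite lerNl (le_trans _ xn)// -normrN ler_norm.
  by apply: le_trans Hbn; rewrite (le_trans _ xn)// ler_norm.
- exact: integrable_norm.
- apply: aeW => x n _; rewrite /patch; case: ifP => _ /=; rewrite ?lee_fin//.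
  by rewrite ?normr0 ?abse0 ?lee_fin.
move=> _ _ cv.
have cv0 : (\int[mu]_x ((EFin \o g) \_ (`[a n, b n]%classic)) x)%E @[n --> \oo] --> 0%E.
  have E n : (\int[mu]_x ((EFin \o g) \_ (`[a n, b n]%classic)) x = (G (b n) - G (a n))%:E)%E.
    by rewrite -integral_mkcond; exact: FTC_integrable.
  under eq_fun do rewrite E.
  apply: cvg_EFin; first exact: nearW.
  apply/cvgr0Pnorm_le => e e1; near=> n.
  have [_ Hbn] := Hb n; have [_ Han] := Ha n.
  apply: le_trans (ler_normB _ _) _.
  have : n.+1%:R^-1 <= e / 2.
    rewrite -[leRHS]invrK lef_pV2 ?posrE ?invr_gt0 ?divr_gt0 ?ltr0n//.
    apply: (@le_trans _ _ n%:R); last by rewrite ler_nat.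
    by near: n; exact: nbhs_infty_ger.
  by move=> H; rewrite [leRHS]splitr lerD// (le_trans _ H)// ltW.
have := cvg_unique _ cv cv0; rewrite /Defs.Rint => /(_ _) ->//.
Unshelve. all: by end_near. Qed.

End FTC.

(** * Componentwise calculus for complex functions of a real variable *)

Section ComplexCalculus.
Context {R : realType}.
Implicit Types (z w : R[i]) (f g S : R -> R[i]).

Lemma cre_mul z w : cre (z * w) = cre z * cre w - cim z * cim w.
Proof. by case: z; case: w. Qed.

Lemma cim_mul z w : cim (z * w) = cre z * cim w + cim z * cre w.
Proof. by case: z; case: w => * /=; ring. Qed.

Lemma cre_add z w : cre (z + w) = cre z + cre w.
Proof. by case: z; case: w. Qed.

Lemma cim_add z w : cim (z + w) = cim z + cim w.
Proof. by case: z; case: w. Qed.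

Lemma cre_sub z w : cre (z - w) = cre z - cre w.
Proof. by case: z; case: w. Qed.

Lemma cim_sub z w : cim (z - w) = cim z - cim w.
Proof. by case: z; case: w. Qed.

Definition cE := (cre_sub, cim_sub, cre_mul, cim_mul, cre_add, cim_add).

Lemma cabs_ge0 z : 0 <= cabs z. Proof. exact: sqrtr_ge0. Qed.

Lemma sqr_cabs z : cabs z ^+ 2 = cre z ^+ 2 + cim z ^+ 2.
Proof. by rewrite sqr_sqrtr// addr_ge0 ?sqr_ge0. Qed.

Lemma cre_le_cabs z : `|cre z| <= cabs z.
Proof. by rewrite -sqrtr_sqr ler_wsqrtr// lerDl sqr_ge0. Qed.

Lemma cim_le_cabs z : `|cim z| <= cabs z.
Proof. by rewrite -sqrtr_sqr ler_wsqrtr// lerDr sqr_ge0. Qed.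

Lemma cabs_mul z w : cabs (z * w) = cabs z * cabs w.
Proof.
rewrite /cabs -sqrtrM ?addr_ge0 ?sqr_ge0// !cE; congr Num.sqrt; ring.
Qed.

Lemma cabs_conj z : cabs (cconj z) = cabs z.
Proof. by rewrite /cabs /= sqrrN. Qed.

Lemma cabs_cexpi (a : R) : cabs (cexpi a) = 1.
Proof. by rewrite /cabs /= cos2Dsin2 sqrtr1. Qed.

Lemma cabs_cR (a : R) : cabs (cR a) = `|a|.
Proof. by rewrite /cabs /= expr0n addr0 sqrtr_sqr. Qed.

Lemma cabs0_eq z : cabs z <= 0 -> z = 0.
Proof.
move=> z0; have : cabs z ^+ 2 = 0.
  by have -> : cabs z = 0 by [apply/eqP; rewrite eq_le z0 cabs_ge0]; rewrite expr0n.
move/eqP; rewrite sqr_cabs paddr_eq0 ?sqr_ge0// !sqrf_eq0 => /andP[/eqP a /eqP b].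
by case: z a b {z0} => a b /= -> ->.
Qed.

Lemma cderivM f f' g g' : cderiv f f' -> cderiv g g' ->
  cderiv (fun y => f y * g y) (fun y => f' y * g y + f y * g' y).
Proof.
move=> df dg y; have [f1 f2] := df y; have [g1 g2] := dg y; split.
- rewrite (_ : (fun z : R => _) = ((fun z : R => cre (f z)) * (fun z : R => cre (g z)) -
    (fun z : R => cim (f z)) * (fun z : R => cim (g z)))); last by apply/funext => z; rewrite cE.
  apply: is_derive_eq; rewrite /GRing.scale/= !cE; ring.
- rewrite (_ : (fun z : R => _) = ((fun z : R => cre (f z)) * (fun z : R => cim (g z)) +
    (fun z : R => cim (f z)) * (fun z : R => cre (g z)))); last by apply/funext => z; rewrite cE.
  apply: is_derive_eq; rewrite /GRing.scale/= !cE; ring.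
Qed.

Lemma cderivB f f' g g' : cderiv f f' -> cderiv g g' ->
  cderiv (fun y => f y - g y) (fun y => f' y - g' y).
Proof.
move=> df dg y; have [f1 f2] := df y; have [g1 g2] := dg y; split.
- rewrite (_ : (fun z : R => _) = ((fun z : R => cre (f z)) - (fun z : R => cre (g z)))).
    by apply: is_derive_eq; rewrite cE.
  by apply/funext => z; rewrite cE.
- rewrite (_ : (fun z : R => _) = ((fun z : R => cim (f z)) - (fun z : R => cim (g z)))).
    by apply: is_derive_eq; rewrite cE.
  by apply/funext => z; rewrite cE.
Qed.

Lemma cderiv_conj f f' : cderiv f f' ->
  cderiv (fun y => cconj (f y)) (fun y => cconj (f' y)).
Proof. by move=> df y; have [f1 f2] := df y; split => //; exact: is_deriveN. Qed.

Lemma cderiv_cst z : cderiv (fun=> z) (fun=> 0).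
Proof. by move=> y; split; exact: is_derive_cst. Qed.

Lemma is_derive_mulr (a y : R) : is_derive y 1 (fun z : R => z * a) a.
Proof.
rewrite (_ : (fun z : R => z * a) = a *: (@id R)); last first.
  by apply/funext => z; rewrite /GRing.scale/= mulrC.
by apply: is_derive_eq; rewrite /GRing.scale/= mulr1.
Qed.

Lemma cderiv_scale f f' (a : R) : cderiv f f' ->
  cderiv (fun y => f (y * a)) (fun y => f' (y * a) * cR a).
Proof.
move=> df y; have [f1 f2] := df (y * a); split.
- refine (@is_derive_eq _ _ _ _ _ _ _ _ (@is_derive1_comp _ (fun z : R => cre (f z)) (fun z : R => z * a) y _ _ f1 (is_derive_mulr a y)) _).
  by rewrite cE /= mulr0 subr0.
- refine (@is_derive_eq _ _ _ _ _ _ _ _ (@is_derive1_comp _ (fun z : R => cim (f z)) (fun z : R => z * a) y _ _ f2 (is_derive_mulr a y)) _).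
  by rewrite cE /= mulr0 add0r.
Qed.

Lemma cderiv_cexpi : cderiv (@cexpi R) (fun y => Complex (- sin y) (cos y)).
Proof. by move=> y; split; [exact: is_derive_cos|exact: is_derive_sin]. Qed.

Lemma cderiv_continuous f f' : cderiv f f' ->
  continuous (fun y => cre (f y)) /\ continuous (fun y => cim (f y)).
Proof.
move=> df; split.
  by apply: (@is_derive_continuous _ _ (fun y => cre (f' y))) => y; case: (df y).
by apply: (@is_derive_continuous _ _ (fun y => cim (f' y))) => y; case: (df y).
Qed.

(* The scalar mean value theorem is applied to the component of [f] along
   [f b - f a]. *)
Lemma cabs_mean_value f f' (M a b : R) : cderiv f f' ->
  (forall y, cabs (f' y) <= M) -> cabs (f b - f a) <= M * `|b - a|.
Proof.
move=> df fM.
wlog ab : a b / a <= b.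
  move=> H; have [|ba] := leP a b; first exact: H.
  rewrite -(cabs_conj (f b - f a)) (_ : cabs (cconj _) = cabs (f a - f b)).
    by rewrite distrC; apply: H; exact: ltW.
  rewrite /cabs; congr Num.sqrt; rewrite /= !cE; ring.
set z := f b - f a.
pose phi (y : R) := cre z * cre (f y) + cim z * cim (f y).
pose phi' (y : R) := cre z * cre (f' y) + cim z * cim (f' y).
have dphi (y : R) : is_derive y 1 phi (phi' y).
  have [f1 f2] := df y.
  have -> : phi = cre z *: (fun y : R => cre (f y)) + cim z *: (fun y : R => cim (f y)) by [].
  exact: is_derive_eq.
have cphi := is_derive_continuous dphi.
have [c _ E] := MVT_segment ab (fun x _ => dphi x) (continuous_subspaceT cphi).
have E2 : phi b - phi a = cabs z ^+ 2.
  by rewrite sqr_cabs /phi /z !cE; ring.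
have CS : phi' c <= cabs z * M.
  apply: (@le_trans _ _ (cabs z * cabs (f' c))); last by rewrite ler_wpM2l ?cabs_ge0.
  rewrite -(cabs_conj (f' c)) -cabs_mul.
  apply: le_trans (cre_le_cabs _); apply: le_trans (ler_norm _).
  by rewrite cE /= /phi'; lra.
rewrite ger0_norm ?subr_ge0//.
have [->|z0] := eqVneq (cabs z) 0.
  by rewrite mulr_ge0 ?subr_ge0// (le_trans (cabs_ge0 (f' a)))//.
have zp : 0 < cabs z by rewrite lt_neqAle eq_sym z0 cabs_ge0.
rewrite -(ler_pM2l zp) -expr2 -E2 E mulrA ler_wpM2r// subr_ge0//.
Qed.

Lemma cexpi_lipschitz (y x x' : R) :
  cabs (cexpi (y * x) - cexpi (y * x')) <= `|y| * `|x - x'|.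
Proof.
apply: (le_trans (cabs_mean_value (M := 1) (y * x') (y * x) cderiv_cexpi _)).
  by move=> z; rewrite /cabs /= sqrrN addrC cos2Dsin2 sqrtr1.
by rewrite mul1r -mulrBr normrM.
Qed.

End ComplexCalculus.

(** * Integral estimates and measurability of derivatives *)

Section Rint.
Context {R : realType}.
Implicit Types (f g : R -> R).
Local Notation mu := (@lebesgue_measure R).

Lemma RintD f g : Rintegrable f -> Rintegrable g ->
  Defs.Rint (fun y => f y + g y) = Defs.Rint f + Defs.Rint g.
Proof. by move=> If Ig; exact: (RintegralD measurableT If Ig). Qed.

Lemma RintB f g : Rintegrable f -> Rintegrable g ->
  Defs.Rint (fun y => f y - g y) = Defs.Rint f - Defs.Rint g.
Proof. by move=> If Ig; exact: (RintegralB measurableT If Ig). Qed.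

Lemma RintZ (c : R) f : Rintegrable f ->
  Defs.Rint (fun y => c * f y) = c * Defs.Rint f.
Proof. by move=> If; exact: (RintegralZl c measurableT If). Qed.

Lemma RintegrableD f g : Rintegrable f -> Rintegrable g ->
  Rintegrable (fun y => f y + g y).
Proof. by move=> If Ig; exact: (integrableD measurableT If Ig). Qed.

Lemma RintegrableZ (c : R) f : Rintegrable f -> Rintegrable (fun y => c * f y).
Proof. by move=> If; exact: (integrableZl measurableT c If). Qed.

Lemma normr_Rint_le f g : measurable_fun setT f -> Rintegrable g ->
  (forall x, `|f x| <= g x) -> `|Defs.Rint f| <= Defs.Rint g.
Proof.
move=> mf Ig fg; have If := le_Rintegrable mf Ig fg.
apply: (le_trans (le_normr_Rintegral measurableT If)).
by apply: le_Rintegral => //; exact: integrable_norm.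
Qed.

(** A derivative is the pointwise limit of the difference quotients with step [1 / (n + 1)], each of
    which is continuous. *)
Lemma is_derive_measurable f g : (forall x : R, is_derive x 1 f (g x)) ->
  measurable_fun setT g.
Proof.
move=> df; have cf := is_derive_continuous df.
apply: (@measurable_fun_cvg _ _ R setT
  (fun (n : nat) (y : R) => n.+1%:R * (f (y + n.+1%:R^-1) - f y)) g).
  move=> n; apply: continuous_measurable_fun => y.
  apply: cvgM; first exact: cvg_cst.
  apply: cvgB; last exact: cf.
  apply: (continuous_comp (f := fun y : R => y + n.+1%:R^-1)); last exact: cf.
  by apply: cvgD; [exact: cvg_id|exact: cvg_cst].
move=> y _; apply/cvgrPdist_le => e e0.
have [d d0 Hd] := is_derive_near (df y) e0.
near=> n.
have n0 : 0 < n.+1%:R :> R by rewrite ltr0n.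
have nd : n.+1%:R^-1 < d.
  rewrite -[ltRHS]invrK ltf_pV2 ?posrE ?invr_gt0//.
  apply: (@le_lt_trans _ _ n%:R); last by rewrite ltr_nat.
  by near: n; exact: nbhs_infty_ger.
have := Hd (y + n.+1%:R^-1); rewrite addrAC subrr add0r gtr0_norm ?invr_gt0// => /(_ nd).
rewrite distrC -(ler_pM2l n0) -{1}(gtr0_norm n0) -normrM.
rewrite [n.+1%:R * (e * _)]mulrCA divff ?gt_eqF// mulr1 mulrBr.
by rewrite [n.+1%:R * (g y * _)]mulrCA divff ?gt_eqF// mulr1.
Unshelve. all: by end_near. Qed.

End Rint.

(** * Integration by parts for Fourier coefficients *)

Section FourierCoefficient.
Context {R : realType}.
Variables (f f' S S' : R -> R[i]).
Hypotheses (df : cderiv f f') (dS : cderiv S S').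

Let K (x y : R) : R[i] := f y * cconj (S y) * cexpi (y * x).

Let hterm (x y : R) : R := cim ((f' y * cconj (S y) + f y * cconj (S' y)) * cexpi (y * x)).

(** The phase contributes [i * x * K], whose imaginary part is [x] times the real part of [K]. This
    is why the imaginary part is differentiated in order to control the integral of the real
    part. *)
Lemma coefficient_derive (x y : R) :
  is_derive y 1 (fun y : R => cim (K x y)) (hterm x y + x * cre (K x y)).
Proof.
have d := cderivM (cderivM df (cderiv_conj dS)) (cderiv_scale x cderiv_cexpi).
have [_ d2] := d y; apply: (is_derive_eq d2).
by rewrite /hterm /K !cE /=; ring.
Qed.

Lemma coefficient_measurable x : measurable_fun setT (fun y => cre (K x y)).
Proof.
have d := cderivM (cderivM df (cderiv_conj dS)) (cderiv_scale x cderiv_cexpi).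
by apply: continuous_measurable_fun; have [] := cderiv_continuous d.
Qed.

Lemma cre_coefficient_le x y : `|cre (K x y)| <= cabs (f y) * cabs (S y).
Proof. by apply: le_trans (cre_le_cabs _) _; rewrite !cabs_mul cabs_cexpi mulr1 cabs_conj. Qed.

(** In the applications [kappa] is [|t|] or [|s - t|], and [sigma], [rho] are integrable majorants
    independent of time. *)
Variables (kappa : R) (rho sigma : R -> R).
Hypotheses (k0 : 0 <= kappa).
Hypotheses (Isigma : Rintegrable sigma) (fS : forall y, cabs (f y) * cabs (S y) <= kappa * sigma y).

Lemma coefficient_integrable x : Rintegrable (fun y => cre (K x y)).
Proof.
apply: (le_Rintegrable (coefficient_measurable x) (RintegrableZ kappa Isigma)) => y.
exact: le_trans (cre_coefficient_le x y) (fS y).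
Qed.

Lemma coefficient_bound0 x : `|Defs.Rint (fun y => cre (K x y))| <= kappa * Defs.Rint sigma.
Proof.
rewrite -RintZ//; apply: normr_Rint_le; first exact: coefficient_measurable.
  exact: RintegrableZ.
by move=> y; exact: le_trans (cre_coefficient_le x y) (fS y).
Qed.

Hypotheses (Irho : Rintegrable rho)
  (fS' : forall y, cabs (f' y) * cabs (S y) + cabs (f y) * cabs (S' y) <= kappa * rho y).

(** The derivative of the imaginary part of [K] has integral 0, so [x] times the integral of the
    real part is minus the integral of [hterm]. The gain [1 / |x|] is what makes the squared
    coefficients summable over the translation index. *)
Lemma coefficient_bound1 x : x != 0 ->
  `|Defs.Rint (fun y => cre (K x y))| <= kappa / `|x| * Defs.Rint rho.
Proof.
move=> x0; have x0' : 0 < `|x| by rewrite normr_gt0.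
have mG : measurable_fun setT (fun y => hterm x y + x * cre (K x y)).
  exact: (is_derive_measurable (coefficient_derive x)).
have mh : measurable_fun setT (hterm x).
  rewrite (_ : hterm x = (fun y => (hterm x y + x * cre (K x y)) - x * cre (K x y))).
    apply: measurable_funB => //; apply: measurable_funM => //.
    exact: coefficient_measurable.
  by apply/funext => y; rewrite addrK.
have hb y : `|hterm x y| <= kappa * rho y.
  apply: le_trans (fS' y); rewrite /hterm mulrDl cE.
  apply: le_trans (ler_normD _ _) _.
  apply: lerD; apply: le_trans (cim_le_cabs _) _;
    by rewrite !cabs_mul cabs_cexpi mulr1 cabs_conj.
have Ih : Rintegrable (hterm x).
  exact: (le_Rintegrable mh (RintegrableZ kappa Irho)).
have IK := coefficient_integrable x.
have IxK := RintegrableZ x IK.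
have IG : Rintegrable (fun y => cim (K x y)).
  apply: (le_Rintegrable _ (RintegrableZ kappa Isigma)) => [|y].
    apply: continuous_measurable_fun.
    exact: (is_derive_continuous (coefficient_derive x)).
  apply: le_trans (cim_le_cabs _) _.
  by rewrite !cabs_mul cabs_cexpi mulr1 cabs_conj.
have := Rint_derive_eq0 (coefficient_derive x) IG (RintegrableD Ih IxK).
rewrite RintD// RintZ// => /eqP; rewrite addr_eq0 => /eqP E.
rewrite mulrAC ler_pdivlMr// mulrC -normrM -normrN -E -RintZ//.
by apply: normr_Rint_le => //; exact: RintegrableZ.
Qed.

End FourierCoefficient.

Lemma cvg_sqr (R : realType) (T : Type) (F : set_system T) (FF : Filter F)
    (f : T -> R) (a : R) : f @ F --> a -> (fun x => f x ^+ 2) @ F --> a ^+ 2.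
Proof. by move=> fa; exact: (cvgM fa fa). Qed.

(** * Markov's inequality *)

Section Markov.
Context {d : measure_display} {Omega : measurableType d} {R : realType}.
Variable P : probability Omega R.
Implicit Types (g h G S U W : Omega -> R).

Lemma indic_leE (k : R) h w :
  \1_[set x | k <= h x] w = (k <= h w)%R%:R :> R.
Proof. by rewrite indicE; congr (_%:R); congr nat_of_bool; apply/idP/idP; rewrite inE. Qed.

Lemma measurable_set_ge g (k : R) : measurable_fun setT g ->
  measurable [set w | (k <= g w)%R].
Proof.
move=> mg; rewrite (_ : [set w | _] = setT `&` g @^-1` `[k, +oo[%classic).
  by apply: mg => //; exact: measurable_itv.
by rewrite setTI; apply/seteqP; split => x /=; rewrite in_itv/= andbT.
Qed.

Lemma measurable_set_gt g (k : R) : measurable_fun setT g ->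
  measurable [set w | (k < g w)%R].
Proof.
move=> mg; rewrite (_ : [set w | _] = setT `&` g @^-1` `]k, +oo[%classic).
  by apply: mg => //; exact: measurable_itv.
by rewrite setTI; apply/seteqP; split => x /=; rewrite in_itv/= andbT.
Qed.

Lemma integral_restrict_indic g (A : set Omega) :
  (\int[P]_(w in A) (g w)%:E = \int[P]_w (g w * \1_A w)%:E)%E.
Proof.
rewrite integral_mkcond; apply: eq_integral => w _.
rewrite /patch indicE; case: ifP => _ /=; by rewrite ?mulr1 ?mulr0.
Qed.

Lemma markov_ge g (k : R) : measurable_fun setT g -> (forall w, 0 <= g w) -> 0 < k ->
  (k%:E * P [set w | (k <= g w)%R] <= \int[P]_w (g w)%:E)%E.
Proof.
move=> mg g0 k0; have mA := measurable_set_ge k mg.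
rewrite -(integral_cst P mA).
apply: (@le_trans _ _ (\int[P]_(w in [set w | (k <= g w)%R]) (g w)%:E)%E).
  apply: ge0_le_integral => //.
  - by move=> w _; rewrite lee_fin ltW.
  - by apply/measurable_EFinP; exact: measurable_funTS.
apply: ge0_subset_integral => //; first exact/measurable_EFinP.
by move=> w _; rewrite lee_fin.
Qed.

End Markov.

Lemma near_lt_cvg0 (R : realType) (a : nat -> \bar R) (e : R) :
  (forall n, (0 <= a n)%E) -> a @ \oo --> 0%E -> 0 < e ->
  \forall n \near \oo, (a n < e%:E)%E.
Proof.
move=> a0 /fine_cvgP[fin cv] e0; have /cvgrPdist_lt/(_ _ e0) := cv => H.
near=> n.
have fn : a n \is a fin_num by near: n.
have : `|0 - fine (a n)| < e by near: n.
rewrite sub0r normrN => an; rewrite -(fineK fn) lte_fin.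
exact: le_lt_trans (ler_norm _) an.
Unshelve. all: by end_near. Qed.

(** * Independent, sub-Gaussian and orthonormal random variables *)

Section Probability.
Context {d : measure_display} {Omega : measurableType d} {R : realType}.
Variable P : probability Omega R.
Implicit Types (g h G S U W : Omega -> R).

(** The first [N] layers are full, [N] being the integer part of [y / eta], and the rest of [y] is
    below [eta]. *)
Lemma layer_cover (eta y : R) : 0 < eta -> 0 <= y ->
  (y%:E <= eta%:E + \sum_(0 <= n <oo) (eta * (n.+1%:R * eta <= y)%R%:R)%:E)%E.
Proof.
move=> eta0 y0; pose N := Num.trunc (y / eta).
have /andP[N1 N2] : N%:R <= y / eta < N.+1%:R.
  by apply: truncn_itv; rewrite divr_ge0// ltW.
have t0 n : (0 <= (eta * (n.+1%:R * eta <= y)%R%:R)%:E)%E.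
  by rewrite lee_fin mulr_ge0// ltW.
apply: le_trans (leeD2l _ (@nneseries_lim_ge R (fun n => (eta * (n.+1%:R * eta <= y)%R%:R)%:E)
  xpredT 0%N N (fun n _ _ => t0 n))).
rewrite big_mkord sumEFin -EFinD lee_fin.
rewrite (eq_bigr (fun=> eta)); last first.
  move=> i _; rewrite (_ : (i.+1%:R * eta <= y) = true) ?mulr1//.
  by rewrite -ler_pdivlMr// (le_trans _ N1)// ler_nat.
rewrite sumr_const card_ord -mulr_natl -{1}[eta]mul1r -mulrDl nat1r.
by rewrite -ler_pdivrMr// ltW.
Qed.

(* Layer-cake: the hypothesis on superlevel sets of [h] bounds the integral of
   [h * G] up to [eta] through [h <= eta + sum_n eta 1_{h >= (n+1) eta}]. *)
Lemma integral_mul_le_layers h G (c m : R) :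
  measurable_fun setT h -> measurable_fun setT G ->
  (forall w, 0 <= h w) -> (forall w, 0 <= G w) -> 0 <= c ->
  (forall k, (\int[P]_(w in [set w | (k <= h w)%R]) (G w)%:E <= c%:E * P [set w | (k <= h w)%R])%E) ->
  (\int[P]_w (G w)%:E <= c%:E)%E -> (\int[P]_w (h w)%:E <= m%:E)%E ->
  (\int[P]_w (h w * G w)%:E <= (c * m)%:E)%E.
Proof.
move=> mh mG h0 G0 c0 HG IG Ih; apply/lee_addgt0Pr => e e0.
have [eta eta0 etac] : exists2 eta, 0 < eta & eta * c <= e.
  exists (e / (c + 1)); first by rewrite divr_gt0// ltr_wpDl.
  rewrite mulrAC ler_pdivrMr ?ltr_wpDl// ler_pM2l// lerDl//.
pose A n := [set w | (n.+1%:R * eta <= h w)%R].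
have mA n : measurable (A n) by exact: measurable_set_ge.
have m1 n : measurable_fun setT (\1_(A n) : Omega -> R) by exact: measurable_indic.
have i0 n w : 0 <= \1_(A n) w :> R by rewrite indicE.
have cover w : ((h w * G w)%:E <= (eta * G w)%:E +
    \sum_(0 <= n <oo) (eta * (G w * \1_(A n) w))%:E)%E.
  have := layer_cover eta0 (h0 w) => /(lee_wpmul2l (x := (G w)%:E)).
  rewrite lee_fin => /(_ (G0 w)); rewrite -EFinM mulrC => /le_trans; apply.
  rewrite ge0_muleDr; [|by rewrite lee_fin ltW|].
  2: by apply: nneseries_ge0 => n _ _; rewrite lee_fin mulr_ge0// ltW.
  rewrite -EFinM [G w * eta]mulrC leeD2l// -nneseriesZl; last first.
    by move=> n _; rewrite lee_fin mulr_ge0// ltW.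
  apply: lee_nneseries => [n _ _|n _].
    by rewrite mule_ge0// lee_fin// mulr_ge0// ltW.
  by rewrite -EFinM lee_fin /A indic_leE mulrCA.
apply: (@le_trans _ _ (\int[P]_w ((eta * G w)%:E +
    \sum_(0 <= n <oo) (eta * (G w * \1_(A n) w))%:E))%E).
  apply: ge0_le_integral => //.
  - by move=> w _; rewrite lee_fin mulr_ge0.
  - by apply/measurable_EFinP; exact: measurable_funM.
  apply: emeasurable_funD.
    by apply/measurable_EFinP; exact: measurable_funM.
  apply: ge0_emeasurable_sum => [n w *|n _].
    by rewrite lee_fin mulr_ge0 ?mulr_ge0// ltW.
  by apply/measurable_EFinP; apply: measurable_funM => //; exact: measurable_funM.
rewrite ge0_integralD//; last 4 first.
- by move=> w _; rewrite lee_fin mulr_ge0// ltW.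
- by apply/measurable_EFinP; exact: measurable_funM.
- by move=> w _; apply: nneseries_ge0 => n _ _; rewrite lee_fin mulr_ge0 ?mulr_ge0// ltW.
- apply: ge0_emeasurable_sum => [n w *|n _].
    by rewrite lee_fin mulr_ge0 ?mulr_ge0// ltW.
  by apply/measurable_EFinP; apply: measurable_funM => //; exact: measurable_funM.
rewrite addeC; apply: leeD; last first.
  under eq_integral do rewrite EFinM.
  rewrite ge0_integralZl_EFin//; last 3 first.
  - by move=> w _; rewrite lee_fin.
  - exact/measurable_EFinP.
  - exact: ltW.
  apply: (@le_trans _ _ (eta%:E * c%:E)%E); last by rewrite -EFinM lee_fin.
  by apply: lee_wpmul2l => //; rewrite lee_fin ltW.
rewrite integral_nneseries//; last 2 first.
- by move=> n; apply/measurable_EFinP; apply: measurable_funM => //; exact: measurable_funM.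
- by move=> n w _; rewrite lee_fin mulr_ge0 ?mulr_ge0// ltW.
apply: (@le_trans _ _ (\sum_(0 <= n <oo) c%:E * \int[P]_w (eta * \1_(A n) w)%:E)%E).
  apply: lee_nneseries => [n _ _|n _].
    by apply: integral_ge0 => w _; rewrite lee_fin mulr_ge0 ?mulr_ge0// ltW.
  under eq_integral do rewrite EFinM.
  under [X in (_ <= _ * X)%E]eq_integral do rewrite EFinM.
  rewrite (@ge0_integralZl_EFin _ _ _ _ _ _ (fun w => (\1_(A n) w)%:E))//; last 2 first.
  - exact/measurable_EFinP.
  - exact: ltW.
  rewrite (@ge0_integralZl_EFin _ _ _ _ _ _ (fun w => (G w * \1_(A n) w)%:E))//; last 3 first.
  - by move=> w _; rewrite lee_fin mulr_ge0.
  - by apply/measurable_EFinP; exact: measurable_funM.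
  - exact: ltW.
  rewrite muleCA; apply: lee_wpmul2l; first by rewrite lee_fin ltW.
  rewrite -integral_restrict_indic integral_indic// setIT; exact: HG.
rewrite nneseriesZl; last first.
  by move=> n _; apply: integral_ge0 => w _; rewrite lee_fin mulr_ge0// ltW.
rewrite EFinM; apply: lee_wpmul2l; first by rewrite lee_fin.
apply: le_trans Ih; rewrite -integral_nneseries//; last 2 first.
- by move=> n; apply/measurable_EFinP; exact: measurable_funM.
- by move=> n w _; rewrite lee_fin mulr_ge0// ltW.
apply: ge0_le_integral => //.
- by move=> w _; apply: nneseries_ge0 => n _ _; rewrite lee_fin mulr_ge0// ltW.
- apply: ge0_emeasurable_sum => [n w *|n _].
    by rewrite lee_fin mulr_ge0// ltW.
  by apply/measurable_EFinP; exact: measurable_funM.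
- exact/measurable_EFinP.
move=> w _; apply: lime_le.
  by apply: is_cvg_nneseries => n _ _; rewrite lee_fin mulr_ge0// ltW.
apply: nearW => N; rewrite big_mkord sumEFin lee_fin.
under eq_bigr do rewrite /A indic_leE.
by apply: floor_layers_le => //; exact: ltW.
Qed.

Lemma measurable_prod_fun (I : eqType) (s : seq I) (F : I -> Omega -> R) :
  (forall i, measurable_fun setT (F i)) ->
  measurable_fun setT (fun w => \prod_(i <- s) F i w).
Proof.
move=> mF; elim: s => [|i s IH].
  by under eq_fun do rewrite big_nil; exact: measurable_cst.
by under eq_fun do rewrite big_cons; exact: measurable_funM.
Qed.

Lemma measurable_sum_fun (I : Type) (s : seq I) (F : I -> Omega -> R) :
  (forall i, measurable_fun setT (F i)) ->
  measurable_fun setT (fun w => \sum_(i <- s) F i w).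
Proof.
move=> mF; elim: s => [|i s IH].
  by under eq_fun do rewrite big_nil; exact: measurable_cst.
by under eq_fun do rewrite big_cons; exact: measurable_funD.
Qed.

(** Independence speaks of events, so functions (over [s1]) and events (over [s2]) are mixed to make
    an induction possible. The superlevel set of [f i (Z i)] at [k] is an event about [Z i]: it
    moves [i] from [s1] to [s2], and the layer bound converts these estimates into the factor
    [m i]. *)
Lemma independent_prod_le (I : eqType) (Z : I -> Omega -> R) (f : I -> R -> R) (m : I -> R) :
  mutually_independent P Z ->
  (forall i, measurable_fun setT (f i)) -> (forall i x, 0 <= f i x) ->
  (forall i, (\int[P]_w (f i (Z i w))%:E <= (m i)%:E)%E) ->
  forall (s1 s2 : seq I) (B : I -> set R), uniq (s1 ++ s2) ->
  (forall i, measurable (B i)) ->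
  (\int[P]_(w in \bigcap_(i in [set` s2]) (Z i @^-1` B i)) (\prod_(i <- s1) f i (Z i w))%:E
   <= (\prod_(i <- s1) m i * \prod_(i <- s2) fine (P (Z i @^-1` B i)))%:E)%E.
Proof.
move=> [mZ ind] mf f0 fm; have m0 i : 0 <= m i.
  by rewrite -lee_fin; apply: le_trans (fm i); apply: integral_ge0 => w _; rewrite lee_fin.
have mfZ i : measurable_fun setT (fun w => f i (Z i w)).
  by apply: measurableT_comp.
have mZB (B : I -> set R) i : measurable (B i) -> measurable (Z i @^-1` B i).
  by move=> mB; rewrite -[X in measurable X]setTI; exact: mZ.
have mcap (s2 : seq I) (B : I -> set R) : (forall i, measurable (B i)) ->
    measurable (\bigcap_(i in [set` s2]) (Z i @^-1` B i)).
  move=> mB; elim: s2 => [|i s2 IH].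
    by rewrite (_ : \bigcap_(i in _) _ = setT)//; apply/seteqP; split => // w _ i /=.
  rewrite (_ : \bigcap_(j in _) _ = (Z i @^-1` B i) `&` \bigcap_(j in [set` s2]) (Z j @^-1` B j)).
    by apply: measurableI => //; exact: mZB.
  apply/seteqP; split => w /= H.
    split; first by apply: H; rewrite /= inE eqxx.
    by move=> j /= js; apply: H; rewrite /= inE js orbT.
  by move=> j /=; rewrite inE => /predU1P[->|js]; [case: H|apply: H.2].
elim=> [|i s1 IH] s2 B /=.
  move=> us mB; under eq_integral do rewrite big_nil.
  rewrite integral_cst ?mul1e; last exact: mcap.
  by rewrite big_nil mul1r -ind// fineK// fin_num_measure//; exact: mcap.
move=> us mB; set C := \bigcap_(j in _) _.
set c := \prod_(j <- s1) m j * \prod_(j <- s2) fine (P (Z j @^-1` B j)).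
have c0 : 0 <= c.
  by apply: mulr_ge0; apply: prodr_ge0 => j _ //; exact: fine_ge0.
have us12 : uniq (s1 ++ s2) by case/andP: us.
have ni : i \notin s2.
  by case/andP: us; rewrite mem_cat negb_or => /andP[].
rewrite integral_restrict_indic.
have -> : (\int[P]_w (\prod_(j <- i :: s1) f j (Z j w) * \1_C w)%:E =
   \int[P]_w (f i (Z i w) * (\prod_(j <- s1) f j (Z j w) * \1_C w))%:E)%E.
  by apply: eq_integral => w _; rewrite big_cons mulrA.
rewrite big_cons -mulrA mulrC -/c.
have mG : measurable_fun setT (fun w => \prod_(j <- s1) f j (Z j w) * \1_C w).
  by apply: measurable_funM; [exact: measurable_prod_fun|apply: measurable_indic; exact: mcap].
apply: integral_mul_le_layers => //.
- by move=> w; rewrite mulr_ge0 ?prodr_ge0// indicE.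
(* [B'] differs from [B] only at [i], which is not in [s2], so the other events are unchanged. *)
- move=> k; pose B' j := if j == i then [set x | k <= f i x] else B j.
  have mB' j : measurable (B' j).
    rewrite /B'; case: ifP => // _.
    rewrite (_ : [set x | _] = setT `&` f i @^-1` `[k, +oo[%classic).
      by apply: mf => //; exact: measurable_itv.
    by rewrite setTI; apply/seteqP; split => x /=; rewrite in_itv/= andbT.
  have us' : uniq (s1 ++ i :: s2) by rewrite -cat_rcons -cats1 -catA uniq_catCA.
  have := IH (i :: s2) B' us' mB'.
  have BB j : j \in s2 -> B' j = B j.
    by move=> js; rewrite /B'; case: eqP => // ji; rewrite -ji js in ni.
  have EB : \prod_(j <- s2) fine (P (Z j @^-1` B' j)) = \prod_(j <- s2) fine (P (Z j @^-1` B j)).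
    by apply: eq_big_seq => j js; rewrite BB.
  rewrite big_cons EB.
  have -> : Z i @^-1` B' i = [set w | (k <= f i (Z i w))%R] by rewrite /B' eqxx.
  rewrite mulrCA -/c mulrC EFinM fineK; last first.
    by rewrite fin_num_measure//; exact: measurable_set_ge.
  move=> IHi; apply: (le_trans _ IHi).
  rewrite [leLHS]integral_restrict_indic [leRHS]integral_restrict_indic.
  rewrite le_eqVlt; apply/orP; left; apply/eqP; apply: eq_integral => w _; congr EFin; rewrite -mulrA; congr (_ * _).
  rewrite !indicE -natrM mulnb; congr (_%:R); congr nat_of_bool.
  rewrite -in_setI; congr (w \in _).
  apply/seteqP; split => x /=.
    move=> [Cx kx] j /=; rewrite inE => /predU1P[->|js]; first by rewrite /B' eqxx.
    by rewrite BB//; exact: Cx.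
  move=> H; split.
    by move=> j /= js; rewrite -BB//; apply: H => /=; rewrite inE js orbT.
  by have := H i; rewrite /= /B' eqxx; apply; rewrite inE eqxx.
- by rewrite -integral_restrict_indic; exact: IH.
Qed.

Lemma independent_mgf_le (I : eqType) (Z : I -> Omega -> R) (c : I -> R) (s : seq I) (lam : R) :
  mutually_independent P Z -> uniq s ->
  (forall i l, (\int[P]_w (expR (l * Z i w))%:E <= (expR (l ^+ 2 / 2))%:E)%E) ->
  (\int[P]_w (expR (lam * \sum_(i <- s) Z i w * c i))%:E <=
   (expR (lam ^+ 2 * (\sum_(i <- s) c i ^+ 2) / 2))%:E)%E.
Proof.
move=> ind us mgf.
have := @independent_prod_le I Z (fun i x => expR (lam * c i * x))
   (fun i => expR ((lam * c i) ^+ 2 / 2)) ind _ _ _ s [::] (fun=> setT) _ _.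
rewrite cats0 => /(_ _ _ _ us _)-H.
have {}H : (\int[P]_(w in \bigcap_(i in [set` [::]]) (Z i @^-1` setT))
  (\prod_(i <- s) expR (lam * c i * Z i w))%:E <=
  (\prod_(i <- s) expR ((lam * c i) ^+ 2 / 2) *
   \prod_(i <- [::]) fine (P (Z i @^-1` setT)))%:E)%E.
  apply: H => //.
  by move=> i; apply: measurableT_comp => //; exact: measurable_funM.
rewrite big_nil mulr1 in H.
rewrite (_ : \bigcap_(i in _) _ = setT) in H; last first.
  by apply/seteqP; split => // w _ i /=.
rewrite (_ : lam ^+ 2 * _ / 2 = \sum_(i <- s) (lam * c i) ^+ 2 / 2); last first.
  by rewrite mulr_sumr mulr_suml; apply: eq_bigr => i _; rewrite exprMn.
rewrite expR_sum; apply: (le_trans _ H); rewrite le_eqVlt; apply/orP; left; apply/eqP.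
apply: eq_integral => w _; congr EFin; rewrite -expR_sum; congr expR.
by rewrite mulr_sumr; apply: eq_bigr => i _; rewrite mulrAC mulrA.
Qed.

Lemma subgaussian_tail S (v r : R) : measurable_fun setT S -> 0 < v -> 0 < r ->
  (forall lam, (\int[P]_w (expR (lam * S w))%:E <= (expR (lam ^+ 2 * v / 2))%:E)%E) ->
  (P [set w | (r <= `|S w|)%R] <= (2 * expR (- (r ^+ 2 / (2 * v))))%:E)%E.
Proof.
move=> mS v0 r0 mgf.
have one (s : R) : s ^+ 2 = 1 -> (P [set w | (r <= s * S w)%R] <= (expR (- (r ^+ 2 / (2 * v))))%:E)%E.
  (* This [lam] minimizes [lam ^ 2 * v / 2 - lam * r], the exponent left by Markov's inequality. *)
  move=> s1; pose lam := r / v; have lam0 : 0 < lam by rewrite divr_gt0.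
  have mE : measurable_fun setT (fun w => expR (lam * s * S w)).
    by apply: measurableT_comp => //; exact: measurable_funM.
  have := markov_ge P mE (fun=> expR_ge0 _) (expR_gt0 (lam * r)).
  rewrite (_ : [set w | _] = [set w | (r <= s * S w)%R]); last first.
    by apply/seteqP; split => w /=; rewrite ler_expR -mulrA ler_pM2l.
  move=> /le_trans/(_ (mgf (lam * s))) H.
  rewrite -(@lee_pmul2l _ (expR (lam * r))%:E) ?lte_fin ?expR_gt0//.
  apply: le_trans H _; rewrite -EFinM -expRD lee_fin ler_expR exprMn s1 /lam.
  rewrite [leLHS](_ : _ = r / v * r + - (r ^+ 2 / (2 * v))) ?lexx//.
  by field; rewrite gt_eqF.
apply: (@le_trans _ _ (P ([set w | (r <= 1 * S w)%R] `|` [set w | (r <= -1 * S w)%R]))).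
  apply: le_measureW.
  - by apply: measurable_set_ge; exact: measurableT_comp.
  - by apply: measurableU; apply: measurable_set_ge; exact: measurable_funM.
  move=> w /=; rewrite mul1r mulN1r; have [Sw|Sw] := leP 0 (S w).
    by rewrite ger0_norm//; left.
  by rewrite ltr0_norm//; right.
apply: le_trans (measureU2 _ _ _) _.
- by apply: measurable_set_ge; exact: measurable_funM.
- by apply: measurable_set_ge; exact: measurable_funM.
rewrite mulr2n mulrDl mul1r EFinD; apply: leeD; apply: one.
  by rewrite expr1n.
by rewrite sqrrN expr1n.
Qed.

(** If [|W| >= r], then [|S n| >= r - eta] or [|W - S n| >= eta]. The first event has the
    sub-Gaussian tail, the second has small probability for large [n] by Chebyshev's inequality, and
    [eta] goes to 0 by continuity of the bound. *)
Lemma subgaussian_tail_limit W (S : nat -> Omega -> R) (v r : R) :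
  measurable_fun setT W -> (forall n, measurable_fun setT (S n)) -> 0 < v -> 0 < r ->
  (\forall n \near \oo, forall lam, (\int[P]_w (expR (lam * S n w))%:E <=
     (expR (lam ^+ 2 * v / 2))%:E)%E) ->
  (fun n => E2 P (fun w => W w - S n w)) @ \oo --> 0%E ->
  (P [set w | (r <= `|W w|)%R] <= (2 * expR (- (r ^+ 2 / (2 * v))))%:E)%E.
Proof.
move=> mW mS v0 r0 mgf cv.
have step eta : 0 < eta -> eta < r ->
    (P [set w | (r <= `|W w|)%R] <= (2 * expR (- ((r - eta) ^+ 2 / (2 * v))))%:E)%E.
  move=> eta0 etar; apply/lee_addgt0Pr => e e0.
  have e1 : (0 < (e * eta ^+ 2)%:E)%E by rewrite lte_fin mulr_gt0 ?exprn_gt0.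
  have small : \forall n \near \oo, (E2 P (fun w => (W w - S n w)%R) < (e * eta ^+ 2)%:E)%E.
    apply: near_lt_cvg0 => //.
    by move=> n; apply: integral_ge0 => w _; rewrite lee_fin sqr_ge0.
  have [n [Hn1 Hn2]] : exists n, (forall lam, (\int[P]_w (expR (lam * S n w))%:E <=
     (expR (lam ^+ 2 * v / 2))%:E)%E) /\ (E2 P (fun w => (W w - S n w)%R) < (e * eta ^+ 2)%:E)%E.
    near \oo => n; exists n; split; by near: n.
  have mWS : measurable_fun setT (fun w => (W w - S n w) ^+ 2).
    by apply: measurable_funX; exact: measurable_funB.
  apply: (@le_trans _ _ (P ([set w | (r - eta <= `|S n w|)%R] `|`
      [set w | (eta ^+ 2 <= (W w - S n w) ^+ 2)%R]))).
    apply: le_measureW.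
    - by apply: measurable_set_ge; exact: measurableT_comp.
    - apply: measurableU; apply: measurable_set_ge => //.
      by apply: measurableT_comp.
    move=> w /= rW; have [|SW] := leP (r - eta) `|S n w|; [by left|right].
    rewrite -[leRHS]real_normK ?num_real// ler_sqr ?nnegrE//; last exact: ltW.
    have : `|W w| <= `|W w - S n w| + `|S n w|.
      by rewrite (le_trans _ (ler_normD _ _))// subrK.
    move: rW SW; lra.
  apply: le_trans (measureU2 _ _ _) _.
  - by apply: measurable_set_ge; exact: measurableT_comp.
  - exact: measurable_set_ge.
  apply: leeD.
    by apply: subgaussian_tail => //; rewrite subr_gt0.
  rewrite -(@lee_pmul2l _ (eta ^+ 2)%:E) ?lte_fin ?exprn_gt0//.
  apply: le_trans (markov_ge P mWS (fun=> sqr_ge0 _) _) _; first exact: exprn_gt0.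
  by rewrite -EFinM mulrC ltW.
apply/lee_addgt0Pr => e e0.
pose f eta : R := 2 * expR (- ((r - eta) ^+ 2 / (2 * v))).
have cf : {for 0, continuous f}.
  apply: cvgM; first exact: cvg_cst.
  apply: (@cvg_comp _ _ _ (fun eta : R => - ((r - eta) ^+ 2 / (2 * v))) expR);
    last exact: continuous_expR.
  apply: cvgN; apply: cvgM; last exact: cvg_cst.
  by apply: cvg_sqr; apply: cvgB; [exact: cvg_cst|exact: cvg_id].
have /cvgrPdist_lt/(_ _ e0)/nbhs_ballP[dd /= dd0 H] := cf.
pose eta := Num.min (r / 2) (dd / 2).
have eta0 : 0 < eta by rewrite lt_min !divr_gt0.
have : eta < dd by rewrite gt_min; apply/orP; right; lra.
have : eta < r by rewrite gt_min; apply/orP; left; lra.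
move=> etar etad; apply: le_trans (step eta eta0 etar) _.
rewrite -EFinD lee_fin.
have := H eta; rewrite /ball/= sub0r normrN gtr0_norm// => /(_ etad).
rewrite /f subr0 distrC ltr_norml => /andP[_]; lra.
Unshelve. all: by end_near. Qed.

(** [tau] is an infimum, not attained by definition: the bound is taken at constants [a] slightly
    above [tau xi = 1] and passes to the limit. *)
Lemma strictly_subG_mgf (xi : Omega -> R) : strictly_sub_gaussian P xi ->
  E2 P xi = 1%E ->
  forall l, (\int[P]_w (expR (l * xi w))%:E <= (expR (l ^+ 2 / 2))%:E)%E.
Proof.
move=> [[mxi [a0 Ha0]] tau1] E1 l.
have {tau1} : tau P xi = 1 by rewrite tau1 E1/= sqrtr1.
rewrite /tau => tau1.
have lb : has_inf [set a | is_subG_const P xi a].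
  by split; [exists a0 | exists 0 => a []].
apply/lee_addgt0Pr => e e0.
pose f (x : R) : R := expR (l ^+ 2 * (1 + x) ^+ 2 / 2).
have cf : {for 0, continuous f}.
  apply: (@cvg_comp _ _ _ (fun x : R => l ^+ 2 * (1 + x) ^+ 2 / 2) expR);
    last exact: continuous_expR.
  apply: cvgM; last exact: cvg_cst.
  apply: cvgM; first exact: cvg_cst.
  by apply: cvg_sqr; apply: cvgD; [exact: cvg_cst|exact: cvg_id].
have /cvgrPdist_lt/(_ _ e0)/nbhs_ballP[dd /= dd0 H] := cf.
have [a [a1 Ha] alt] := inf_adherent dd0 lb.
rewrite tau1 in alt.
have a1' : 1 <= a by rewrite -tau1; apply: ge_inf; [case: lb|split].
apply: le_trans (Ha l) _; rewrite -EFinD lee_fin.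
have := H (a - 1); rewrite /ball/= sub0r normrN ger0_norm ?subr_ge0// ltrBlDl => /(_ alt).
rewrite /f addr0 expr1n mulr1 (addrC 1) subrK distrC ltr_norml => /andP[_]; lra.
Qed.

Lemma E2_orthonormal (I : eqType) (Z : I -> Omega -> R) (c : I -> R) (s : seq I) :
  (forall i, measurable_fun setT (Z i)) ->
  (forall i j, (\int[P]_w (Z i w * Z j w)%:E = ((i == j)%:R)%:E)%E) -> uniq s ->
  E2 P (fun w => \sum_(i <- s) Z i w * c i) = (\sum_(i <- s) c i ^+ 2)%:E.
Proof.
move=> mZ orth us; rewrite /E2.
have IZZ i : P.-integrable setT (EFin \o (fun w => Z i w ^+ 2)).
  apply/integrableP; split; first by apply/measurable_EFinP; exact: measurable_funX.
  under eq_integral do rewrite gee0_abs ?lee_fin ?sqr_ge0//=.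
  have := orth i i; rewrite eqxx => E.
  by under eq_integral do rewrite /= expr2; rewrite E ltry.
have IZ i j : P.-integrable setT (EFin \o (fun w => Z i w * Z j w)).
  apply: (le_integrable _ _ _ (integrableD measurableT (IZZ i) (IZZ j))) => //.
    by apply/measurable_EFinP; exact: measurable_funM.
  move=> w _.
  change ((`|Z i w * Z j w|)%:E <= (`|Z i w ^+ 2 + Z j w ^+ 2|)%:E)%E.
  rewrite lee_fin [leRHS]ger0_norm; last first.
    by rewrite addr_ge0 ?sqr_ge0.
  rewrite normrM -[Z i w ^+ 2]real_normK ?num_real// -[Z j w ^+ 2]real_normK ?num_real//.
  have := sqr_ge0 (`|Z i w| - `|Z j w|).
  have := normr_ge0 (Z i w); have := normr_ge0 (Z j w); nra.
have Icc i j : P.-integrable setT (fun w => (c i * c j)%:E * (Z i w * Z j w)%:E)%E.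
  exact: (integrableZl measurableT (c i * c j) (IZ i j)).
have -> : (\int[P]_w ((\sum_(i <- s) Z i w * c i) ^+ 2)%:E =
   \int[P]_w \sum_(i <- s) \sum_(j <- s) ((c i * c j)%:E * (Z i w * Z j w)%:E))%E.
  apply: eq_integral => w _.
  rewrite expr2 mulr_suml -sumEFin; apply: eq_bigr => i _.
  rewrite mulr_sumr -sumEFin; apply: eq_bigr => j _.
  by rewrite -EFinM; congr EFin; ring.
rewrite integral_sum//; last by move=> i; exact: integrable_sum.
rewrite -sumEFin; apply: eq_big_seq => i si.
rewrite integral_sum//.
have Ecc j : (\int[P]_w ((c i * c j)%:E * (Z i w * Z j w)%:E) = (c i * c j * (i == j)%:R)%:E)%E.
  transitivity ((c i * c j)%:E * \int[P]_w (Z i w * Z j w)%:E)%E.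
    exact: (integralZl measurableT (IZ i j)).
  by rewrite orth -EFinM.
rewrite (eq_bigr _ (fun j _ => Ecc j)) sumEFin; congr EFin.
rewrite (bigD1_seq i)//= eqxx mulr1 big1 ?addr0 ?expr2// => j ji.
by rewrite eq_sym (negbTE ji) mulr0.
Qed.

(** By orthonormality the sum of squares is the squared norm of a partial sum [S]. It is at most
    twice that of [W] plus twice that of [W - S], and the latter is eventually below 1; boundedness
    is all that is wanted, so the constant is crude. *)
Lemma bessel_bounded (I : eqType) (Z : I -> Omega -> R) (c : I -> R) (s : nat -> seq I) W :
  measurable_fun setT W -> (E2 P W < +oo)%E ->
  (forall i, measurable_fun setT (Z i)) ->
  (forall i j, (\int[P]_w (Z i w * Z j w)%:E = ((i == j)%:R)%:E)%E) ->
  (forall n, uniq (s n)) ->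
  (fun n => E2 P (fun w => W w - \sum_(i <- s n) Z i w * c i)) @ \oo --> 0%E ->
  exists K : R, \forall n \near \oo, \sum_(i <- s n) c i ^+ 2 <= K.
Proof.
move=> mW W2 mZ orth us cv.
have W20 : (0 <= E2 P W)%E by apply: integral_ge0 => w _; rewrite lee_fin sqr_ge0.
exists (2 * fine (E2 P W) + 2).
have small : \forall n \near \oo, (E2 P (fun w => (W w - \sum_(i <- s n) Z i w * c i)%R) < 1%:E)%E.
  apply: near_lt_cvg0 => //.
  by move=> n; apply: integral_ge0 => w _; rewrite lee_fin sqr_ge0.
near=> n.
have mS : measurable_fun setT (fun w => \sum_(i <- s n) Z i w * c i).
  by apply: measurable_sum_fun => i; exact: measurable_funM.
rewrite -lee_fin -(E2_orthonormal c mZ orth (us n)).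
have H : (E2 P (fun w => (W w - \sum_(i <- s n) Z i w * c i)%R) <= 1%:E)%E.
  by apply: ltW; near: n.
apply: (@le_trans _ _ (\int[P]_w ((2 * (W w) ^+ 2)%:E +
    (2 * (W w - \sum_(i <- s n) Z i w * c i) ^+ 2)%:E))%E).
  apply: ge0_le_integral => //.
  - by move=> w _; rewrite lee_fin sqr_ge0.
  - by apply/measurable_EFinP; exact: measurable_funX.
  - apply: emeasurable_funD; apply/measurable_EFinP; apply: measurable_funM => //.
      exact: measurable_funX.
    by apply: measurable_funX; exact: measurable_funB.
  move=> w _; rewrite -EFinD lee_fin; set S := \sum_(i <- _) _.
  have := sqr_ge0 (2 * W w - S); nra.
rewrite ge0_integralD//; last 4 first.
- by move=> w _; rewrite lee_fin mulr_ge0 ?sqr_ge0.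
- by apply/measurable_EFinP; apply: measurable_funM => //; exact: measurable_funX.
- by move=> w _; rewrite lee_fin mulr_ge0 ?sqr_ge0.
- by apply/measurable_EFinP; apply: measurable_funM => //; apply: measurable_funX; exact: measurable_funB.
under eq_integral do rewrite EFinM.
under [X in (_ + X <= _)%E]eq_integral do rewrite EFinM.
rewrite !ge0_integralZl_EFin//; last 4 first.
- by move=> w _; rewrite lee_fin sqr_ge0.
- by apply/measurable_EFinP; apply: measurable_funX; exact: measurable_funB.
- by move=> w _; rewrite lee_fin sqr_ge0.
- by apply/measurable_EFinP; exact: measurable_funX.
have -> : ((2 * fine (E2 P W) + 2)%:E = 2%:E * E2 P W + 2%:E * 1%:E)%E.
  by rewrite mule1 EFinD EFinM fineK// ge0_fin_numE.
apply: leeD; first exact: lexx.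
by apply: lee_wpmul2l => //; rewrite lee_fin.
Unshelve. all: by end_near. Qed.

Lemma E2_eq0_negligible W : measurable_fun setT W -> E2 P W = 0%E ->
  P [set w | W w != 0] = 0%E.
Proof.
move=> mW W2.
apply/negligibleP.
  rewrite (_ : [set w | _] = [set w | (0 < `|W w|)%R]).
    by apply: measurable_set_gt; exact: measurableT_comp.
  by apply/seteqP; split => w /=; rewrite normr_gt0.
apply: (negligibleS (A := \bigcup_k [set w | (k.+1%:R^-1 ^+ 2 <= W w ^+ 2)%R])); last first.
  apply: negligible_bigcup => k; apply/negligibleP.
    by apply: measurable_set_ge; exact: measurable_funX.
  have k0 : 0 < k.+1%:R^-1 ^+ 2 :> R by rewrite exprn_gt0// invr_gt0 ltr0n.
  have := markov_ge P (measurable_funX 2 mW) (fun=> sqr_ge0 _) k0.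
  rewrite -/(E2 P W) W2 => H; apply/eqP; rewrite eq_le measure_ge0 andbT.
  by rewrite -(@lee_pmul2l _ (k.+1%:R^-1 ^+ 2)%:E) ?lte_fin// mule0.
move=> w /= W0; exists (Num.trunc (`|W w|^-1)) => //=.
rewrite -[leRHS]real_normK ?num_real// ler_sqr ?nnegrE ?invr_ge0//.
rewrite -[leRHS]invrK lef_pV2 ?posrE ?ltr0n ?invr_gt0 ?normr_gt0//.
have ii : 0 <= `|W w|^-1 by rewrite invr_ge0.
by have /andP[_ /ltW] := truncn_itv ii.
Qed.

End Probability.

Ltac solve_pos := repeat first [done | assumption | (apply: ltW; assumption)
  | apply: sqr_ge0 | apply: exprn_ge0 | apply: exprn_gt0 | rewrite invr_ge0 | rewrite invr_gt0
  | apply: expR_gt0 | apply: expR_ge0 | apply: mulr_ge0 | apply: mulr_gt0].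

(** * Numerical estimates for the constants *)

Section Numerics.
Context {R : realType}.
Implicit Types (x y : R).
Local Notation mu := (@lebesgue_measure R).

Lemma is_derive_inv_sqrt x : 0 < x ->
  is_derive x 1 (fun z : R => -2 * (Num.sqrt z)^-1) (Num.sqrt x / x ^+ 2).
Proof.
move=> x0; have s0 : Num.sqrt x != 0 by rewrite gt_eqF// sqrtr_gt0.
have ds := is_derive1_sqrt x0.
have dv := is_deriveV s0 ds.
refine (@is_derive_eq _ _ _ _ _ _ _ _ (is_deriveZ (-2) dv) _).
have -> : Num.sqrt x / x ^+ 2 = (Num.sqrt x ^+ 3)^-1.
  by rewrite -[X in _ / X ^+ 2](sqr_sqrtr (ltW x0)); field.
by rewrite /GRing.scale/=; field.
Qed.

Lemma integral_powN3_2 c : 0 < c ->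
  (\int[mu]_(x in `[c, +oo[) (Num.sqrt x / x ^+ 2)%:E = (2 / Num.sqrt c)%:E)%E.
Proof.
move=> c0.
have cpos x : c <= x -> 0 < x by move=> /(lt_le_trans c0).
rewrite (@ge0_continuous_FTC2y _ _ (fun z : R => -2 * (Num.sqrt z)^-1) c 0).
- by rewrite -EFinB sub0r -mulNr opprK.
- by move=> x _; rewrite divr_ge0 ?sqrtr_ge0 ?sqr_ge0.
- apply: continuous_in_subspaceT => x; rewrite inE/= in_itv/= andbT => /cpos x0.
  apply: cvgM; first exact: sqrt_continuous.
  apply: cvgV; first by rewrite gt_eqF ?exprn_gt0.
  by apply: cvg_sqr; exact: cvg_id.
- apply/cvgr0Pnorm_lt => e e0; near=> x.
  have x0 : 0 < x by near: x; apply: nbhs_pinfty_gt; rewrite num_real.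
  rewrite normrM (@ger0_norm _ (Num.sqrt x)^-1) ?invr_ge0 ?sqrtr_ge0// normrN ger0_norm//.
  rewrite ltr_pdivrMr ?sqrtr_gt0// mulrC -ltr_pdivrMr//.
  have -> : 2 / e = Num.sqrt ((2 / e) ^+ 2) by rewrite sqrtr_sqr ger0_norm// divr_ge0// ltW.
  by rewrite ltr_sqrt//; near: x; apply: nbhs_pinfty_gt; rewrite num_real.
- by move=> x /ltW/cpos x0; have [] := is_derive_inv_sqrt x0.
- apply: cvg_at_right_filter.
  apply: cvgM; first exact: cvg_cst.
  by apply: cvgV; [rewrite gt_eqF ?sqrtr_gt0|exact: sqrt_continuous].
- move=> x; rewrite in_itv/= andbT => /ltW/cpos x0.
  by rewrite derive1E; have [_ ->] := is_derive_inv_sqrt x0.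
Unshelve. all: by end_near. Qed.

(** Dropping the 1 under the root leaves the power [- 3 / 2], whose integral from
    [c = 1 / (2 * theta)] is [2 / sqrt c]. *)
Lemma A_theta_ge (theta : R) : 0 < theta < 1 -> 2 * Num.sqrt (2 * theta) <= A_theta theta.
Proof.
move=> /andP[t0 t1]; rewrite /A_theta.
set c := (2 * theta)^-1.
have c0 : 0 < c by rewrite invr_gt0 mulr_gt0.
have c12 : 1 <= 2 * c.
  by rewrite /c invfM mulrA divff// mul1r invf_ge1// ltW.
have cpos x : c <= x -> 0 < x by move=> /(lt_le_trans c0).
have mc : measurable (`[c, +oo[%classic : set R) by exact: measurable_itv.
have mg : measurable_fun (`[c, +oo[%classic : set R) (fun x : R => Num.sqrt x / x ^+ 2).
  apply: subspace_continuous_measurable_fun => //.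
  apply: continuous_in_subspaceT => x; rewrite inE/= in_itv/= andbT => /cpos x0.
  apply: cvgM; first exact: sqrt_continuous.
  apply: cvgV; first by rewrite gt_eqF ?exprn_gt0.
  by apply: cvg_sqr; exact: cvg_id.
have mf : measurable_fun (`[c, +oo[%classic : set R) (fun x : R => Num.sqrt (x + 1) / x ^+ 2).
  apply: subspace_continuous_measurable_fun => //.
  apply: continuous_in_subspaceT => x; rewrite inE/= in_itv/= andbT => /cpos x0.
  apply: cvgM.
    apply: (continuous_comp (f := fun x : R => x + 1)); last exact: sqrt_continuous.
    by apply: cvgD; [exact: cvg_id|exact: cvg_cst].
  apply: cvgV; first by rewrite gt_eqF ?exprn_gt0.
  by apply: cvg_sqr; exact: cvg_id.
have lo : ((2 / Num.sqrt c)%:E <=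
    \int[mu]_(x in `[c, +oo[) (Num.sqrt (x + 1) / x ^+ 2)%:E)%E.
  rewrite -integral_powN3_2//; apply: ge0_le_integral => //.
  - by move=> x _; rewrite lee_fin divr_ge0 ?sqrtr_ge0 ?sqr_ge0.
  - exact/measurable_EFinP.
  - exact/measurable_EFinP.
  move=> x; rewrite /= in_itv/= andbT => /cpos x0.
  by rewrite lee_fin ler_pM2r ?invr_gt0 ?exprn_gt0// ler_wsqrtr// lerDl.
(* Finiteness matters because [fine] sends [+oo] to 0. As [c >= 1 / 2], one has [x + 1 <= 4 * x] on
   the domain. *)
have up : (\int[mu]_(x in `[c, +oo[) (Num.sqrt (x + 1) / x ^+ 2)%:E < +oo)%E.
  apply: (@le_lt_trans _ _ (\int[mu]_(x in `[c, +oo[) (2%:E * (Num.sqrt x / x ^+ 2)%:E))%E).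
    apply: ge0_le_integral => //.
    - by move=> x _; rewrite lee_fin divr_ge0 ?sqrtr_ge0 ?sqr_ge0.
    - exact/measurable_EFinP.
    - by apply/measurable_EFinP; exact: measurable_funM.
    move=> x; rewrite /= in_itv/= andbT => cx; have x0 := cpos _ cx.
    rewrite -EFinM lee_fin mulrA ler_pM2r ?invr_gt0 ?exprn_gt0//.
    have -> : 2 * Num.sqrt x = Num.sqrt (2 ^+ 2 * x).
      by rewrite sqrtrM ?sqr_ge0// sqrtr_sqr ger0_norm.
    rewrite ler_wsqrtr//; lra.
  rewrite ge0_integralZl_EFin//; last 2 first.
  - by move=> x _; rewrite lee_fin divr_ge0 ?sqrtr_ge0 ?sqr_ge0.
  - exact/measurable_EFinP.
  by rewrite integral_powN3_2// -EFinM ltry.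
have -> : 2 * Num.sqrt (2 * theta) = 2 / Num.sqrt c.
  by rewrite /c sqrtrV ?invrK// mulr_ge0// ltW.
rewrite -lee_fin fineK// ge0_fin_numE//.
by apply: integral_ge0 => x _; rewrite lee_fin divr_ge0 ?sqrtr_ge0 ?sqr_ge0.
Qed.

(** [expR (- (1 / 6)) >= 5 / 6], and the sixth power of [5 / 6] exceeds [1 / 3]. *)
Lemma expR1_le3 : expR 1 <= 3 :> R.
Proof.
have h : 5 / 6 <= expR (- (1 / 6)) :> R.
  by apply: le_trans (expR_ge1Dx _); lra.
have E : expR (- (1 / 6)) ^+ 6 = (expR 1)^-1 :> R.
  by rewrite -expRM_natl -expRN; congr expR; field.
have h6 : (5 / 6) ^+ 6 <= (expR 1)^-1 :> R.
  by rewrite -E; apply: lerXn2r; rewrite ?nnegrE ?expR_ge0//; lra.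
rewrite -[leLHS]invrK -[leRHS]invrK lef_pV2 ?posrE ?invr_gt0 ?expR_gt0//.
by apply: le_trans h6; lra.
Qed.

(** After squaring, the first bound compares [4 / 9 * theta], from [expR 1 <= 3] and
    [theta * (1 - theta) ^ 2 <= 4 / 27], with [9 / 20 * theta], from [2 ^ (9 / 2) >= 45 / 2] and
    [A ^ 2 >= 8 * theta]. The second one adds [eh / (1 + eh ^ 3 / 8) <= 3 / 2]. *)
Lemma Qc_scaled (eh theta T : R) : 0 < eh -> 0 < theta < 1 -> 0 < T ->
  [/\ 0 < Qc eh theta T, Qc eh theta T * T <= eh / 20 & Qc eh theta T * T <= 3 / 40].
Proof.
move=> e0 tt T0; have A0 := A_theta_ge tt; case/andP: tt => t0 t1.
rewrite /Qc; set A := A_theta theta in A0 *.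
set p := 2 `^ (9 / 4); set a := expR (1 / 2).
have Agt0 : 0 < A by apply: lt_le_trans A0; rewrite mulr_gt0// sqrtr_gt0 mulr_gt0.
have p0 : 0 < p by rewrite powR_gt0.
have a0 : 0 < a by exact: expR_gt0.
have h0 : 0 < 1 + eh ^+ 3 / 8 by rewrite ltr_pwDl// divr_ge0// exprn_ge0// ltW.
have t0' := ltW t0; have t1' : 0 <= 1 - theta by rewrite subr_ge0 ltW.
have a0' := ltW a0; have p0' := ltW p0; have A0' := ltW Agt0; have e0' := ltW e0.
have h0' := ltW h0.
have p4 : p ^+ 4 = 512.
  rewrite /p -powR_mulrn ?powR_ge0// -powRrM (_ : 9 / 4 * 4%:R = 9%:R); last by field.
  by rewrite powR_mulrn//; ring.
have p2 : 45 / 2 <= p ^+ 2.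
  rewrite -(@ler_sqr _ (45 / 2)) ?nnegrE ?exprn_ge0//.
  rewrite -exprM p4; lra.
have a2 : a ^+ 2 <= 3.
  rewrite /a -expRM_natl (_ : 2%:R * (1 / 2) = 1); last by field.
  exact: expR1_le3.
have A2 : 8 * theta <= A ^+ 2.
  rewrite (_ : 8 * theta = (2 * Num.sqrt (2 * theta)) ^+ 2); last first.
    by rewrite exprMn sqr_sqrtr ?mulr_ge0//; ring.
  by apply: lerXn2r => //; rewrite nnegrE ?mulr_ge0 ?sqrtr_ge0//.
have key : a * theta * (1 - theta) <= p * A / 20.
  rewrite -ler_sqr ?nnegrE; last 2 first.
  - by rewrite !mulr_ge0 //.
  - by rewrite !mulr_ge0 ?invr_ge0//.
  have c1 : theta * (1 - theta) ^+ 2 <= 4 / 27.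
    (* The maximum is at [theta = 1 / 3]; this product equals [4 - 27 * theta * (1 - theta) ^ 2]. *)
    have : 0 <= (3 * theta - 1) ^+ 2 * (4 - 3 * theta).
      by rewrite mulr_ge0 ?sqr_ge0//; lra.
    nra.
  have c2 : (a * theta * (1 - theta)) ^+ 2 <= 3 * (theta * (4 / 27)).
    rewrite (_ : (a * theta * (1 - theta)) ^+ 2 =
       a ^+ 2 * (theta * (theta * (1 - theta) ^+ 2))); last by ring.
    apply: ler_pM => //; rewrite ?sqr_ge0//.
      by rewrite !mulr_ge0 ?sqr_ge0//.
    by rewrite ler_pM2l.
  have c3 : (45 / 2) * (8 * theta) <= p ^+ 2 * A ^+ 2.
    by apply: ler_pM => //; lra.
  apply: le_trans c2 _.
  rewrite (_ : (p * A / 20) ^+ 2 = p ^+ 2 * A ^+ 2 / 400); last by field.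
  move: c3; lra.
have E H : 0 < H -> a * eh * theta * (1 - theta) / (p * A * T * H) * T =
   (a * theta * (1 - theta)) * (p * A)^-1 * (eh / H).
  move=> H0.
  by field; rewrite !gt_eqF.
have b : a * theta * (1 - theta) * (p * A)^-1 <= 1 / 20.
  rewrite ler_pdivrMr ?mulr_gt0//; move: key; lra.
have eb : 0 <= eh / (1 + eh ^+ 3 / 8) by rewrite divr_ge0.
rewrite E//; split.
- by rewrite divr_gt0 ?mulr_gt0// subr_gt0.
- apply: (@le_trans _ _ (1 / 20 * eh)); last by rewrite mulrC mul1r.
  apply: ler_pM => //; first by rewrite !mulr_ge0 ?invr_ge0 ?mulr_ge0//.
  by rewrite ler_pdivrMr// ler_peMr// lerDl divr_ge0// exprn_ge0// ltW.
- apply: (@le_trans _ _ (1 / 20 * (3 / 2))); last by lra.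
  apply: ler_pM => //; first by rewrite !mulr_ge0 ?invr_ge0 ?mulr_ge0//.
  rewrite ler_pdivrMr//.
  have : 0 <= (eh - 1) ^+ 2 * (eh + 2) by rewrite mulr_ge0 ?sqr_ge0// addr_ge0// ltW.
  nra.
Qed.

(** The exponent is split in halves. By [q <= x / 20] one half is at least [u], and
    [expR (- u) <= 1 / u] produces [eps * delta ^ 2 / D ^ 2] up to a constant. By [q <= 3 / 40] the
    other half is at least [25 / 9 * D ^ 2], which absorbs the growth
    [delta ^ 2 / D ^ 2 <= expR (2 * D)] for large [delta]. *)
Lemma chaining_level_le (delta eps q : R) : 0 < delta -> 0 < eps -> 0 < q ->
  q <= eps_hat delta eps / 20 -> q <= 3 / 40 ->
  4 * expR (- (ln (1 + delta) ^+ 2 / (32 * q ^+ 2))) <= eps.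
Proof.
move=> d0 e0 q0; set x := eps_hat _ _ => qx q2.
have x2 : x ^+ 2 = delta ^+ 2 * eps by rewrite /x /eps_hat exprMn sqr_sqrtr// ltW.
have x0 : 0 < x by rewrite /x /eps_hat mulr_gt0// sqrtr_gt0.
have d0' := ltW d0; have e0' := ltW e0; have q0' := ltW q0; have x0' := ltW x0.
have d1 : 1 < 1 + delta by rewrite ltrDl.
set D := ln (1 + delta).
have D0 : 0 < D by rewrite ln_gt0.
have D0' := ltW D0.
have eD : expR D = 1 + delta by rewrite lnK// posrE addr_gt0.
have dD : delta <= D * expR D.
  have := expR_ge1Dx (- D); rewrite expRN.
  rewrite -(ler_pM2r (expR_gt0 D)) mulVf ?gt_eqF ?expR_gt0// mulrDl mul1r mulNr eD; lra.
pose u := 25 / 4 * D ^+ 2 / x ^+ 2.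
have u0 : 0 < u by rewrite /u; solve_pos.
have B : u + 25 / 9 * D ^+ 2 <= D ^+ 2 / (32 * q ^+ 2).
  have ra : 20 / x <= q^-1.
    rewrite -(ler_pM2r q0) mulVf ?gt_eqF//.
    apply: (@le_trans _ _ (20 / x * (x / 20))); first by rewrite ler_pM2l// divr_gt0.
    by rewrite mulrA divfK ?gt_eqF// divff.
  have rb : 40 / 3 <= q^-1.
    rewrite -(ler_pM2r q0) mulVf ?gt_eqF//; lra.
  have r2a : (20 / x) ^+ 2 <= q^-1 ^+ 2.
    by apply: lerXn2r => //; rewrite nnegrE ?invr_ge0// divr_ge0.
  have r2b : (40 / 3) ^+ 2 <= q^-1 ^+ 2.
    by apply: lerXn2r => //; rewrite nnegrE ?invr_ge0// divr_ge0.
  have -> : D ^+ 2 / (32 * q ^+ 2) = D ^+ 2 * q^-1 ^+ 2 / 32 by field; rewrite gt_eqF.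
  have -> : u = D ^+ 2 * (20 / x) ^+ 2 / 64 by rewrite /u; field; rewrite gt_eqF.
  have := ler_wpM2l (sqr_ge0 D) r2a; have := ler_wpM2l (sqr_ge0 D) r2b; lra.
have e1 : expR (- u) <= u^-1.
  rewrite expRN lef_pV2 ?posrE ?expR_gt0//.
  by apply: le_trans (expR_ge1Dx u); rewrite lerDr.
(* The exponent is at most [9 / 25], its value at [D = 9 / 25], and [expR (9 / 25) <= 1 / (1 - 9 /
   25) = 25 / 16]. This cancels the factor [16 / 25] left by [4 / u]. *)
have e2 : expR (2 * D - 25 / 9 * D ^+ 2) <= 25 / 16.
  apply: (@le_trans _ _ (expR (9 / 25))).
    rewrite ler_expR; have := sqr_ge0 (5 / 3 * D - 3 / 5); nra.
  rewrite -[leLHS]invrK -[leRHS]invrK lef_pV2 ?posrE ?invr_gt0 ?expR_gt0//.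
  rewrite -expRN; apply: le_trans (expR_ge1Dx _); lra.
apply: (@le_trans _ _ (4 * (expR (- u) * expR (- (25 / 9 * D ^+ 2))))).
  by rewrite ler_pM2l// -expRD ler_expR -opprD lerN2.
apply: (@le_trans _ _ (4 * (u^-1 * expR (- (25 / 9 * D ^+ 2))))).
  by rewrite ler_pM2l// ler_pM2r// expR_gt0.
have d2 : delta ^+ 2 <= D ^+ 2 * expR (2 * D).
  rewrite [2 * D]mulrC expRM_natr -exprMn.
  by apply: lerXn2r => //; rewrite nnegrE ?mulr_ge0 ?expR_ge0//.
rewrite /u x2.
have -> : 4 * ((25 / 4 * D ^+ 2 / (delta ^+ 2 * eps))^-1 * expR (- (25 / 9 * D ^+ 2))) =
   eps * (16 / 25 * (delta ^+ 2 * expR (- (25 / 9 * D ^+ 2))) / D ^+ 2).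
  by field; rewrite !gt_eqF.
rewrite ger_pMr// ler_pdivrMr ?exprn_gt0// mul1r.
have h1 : delta ^+ 2 * expR (- (25 / 9 * D ^+ 2)) <= D ^+ 2 * (25 / 16).
  apply: (@le_trans _ _ (D ^+ 2 * expR (2 * D) * expR (- (25 / 9 * D ^+ 2)))).
    by rewrite ler_pM2r// expR_gt0.
  by rewrite -mulrA -expRD ler_pM2l// exprn_gt0.
move: h1; lra.
Qed.

Lemma zsumSS n (F : int -> R) : zsum n.+2 F = zsum n.+1 F + (F n.+1%:Z + F (- n.+1%:Z)).
Proof.
rewrite /zsum !doubleS/= big_ord_recr big_ord_recl/=.
rewrite addrC addrA addrC; congr (_ + _); last first.
  by congr (_ + _); congr F; rewrite ?PoszM; lia.
by apply: eq_bigr => i _; congr F; rewrite /= /bump; lia.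
Qed.

Lemma zsum_even n (F : int -> R) : (forall k, F (- k) = F k) ->
  zsum n.+1 F = F 0 + \sum_(1 <= k < n.+1) 2 * F k%:Z.
Proof.
move=> ev; elim: n => [|n IH].
  rewrite /zsum/= big_ord_recl big_ord0 big_geq//= !addr0.
rewrite zsumSS IH [in RHS]big_nat_recr//= ev -addrA; congr (_ + (_ + _)).
by ring.
Qed.

(** Telescoping, since [1 / k ^ 2 <= 1 / (k - 1) - 1 / k]. *)
Lemma inv_square_sum_tail a n : (1 < a)%N ->
  \sum_(a <= k < n) (k%:R ^+ 2)^-1 <= (a.-1%:R)^-1 :> R.
Proof.
move=> a1; have [na|an] := leqP n a.
  by rewrite big_geq// invr_ge0.
suff : \sum_(a <= k < n) (k%:R ^+ 2)^-1 <= (a.-1%:R)^-1 - (n.-1%:R)^-1 :> R.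
  by move=> /le_trans; apply; rewrite gerBl invr_ge0.
move: an; elim: n => [//|n IH]; rewrite ltnS leq_eqVlt => /predU1P[<-|an].
  rewrite big_nat1; case: a a1 {IH} => [//|[//|a]] _ /=.
  rewrite -[a.+2%:R]natr1; set z : R := a.+1%:R.
  have z0 : 0 < z by rewrite ltr0n.
  rewrite (_ : z^-1 - (z + 1)^-1 = (z * (z + 1))^-1); last by field; rewrite !gt_eqF// addr_gt0.
  rewrite lef_pV2 ?posrE ?exprn_gt0 ?mulr_gt0 ?addr_gt0//; nra.
rewrite big_nat_recr/= ?(ltnW an)//.
apply: le_trans (lerD (IH an) (lexx _)) _.
case: n an {IH} => [//|[|n]] an /=; first by move: an a1; lia.
rewrite -[n.+2%:R]natr1; set z : R := n.+1%:R.
have z0 : 0 < z by rewrite ltr0n.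
have : ((z + 1) ^+ 2)^-1 <= z^-1 - (z + 1)^-1.
  rewrite (_ : z^-1 - (z + 1)^-1 = (z * (z + 1))^-1); last by field; rewrite !gt_eqF// addr_gt0.
  rewrite lef_pV2 ?posrE ?exprn_gt0 ?mulr_gt0 ?addr_gt0//; nra.
by move=> h; apply: (le_trans (lerD (lexx _) h)); rewrite addrA subrK.
Qed.

Lemma inv_square_sum_le2 n : \sum_(1 <= k < n) (k%:R ^+ 2)^-1 <= 2 :> R.
Proof.
case: n => [|[|n]]; try by rewrite big_geq.
rewrite big_ltn//= expr1n invr1.
by have := @inv_square_sum_tail 2 n.+2 isT; rewrite /= invr1; lra.
Qed.

Lemma geometric_tail_le (b : R) a n : 1 < b ->
  \sum_(a <= j < n) (b ^+ j)^-1 <= b / (b - 1) * (b ^+ a)^-1.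
Proof.
move=> b1; have b0 : 0 < b by rewrite (lt_trans _ b1).
have bb : 0 < b - 1 by rewrite subr_gt0.
have [na|an] := leqP n a.
  by rewrite big_geq// !mulr_ge0 ?invr_ge0 ?exprn_ge0 ?ltW.
suff : \sum_(a <= j < n) (b ^+ j)^-1 = b / (b - 1) * ((b ^+ a)^-1 - (b ^+ n)^-1).
  move=> ->; rewrite ler_pM2l ?divr_gt0// gerBl invr_ge0 exprn_ge0// ltW//.
elim: n an => [//|n IH]; rewrite ltnS leq_eqVlt => /predU1P[<-|an].
  rewrite big_nat1 exprS; field; rewrite !gt_eqF ?exprn_gt0//.
rewrite big_nat_recr/= ?(ltnW an)// IH// exprS; field.
by rewrite !gt_eqF ?exprn_gt0.
Qed.

Lemma log_b_lt_pow (b y : R) (a N : nat) : 1 < b -> 0 <= y ->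
  a%:R + log_b b y < N%:R -> b ^+ a * y <= b ^+ N.
Proof.
move=> b1 y0 H; have b0 : 0 < b by rewrite (lt_trans _ b1).
(* [ln 0] is a default value, so [y = 0] is treated apart; it occurs when [B0] or [B1] vanishes. *)
move: y0; rewrite le_eqVlt => /predU1P[<-|y0].
  by rewrite mulr0 exprn_ge0// ltW.
have lb : 0 < ln b by rewrite ln_gt0.
move: H; rewrite /log_b -(ltr_pM2r lb) mulrDl divfK ?gt_eqF// => H.
rewrite -ler_ln ?posrE ?mulr_gt0 ?exprn_gt0// lnM ?posrE ?exprn_gt0// !lnXn//.
by rewrite -[ln b *+ a]mulr_natl -[ln b *+ N]mulr_natl ltW.
Qed.

(** [gA] and [gB] stand for the squared Lipschitz constants of the coefficients in time. The centre
    term [gA 0] cancels in the difference because [N0 > 1], whereas the centre terms [gB j 0]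
    survive on the omitted levels [j >= N], where [B0] governs them. *)
Lemma residual_variance_le (A1 B0 B1 Q : R) (N0 N : nat) (Mj : nat -> nat) (n : nat)
    (gA : int -> R) (gB : nat -> int -> R) :
  0 < Q -> N0_star A1 Q < N0%:R -> N_star B0 B1 Q < N%:R ->
  (forall j, (j < N)%N -> M_star B1 Q < (Mj j)%:R) ->
  (N0 <= n)%N -> (N <= n)%N -> (forall j, (j < N)%N -> (Mj j <= n)%N) ->
  (forall k, gA (- k) = gA k) ->
  (forall k : nat, (0 < k)%N -> gA k%:Z = A1 ^+ 2 / k%:R ^+ 2) ->
  (forall j k, gB j (- k) = gB j k) ->
  (forall j, gB j 0 = B0 ^+ 2 / 8 ^+ j) ->
  (forall j (k : nat), (0 < k)%N -> gB j k%:Z = B1 ^+ 2 / 2 ^+ j / k%:R ^+ 2) ->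
  (zsum n gA - zsum N0 gA) +
  (\sum_(j < n) zsum n (gB j) - \sum_(j < N) zsum (Mj j) (gB j)) <= Q ^+ 2.
Proof.
move=> Q0 hN0 hN hM N0n Nn Mn evA gAk evB gB0 gBk.
have Q20 : 0 < Q ^+ 2 by rewrite exprn_gt0.
have tailE (g : int -> R) c a : (forall k, g (- k) = g k) ->
    (forall k : nat, (0 < k)%N -> g k%:Z = c / k%:R ^+ 2) -> (0 < a)%N -> (a <= n)%N ->
    zsum n g - zsum a g = 2 * c * \sum_(a <= k < n) (k%:R ^+ 2)^-1.
  move=> ev gk; case: a => // a _ an; case: n an {N0n Nn Mn} => // m an.
  rewrite !zsum_even// (big_cat_nat (n := a.+1))//= mulr_sumr.
  rewrite opprD addrACA subrr add0r addrAC subrr add0r.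
  rewrite !big_seq; apply: eq_bigr => k; rewrite mem_index_iota => /andP[ak _].
  by rewrite gk ?(leq_trans _ ak)// mulrA.
have N01 : (1 < N0)%N.
  rewrite -(ltr_nat R); apply: le_lt_trans hN0; rewrite /N0_star lerDl.
  by solve_pos.
have partA : zsum n gA - zsum N0 gA <= Q ^+ 2 / 4.
  rewrite (tailE gA (A1 ^+ 2))// ?(ltnW N01)//.
  have := inv_square_sum_tail n N01 => h.
  apply: (@le_trans _ _ (2 * A1 ^+ 2 * (N0.-1%:R)^-1)).
    by apply: ler_wpM2l => //; solve_pos.
  have n0 : 0 < N0.-1%:R :> R by rewrite ltr0n -ltnS prednK// ltnW.
  rewrite ler_pdivrMr//.
  have E0 : N0%:R = N0.-1%:R + 1 :> R by rewrite natr1 prednK// ltnW.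
  have : 8 * A1 ^+ 2 / Q ^+ 2 < N0.-1%:R by move: hN0; rewrite /N0_star E0; lra.
  rewrite ltr_pdivrMr//; lra.
have Bsplit : \sum_(j < n) zsum n (gB j) - \sum_(j < N) zsum (Mj j) (gB j) =
   \sum_(0 <= j < N) (zsum n (gB j) - zsum (Mj j) (gB j)) + \sum_(N <= j < n) zsum n (gB j).
  rewrite -(big_mkord xpredT (fun j => zsum n (gB j))) (big_cat_nat (n := N))//=.
  rewrite -(big_mkord xpredT (fun j => zsum (Mj j) (gB j))) addrAC.
  by rewrite -sumrB.
have low : \sum_(0 <= j < N) (zsum n (gB j) - zsum (Mj j) (gB j)) <= Q ^+ 2 / 4.
  apply: (@le_trans _ _ (\sum_(0 <= j < N) Q ^+ 2 / 8 * (2 ^+ j)^-1)).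
    rewrite !big_seq; apply: ler_sum => j; rewrite mem_index_iota => /andP[_ jN].
    have M1 : (1 < Mj j)%N.
      rewrite -(ltr_nat R); apply: le_lt_trans (hM j jN); rewrite /M_star lerDl.
      by solve_pos.
    rewrite (tailE (gB j) (B1 ^+ 2 / 2 ^+ j))// ?(ltnW M1) ?Mn//; last first.
      by move=> k k0; rewrite gBk.
    have h := inv_square_sum_tail n M1.
    apply: (@le_trans _ _ (2 * (B1 ^+ 2 / 2 ^+ j) * ((Mj j).-1%:R)^-1)).
      by apply: ler_wpM2l => //; solve_pos.
    have n0 : 0 < (Mj j).-1%:R :> R by rewrite ltr0n -ltnS prednK// ltnW.
    rewrite ler_pdivrMr//.
    have E0 : (Mj j)%:R = (Mj j).-1%:R + 1 :> R by rewrite natr1 prednK// ltnW.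
    have : 16 * B1 ^+ 2 / Q ^+ 2 < (Mj j).-1%:R by move: (hM j jN); rewrite /M_star E0; lra.
    rewrite ltr_pdivrMr// => hh.
    have z0 : 0 < (2 ^+ j)^-1 :> R by rewrite invr_gt0 exprn_gt0.
    have := ler_wpM2l (ltW z0) (ltW hh); lra.
  rewrite -mulr_sumr.
  have := @geometric_tail_le 2 0 N; rewrite ltr1n => /(_ isT); rewrite expr0 => g.
  have E2 : 2 / (2 - 1) * 1^-1 = 2 :> R by field.
  rewrite E2 in g.
  have : Q ^+ 2 / 8 * \sum_(0 <= j < N) (2 ^+ j)^-1 <= Q ^+ 2 / 8 * 2.
    by rewrite ler_pM2l ?divr_gt0.
  lra.
have [hN1 hN2] : 1 + log_b 8 (4 * B0 ^+ 2 / (7 * Q ^+ 2)) < N%:R /\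
    3 + log_b 2 (4 * B1 ^+ 2 / Q ^+ 2) < N%:R.
  by move: hN; rewrite /N_star gt_max => /andP[].
(* Half of this allowance goes to the centre terms, of ratio [1 / 8], and half to the others, of
   ratio [1 / 2]. The factor 4 is [2 * 2]: two signs of [k], and 2 as a bound for the sum of the
   inverse squares. *)
have high : \sum_(N <= j < n) zsum n (gB j) <= Q ^+ 2 / 2.
  apply: (@le_trans _ _ (\sum_(N <= j < n)
     (B0 ^+ 2 * (8 ^+ j)^-1 + 4 * B1 ^+ 2 * (2 ^+ j)^-1))).
    rewrite !big_seq; apply: ler_sum => j; rewrite mem_index_iota => /andP[_ jn].
    case: n jn {N0n Nn Mn tailE partA Bsplit low} => // m jn.
    rewrite zsum_even// gB0 lerD2l.
    rewrite (eq_big_nat _ _ (F2 := fun k => 2 * (B1 ^+ 2 / 2 ^+ j) * (k%:R ^+ 2)^-1)); last first.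
      by move=> k /andP[k0 _]; rewrite gBk// mulrA.
    rewrite -mulr_sumr.
    apply: (@le_trans _ _ (2 * (B1 ^+ 2 / 2 ^+ j) * 2)).
      by apply: ler_wpM2l; [solve_pos|exact: inv_square_sum_le2].
    by rewrite le_eqVlt; apply/orP; left; apply/eqP; ring.
  rewrite big_split/= -!mulr_sumr.
  have g8 := @geometric_tail_le 8 N n; rewrite ltr1n in g8; have {}g8 := g8 isT.
  have g2 := @geometric_tail_le 2 N n; rewrite ltr1n in g2; have {}g2 := g2 isT.
  have l8 : 8 ^+ 1 * (4 * B0 ^+ 2 / (7 * Q ^+ 2)) <= 8 ^+ N.
    by apply: (@log_b_lt_pow 8 _ 1 N _ _ hN1); [rewrite ltr1n|solve_pos].
  have l2 : 2 ^+ 3 * (4 * B1 ^+ 2 / Q ^+ 2) <= 2 ^+ N.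
    by apply: (@log_b_lt_pow 2 _ 3 N _ _ hN2); [rewrite ltr1n|solve_pos].
  have s8 : B0 ^+ 2 * \sum_(N <= j < n) (8 ^+ j)^-1 <= Q ^+ 2 / 4.
    apply: (@le_trans _ _ (B0 ^+ 2 * (8 / (8 - 1) * (8 ^+ N)^-1))).
      by rewrite ler_wpM2l ?sqr_ge0.
    rewrite mulrA ler_pdivrMr ?exprn_gt0//.
    have : Q ^+ 2 / 4 * (8 ^+ 1 * (4 * B0 ^+ 2 / (7 * Q ^+ 2))) <= Q ^+ 2 / 4 * 8 ^+ N.
      by rewrite ler_pM2l ?divr_gt0.
    apply: le_trans; rewrite le_eqVlt; apply/orP; left; apply/eqP.
    by field; rewrite gt_eqF.
  have s2 : 4 * B1 ^+ 2 * \sum_(N <= j < n) (2 ^+ j)^-1 <= Q ^+ 2 / 4.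
    apply: (@le_trans _ _ (4 * B1 ^+ 2 * (2 / (2 - 1) * (2 ^+ N)^-1))).
      by apply: ler_wpM2l => //; solve_pos.
    rewrite mulrA ler_pdivrMr ?exprn_gt0//.
    have : Q ^+ 2 / 4 * (2 ^+ 3 * (4 * B1 ^+ 2 / Q ^+ 2)) <= Q ^+ 2 / 4 * 2 ^+ N.
      by rewrite ler_pM2l ?divr_gt0.
    apply: le_trans; rewrite le_eqVlt; apply/orP; left; apply/eqP.
    by field; rewrite gt_eqF.
  lra.
rewrite Bsplit; lra.
Qed.

End Numerics.

(** * Dyadic chaining over a countable set of times *)

Section Chaining.
Context {d : measure_display} {Omega : measurableType d} {R : realType}.
Variable P : probability Omega R.

Let grid (T : R) (n i : nat) : R := i%:R * T / (2 ^ n)%:R.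

Lemma grid_double T n i : grid T n.+1 i.*2 = grid T n i.
Proof.
rewrite /grid expnS -muln2 !natrM invfM; have p : (2 ^ n)%:R != 0 :> R by rewrite pnatr_eq0 -lt0n expn_gt0.
by field.
Qed.

Let chain_radius (D : R) (n : nat) : R := D * n.+1%:R / (4 * (2 ^ n)%:R).

(** The bound is [D] times the partial sum up to [n] of [(k + 1) / (4 * 2 ^ k)], a series with sum
    1. A grid point of even index belongs to the coarser grid; one of odd index is one step to the
    right of such a point. *)
Lemma dyadic_chaining_bound (Z : R -> R) (T D : R) : 0 < D -> Z 0 = 0 ->
  (forall n i, (i < 2 ^ n)%N ->
     `|Z (grid T n i.+1) - Z (grid T n i)| <= chain_radius D n) ->
  forall n i, (i <= 2 ^ n)%N ->
    `|Z (grid T n i)| <= D * (1 - n.+3%:R / (4 * (2 ^ n)%:R)).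
Proof.
move=> D0 Z0 H; elim=> [|n IH] i.
  rewrite expn0 => i1.
  have -> : D * (1 - 3%:R / (4 * 1%:R)) = chain_radius D 0.
    by rewrite /chain_radius expn0; field.
  case: i i1 => [_|[_|//]].
    rewrite /grid !mul0r Z0 normr0 /chain_radius.
    by rewrite !mulr_ge0 ?invr_ge0 ?mulr_ge0 ?ltW.
  have := H 0%N 0%N isT.
  by rewrite {2}/grid !mul0r Z0 subr0.
have p : (2 ^ n)%:R != 0 :> R by rewrite pnatr_eq0 -lt0n expn_gt0.
have p0 : 0 < (2 ^ n)%:R :> R by rewrite ltr0n expn_gt0.
have key : D * (1 - n.+3%:R / (4 * (2 ^ n)%:R)) + chain_radius D n.+1 =
   D * (1 - n.+4%:R / (4 * (2 ^ n.+1)%:R)).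
  rewrite /chain_radius expnS natrM -[n.+4%:R]natr1 -[n.+3%:R]natr1 -[n.+2%:R]natr1.
  by field.
move=> iN; rewrite -(odd_double_half i).
case E : (odd i) => /=.
  rewrite add1n.
  have hi : (i./2 < 2 ^ n)%N.
    have := odd_double_half i; rewrite E expnS in iN * => ii; lia.
  have h1 := H n.+1 i./2.*2.
  rewrite grid_double in h1.
  have {}h1 := h1 _; have h2 := IH i./2 (ltnW hi).
  rewrite -key.
  have : `|Z (grid T n.+1 (i./2.*2).+1)| <= `|Z (grid T n i./2)| +
     `|Z (grid T n.+1 (i./2.*2).+1) - Z (grid T n i./2)|.
    by rewrite (le_trans _ (ler_normD _ _))// addrC subrK.
  move=> /le_trans; apply; apply: lerD => //; apply: h1.
  by rewrite expnS; lia.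
rewrite add0n grid_double.
have hi : (i./2 <= 2 ^ n)%N.
  have := odd_double_half i; rewrite E expnS in iN * => ii; lia.
apply: le_trans (IH _ hi) _; rewrite -key lerDl /chain_radius.
by rewrite !mulr_ge0 ?invr_ge0 ?mulr_ge0 ?ltW.
Qed.

Lemma countable_range (S : set R) : countable S ->
  exists f : nat -> R, S `<=` range f.
Proof.
move=> /pcard_surjP[g gS]; exists g => x Sx.
by have [n _ <-] := gS x Sx; exists n.
Qed.

(** In place of path continuity, the tail bound makes [Z s] the limit in probability of its values
    at neighbouring grid points. Off a null set these values come arbitrarily close to [Z s], and
    countability of [S] keeps the union of the exceptional sets null. *)
Lemma chaining (Z : R -> Omega -> R) (T q D eps : R) (S : set R) :
  0 < T -> 0 < q -> 0 < D -> countable S ->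
  (forall t, measurable_fun setT (Z t)) ->
  P [set w | Z 0 w != 0] = 0%E ->
  (forall s t r, 0 <= s <= T -> 0 <= t <= T -> s != t -> 0 < r ->
     (P [set w | (r <= `|Z t w - Z s w|)%R] <=
      (2 * expR (- (r ^+ 2 / (2 * (q / T * (t - s)) ^+ 2))))%:E)%E) ->
  4 * expR (- (D ^+ 2 / (32 * q ^+ 2))) <= eps -> eps <= 1 ->
  exists A : set Omega, [/\ measurable A, (P A <= eps%:E)%E &
    forall w, ~ A w -> forall s, S s -> 0 <= s <= T -> `|Z s w| <= D].
Proof.
move=> T0 q0 D0 cS mZ Z00 tail Beps eps1.
have [f Sf] := countable_range cS.
have p0 n : 0 < (2 ^ n)%:R :> R by rewrite ltr0n expn_gt0.
have T0' := ltW T0; have q0' := ltW q0; have D0' := ltW D0.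
have p0' n : 0 <= (2 ^ n)%:R :> R by [].
have gT n i : (i <= 2 ^ n)%N -> 0 <= grid T n i <= T.
  move=> iN; rewrite /grid divr_ge0 ?mulr_ge0//= ler_pdivrMr// mulrC.
  by rewrite ler_pM2l// ler_nat.
have gS n i : grid T n i.+1 - grid T n i = T / (2 ^ n)%:R.
  by rewrite /grid -natr1; field; rewrite gt_eqF.
pose a n i := [set w | (chain_radius D n < `|Z (grid T n i.+1) w - Z (grid T n i) w|)%R].
have mN s t : measurable_fun setT (fun w => `|Z s w - Z t w|).
  by apply: measurableT_comp => //; exact: measurable_funB.
have ma n i : measurable (a n i) by exact: measurable_set_gt.
pose A1 n := \big[setU/set0]_(i < 2 ^ n) a n i.
have mA1 n : measurable (A1 n) by apply: bigsetU_measurable => i _.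
(* [x ^ (n + 1)] bounds the probability of a failure on level [n]; as [x <= eps / 2 <= 1 / 2], it is
   at most [eps / 2 ^ (n + 1)]. *)
pose x := 2 * expR (- (D ^+ 2 / (32 * q ^+ 2))).
have x0 : 0 < x by rewrite mulr_gt0// expR_gt0.
have x2 : 2 * x <= eps by rewrite /x mulrA -natrM.
have r0 n : 0 < chain_radius D n.
  by rewrite /chain_radius divr_gt0 ?mulr_gt0.
have Pa n i : (i < 2 ^ n)%N ->
    (P (a n i) <= (2 * expR (- (D ^+ 2 / (32 * q ^+ 2))) ^+ n.+1)%:E)%E.
  move=> iN.
  apply: (@le_trans _ _ (P [set w | (chain_radius D n <= `|Z (grid T n i.+1) w - Z (grid T n i) w|)%R])).
    apply: le_measureW => //; first exact: measurable_set_ge.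
    by move=> w /= /ltW.
  apply: le_trans (tail (grid T n i) (grid T n i.+1) _ (gT _ _ (ltnW iN)) (gT _ _ iN) _ (r0 n)) _.
    by rewrite eq_sym -subr_eq0 gS gt_eqF// divr_gt0.
  rewrite lee_fin ler_pM2l// -expRM_natl ler_expR gS mulrN lerN2.
  (* Of the factor [(n + 1) ^ 2] in the exponent, only [n + 1] is kept. *)
  have -> : chain_radius D n ^+ 2 / (2 * (q / T * (T / (2 ^ n)%:R)) ^+ 2) =
     n.+1%:R ^+ 2 * (D ^+ 2 / (32 * q ^+ 2)).
    by rewrite /chain_radius; field; rewrite !gt_eqF.
  apply: ler_wpM2r; first by rewrite divr_ge0 ?mulr_ge0 ?sqr_ge0.
  by rewrite expr2 -natrM ler_nat leq_pmulr.
have PA1 n : (P (A1 n) <= (eps / (2 ^ n.+1)%:R)%:E)%E.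
  apply: (@le_trans _ _ (\sum_(i < 2 ^ n) P (a n i))%E).
    by apply: Boole_inequality => i _.
  apply: (@le_trans _ _ (\sum_(i < 2 ^ n) (2 * expR (- (D ^+ 2 / (32 * q ^+ 2))) ^+ n.+1)%:E)%E).
    by apply: lee_sum => i _; exact: Pa.
  rewrite sumEFin sumr_const card_ord lee_fin -[leLHS]mulr_natl.
  have -> : (2 ^ n)%:R * (2 * expR (- (D ^+ 2 / (32 * q ^+ 2))) ^+ n.+1) = x ^+ n.+1.
    by rewrite /x exprMn -natrX expnS natrM; ring.
  rewrite exprS natrX -exprVn exprS mulrA.
  have xe : x <= eps / 2 by rewrite ler_pdivlMr// mulrC.
  have xn : x ^+ n <= 2^-1 ^+ n by apply: lerXn2r; rewrite ?nnegrE; lra.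
  exact: (ler_pM (ltW x0) (exprn_ge0 n (ltW x0)) xe xn).
(* This is the index of the last grid point of level [n] not beyond [s]. The event [N1 s k] says
   that the values at all these neighbours stay [1 / (k + 1)] away from [Z s]. *)
pose near_idx (s : R) n := Num.trunc (s * (2 ^ n)%:R / T).
pose N1 s k := \bigcap_n [set w | (k.+1%:R^-1 <= `|Z s w - Z (grid T n (near_idx s n)) w|)%R].
have mN1 s k : measurable (N1 s k).
  by apply: bigcapT_measurable => n; exact: measurable_set_ge.
have idxP s n : 0 <= s <= T -> (near_idx s n <= 2 ^ n)%N /\
    `|s - grid T n (near_idx s n)| <= T / (2 ^ n)%:R.
  move=> /andP[s0 sT].
  have /andP[t1 t2] : (near_idx s n)%:R <= s * (2 ^ n)%:R / T < (near_idx s n).+1%:R.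
    by apply: truncn_itv; rewrite divr_ge0 ?mulr_ge0// ltW.
  split.
    rewrite -ltnS -(ltr_nat R); apply: le_lt_trans t1 _.
    rewrite ltr_pdivrMr// -natr1 mulrDl mul1r.
    rewrite ltr_pwDr// mulrC ler_wpM2l//.
  rewrite /grid ler_norml; apply/andP; split.
    rewrite lerBrDr -lerBrDl opprK.
    apply: (@le_trans _ _ s); last by rewrite lerDl divr_ge0.
    by rewrite ler_pdivrMr// -ler_pdivlMr.
  rewrite lerBlDr -mulrDl ler_pdivlMr// -[X in X + _]mul1r -mulrDl nat1r.
  by rewrite -ler_pdivrMr// ltW.
have PN1 s k : 0 <= s <= T -> P (N1 s k) = 0%E.
  move=> sT; apply/eqP; rewrite eq_le measure_ge0 andbT.
  have kk : 0 < k.+1%:R^-1 :> R by rewrite invr_gt0 ltr0n.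
  (* A bound of order [1 / n] suffices: it comes from [expR y >= 1 + y] and [n * Delta <= q ^ 2],
     where [Delta <= (q / 2 ^ n) ^ 2] and [n <= 4 ^ n]. *)
  have le_n n : (P (N1 s k) <= (2 * (1 + (k.+1%:R^-1) ^+ 2 / (2 * q ^+ 2) * n%:R)^-1)%:E)%E.
    have [iN dist] := idxP s n sT.
    apply: (@le_trans _ _ (P [set w | (k.+1%:R^-1 <= `|Z s w - Z (grid T n (near_idx s n)) w|)%R])).
      by apply: le_measureW => //; [exact: measurable_set_ge|move=> w /(_ n I)].
    (* The tail hypothesis asks for distinct times; if the neighbour is [s] itself, the event is
       empty. *)
    have [E|ne] := eqVneq (grid T n (near_idx s n)) s.
      rewrite E (_ : [set w | _] = set0) ?measure0.
        by rewrite lee_fin mulr_ge0// invr_ge0 addr_ge0// mulr_ge0// divr_ge0 ?mulr_ge0 ?sqr_ge0.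
      by apply/seteqP; split => w //=; rewrite subrr normr0 leNgt kk.
    apply: le_trans (tail _ _ _ (gT _ _ iN) sT ne kk) _.
    rewrite lee_fin ler_pM2l// expRN lef_pV2 ?posrE ?expR_gt0//; last first.
      by rewrite ltr_wpDr// mulr_ge0// divr_ge0 ?mulr_ge0 ?sqr_ge0.
    apply: le_trans (expR_ge1Dx _); rewrite lerD2l.
    have ds : 0 < (q / T * (s - grid T n (near_idx s n))) ^+ 2.
      rewrite exprn_even_gt0//=; apply: mulf_neq0; first by rewrite gt_eqF// divr_gt0.
      by rewrite subr_eq0 eq_sym.
    set Delta := (q / T * _) ^+ 2 in ds *.
    have nD : n%:R * Delta <= q ^+ 2.
      have d2 : (s - grid T n (near_idx s n)) ^+ 2 <= (T / (2 ^ n)%:R) ^+ 2.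
        by rewrite -real_normK ?num_real// lerXn2r ?nnegrE ?divr_ge0.
      have : Delta <= (q / (2 ^ n)%:R) ^+ 2.
        have -> : q / (2 ^ n)%:R = q / T * (T / (2 ^ n)%:R) by field; rewrite !gt_eqF.
        by rewrite /Delta !exprMn ler_wpM2l ?mulr_ge0 ?exprn_ge0 ?invr_ge0// -!exprMn.
      have n4 : n%:R <= (2 ^ n)%:R ^+ 2 :> R.
        apply: (@le_trans _ _ (2 ^ n)%:R); first by rewrite ler_nat ltnW// ltn_expl.
        by rewrite expr2 ler_peMr// -[leLHS]/(1%:R) ler_nat expn_gt0.
      move=> Dq; apply: (le_trans (ler_pM _ (ltW ds) n4 Dq)) => //.
      by rewrite exprMn exprVn mulrCA mulfV ?mulr1// gt_eqF// exprn_gt0.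
    rewrite -mulrA ler_wpM2l ?sqr_ge0// -ler_pdivlMl ?invr_gt0 ?mulr_gt0 ?exprn_gt0//.
    rewrite invrK -[2 * Delta]/(2 * Delta) invfM mulrA ler_pdivlMr//.
    by rewrite [2 * q ^+ 2]mulrC -mulrA divff// mulr1.
  apply/lee_addgt0Pr => e e0; rewrite add0e.
  have a0 : 0 < k.+1%:R^-1 ^+ 2 / (2 * q ^+ 2) by rewrite divr_gt0 ?mulr_gt0 ?exprn_gt0.
  move: le_n a0; set al := _ / _ => le_n a0.
  have [M h1] : exists M : nat, 2 / e < al * M%:R.
    exists (Num.trunc (2 / e / al)).+1; rewrite [al * _]mulrC -ltr_pdivrMr//.
    by have /andP[_] := truncn_itv (divr_ge0 (divr_ge0 (ler0n R 2) (ltW e0)) (ltW a0)).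
  apply: le_trans (le_n M) _.
  rewrite lee_fin ler_pdivrMr; last by rewrite ltr_wpDr// mulr_ge0// ltW.
  rewrite mulrC -ler_pdivrMr//; lra.
pose A2 := [set w | Z 0 w != 0].
have mA2 : measurable A2.
  rewrite (_ : A2 = [set w | (0 < `|Z 0 w|)%R]).
    by apply: measurable_set_gt; exact: measurableT_comp.
  by apply/seteqP; split => w /=; rewrite normr_gt0.
(* The enumeration [f] may leave [[0, T]], where no tail bound is available; nothing is removed
   there. *)
pose A3k m k := if 0 <= f m <= T then N1 (f m) k else set0.
have mA3k m k : measurable (A3k m k) by rewrite /A3k; case: ifP.
pose A3 := \bigcup_m \bigcup_k A3k m k.
have mA3 : measurable A3.
  by apply: bigcupT_measurable => m; apply: bigcupT_measurable => k.
have PA3 : P A3 = 0%E.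
  apply/negligibleP => //; apply: negligible_bigcup => m; apply: negligible_bigcup => k.
  rewrite /A3k; case: ifP => H; last exact: negligible_set0.
  by apply/negligibleP => //; exact: PN1.
have mB : measurable (\bigcup_n A1 n) by exact: bigcupT_measurable.
exists (\bigcup_n A1 n `|` (A2 `|` A3)); split.
- by apply: measurableU => //; exact: measurableU.
- apply: le_trans (measureU2 _ mB (measurableU _ _ mA2 mA3)) _.
  rewrite [X in (_ + X)%E](_ : _ = 0%E); last first.
    apply/negligibleP; first exact: measurableU.
    by apply: negligibleU; apply/negligibleP.
  rewrite adde0.
  apply: le_trans (measure_sigma_subadditive _ mA1 mB (fun _ => id)) _.
  apply: le_trans (epsilon_trick0 xpredT _); last by rewrite (le_trans _ x2)// mulr_ge0// ltW.
  by apply: lee_nneseries => [n _ _|n _]; [exact: measure_ge0|exact: PA1].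
move=> w nA s Ss sT.
have nA1 n i : (i < 2 ^ n)%N ->
    `|Z (grid T n i.+1) w - Z (grid T n i) w| <= chain_radius D n.
  move=> iN; rewrite leNgt; apply/negP => H; apply: nA; left; exists n => //.
  rewrite /A1 -bigcup_mkord; exists i => //.
have Zw0 : Z 0 w = 0.
  by apply/eqP/negPn/negP => H; apply: nA; right; left.
have bnd := @dyadic_chaining_bound (fun t => Z t w) T D D0 Zw0 nA1.
rewrite leNgt; apply/negP => DZ.
have [m _ fm] := Sf _ Ss.
pose k := Num.trunc ((`|Z s w| - D)^-1).
have ZD0 : 0 < `|Z s w| - D by rewrite subr_gt0.
have kk : k.+1%:R^-1 <= `|Z s w| - D.
  rewrite -[leRHS]invrK lef_pV2 ?posrE ?ltr0n ?invr_gt0//.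
  have ii : 0 <= (`|Z s w| - D)^-1 by rewrite invr_ge0 ltW.
  by have /andP[_ /ltW] := truncn_itv ii.
have [n Hn] : exists n, `|Z s w - Z (grid T n (near_idx s n)) w| < k.+1%:R^-1.
  apply: contrapT => H; apply: nA; right; right; exists m => //; exists k => //.
  rewrite /A3k fm sT => n _ /=; rewrite leNgt; apply/negP => H'; apply: H; by exists n.
have [iN _] := idxP s n sT.
have lt1 : `|Z s w| < (`|Z s w| - D) + D.
  apply: (@le_lt_trans _ _ (`|Z s w - Z (grid T n (near_idx s n)) w| +
     `|Z (grid T n (near_idx s n)) w|)).
    by rewrite (le_trans _ (ler_normD _ _))// subrK.
  apply: (ltr_leD (lt_le_trans Hn kk)); apply: (le_trans (bnd n _ iN)).
  by rewrite ler_piMr// lerBlDr lerDl divr_ge0 ?mulr_ge0.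
by move: lt1; rewrite subrK ltxx.
Qed.

End Chaining.

(** * Index lists of the partial sums and of the model *)

Section IndexLists.
Context {R : realType}.

Definition idxl (N : nat) : seq int := [seq i%:Z - (N%:Z - 1) | i <- iota 0 (N.*2).-1].

Lemma zsumE N (F : int -> R) : zsum N F = \sum_(k <- idxl N) F k.
Proof.
by rewrite /zsum big_map -(big_mkord xpredT (fun i => F (i%:Z - (N%:Z - 1)))) /index_iota subn0.
Qed.

Lemma mem_idxl N (k : int) : (k \in idxl N) = (`|k| < N)%N.
Proof.
apply/mapP/idP => [[i iN ->]|kN].
  by move: iN; rewrite mem_iota => /andP[_ iN]; lia.
exists (absz (k + (N%:Z - 1))); last by lia.
by rewrite mem_iota; lia.
Qed.

Lemma idxl_uniq N : uniq (idxl N).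
Proof. by rewrite map_inj_uniq ?iota_uniq// => i j; lia. Qed.

(** The indices live in the index type of [xi_eta], so that independence, orthonormality and the
    partial sums all concern a single family. *)
Definition idx (N0 N : nat) (M : nat -> nat) : seq (int + (nat * int)) :=
  [seq inl k | k <- idxl N0] ++ [seq inr (j, l) | j <- iota 0 N, l <- idxl (M j)].

Lemma idx_sum N0 N M (F : int + (nat * int) -> R) :
  \sum_(i <- idx N0 N M) F i =
  zsum N0 (fun k => F (inl k)) + \sum_(j < N) zsum (M j) (fun l => F (inr (j : nat, l))).
Proof.
rewrite /idx big_cat/= big_map zsumE; congr (_ + _).
rewrite big_allpairs_dep/= -(big_mkord xpredT (fun j => zsum (M j) (fun l => F (inr (j, l))))).
by rewrite /index_iota subn0; apply: eq_bigr => j _; rewrite zsumE.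
Qed.

Lemma idx_uniq N0 N M : uniq (idx N0 N M).
Proof.
rewrite cat_uniq; apply/and3P; split.
- by rewrite map_inj_uniq ?idxl_uniq// => i j [].
- by apply/hasPn => x /allpairsPdep[j [l [_ _ ->]]]; apply/mapP => -[].
- apply: allpairs_uniq_dep; first exact: iota_uniq.
    by move=> j _; exact: idxl_uniq.
  by move=> [j l] [j' l'] _ _ /= [-> ->].
Qed.

Lemma mem_idx_inr N0 N M j l : (inr (j, l) \in idx N0 N M) = (j < N)%N && (`|l| < M j)%N.
Proof.
rewrite mem_cat; apply/orP/andP => [[/mapP[]//|/allpairsPdep[j' [l' [+ + [-> ->]]]]]|[jN lM]].
  by rewrite mem_iota mem_idxl.
right; apply/allpairsPdep; exists j, l; split => //; last by rewrite mem_idxl.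
by rewrite mem_iota.
Qed.

Lemma mem_idx_inl N0 N M k : (inl k \in idx N0 N M) = (`|k| < N0)%N.
Proof.
rewrite mem_cat -mem_idxl; apply/orP/idP => [[/mapP[k' ? [->]]//|/allpairsPdep[j' [l' [_ _]]]//]|kN].
by left; apply/mapP; exists k.
Qed.

Lemma idx_subset N0 N M n : (N0 <= n)%N -> (N <= n)%N ->
  (forall j, (j < N)%N -> (M j <= n)%N) -> {subset idx N0 N M <= idx n n (fun=> n)}.
Proof.
move=> N0n Nn Mn [k|[j l]]; rewrite ?mem_idx_inl ?mem_idx_inr.
  by move=> /leq_trans; apply.
move=> /andP[jN lM]; rewrite (leq_trans jN)//=; exact: leq_trans (Mn j jN).
Qed.

Lemma sum_subseq_split (I : eqType) (s s' : seq I) (F : I -> R) :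
  uniq s -> uniq s' -> {subset s' <= s} ->
  \sum_(i <- s) F i = \sum_(i <- s') F i + \sum_(i <- [seq i <- s | i \notin s']) F i.
Proof.
move=> us us' ss; rewrite (bigID (mem s'))/= -big_filter; congr (_ + _).
  apply: perm_big; apply: uniq_perm => //; first exact: filter_uniq.
  move=> i; rewrite mem_filter; apply/andP/idP => [[]//|is'].
  by split => //; exact: ss.
by rewrite -big_filter.
Qed.

End IndexLists.

(** * Lipschitz bounds in time for the coefficients *)

Section Coefficients.
Context {R : realType}.
Variables (T : R) (u du : R -> R -> R[i]) (phih psih dphih dpsih : R -> R[i]).
Variables (Mb : R) (v w : R -> R).
Hypotheses (T0 : 0 < T) (u0 : forall y, u 0 y = 0).
Hypotheses (du_ : forall t, cderiv (u t) (du t)).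
Hypotheses (dphi : cderiv phih dphih) (dpsi : cderiv psih dpsih).
Hypotheses (hM : forall y, cabs (dpsih y) <= Mb).
Hypotheses (w0 : forall y, 0 <= w y) (v0 : forall y, 0 <= v y).
Hypotheses (lip_du : forall t s y, 0 <= t <= T -> 0 <= s <= T ->
  cabs (du t y - du s y) <= `|s - t| * v y).
Hypotheses (lip_u : forall t s y, 0 <= t <= T -> 0 <= s <= T ->
  cabs (u t y - u s y) <= `|s - t| * w y).
Hypotheses (Iyv : Rintegrable (fun y => `|y| * v y))
  (Ivphi : Rintegrable (fun y => v y * cabs (cconj (phih y))))
  (Iwdphi : Rintegrable (fun y => w y * cabs (cconj (dphih y))))
  (Iw : Rintegrable w) (Iwy : Rintegrable (fun y => w y * `|y|))
  (Iwphi : Rintegrable (fun y => w y * cabs (cconj (phih y)))).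

Let c0 : R := sq2pi^-1.
Let c0_gt0 : 0 < c0.
Proof. by rewrite invr_gt0 sqrtr_gt0 mulr_gt0// pi_gt0. Qed.
Let Mb0 : 0 <= Mb. Proof. exact: le_trans (cabs_ge0 _) (hM 0). Qed.

Let A1 := A1c v w phih dphih.
Let B0 := B0c Mb w.
Let B1 := B1c Mb v w.

Definition coef (t : R) (i : int + (nat * int)) : R :=
  match i with inl k => cre (coef_a u phih t k) | inr p => cre (coef_b u psih t p.1 p.2) end.

Let lvl (j : nat) : R := 2 `^ (- (j%:R / 2)).

Lemma lvl_gt0 j : 0 < lvl j. Proof. exact: powR_gt0. Qed.

Lemma sqr_lvl j : lvl j ^+ 2 = (2 ^+ j)^-1.
Proof.
rewrite /lvl -powR_mulrn ?powR_ge0// -powRrM mulNr divfK// powRN powR_mulrn//.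
Qed.

(** For [l <> 0] the frequency is [l / 2 ^ j], so the gain [2 ^ j / |l|] of the integration by parts
    cancels the factor [Mb / 2 ^ j] that comes from [psih (y / 2 ^ j) - psih 0]; for [l = 0] only
    the latter factor is present. The entry at [k = 0] is the plain modulus bound. *)
Definition coef_lip (i : int + (nat * int)) : R :=
  match i with
  | inl k => if k == 0 then c0 * Defs.Rint (fun y => w y * cabs (cconj (phih y)))
             else A1 / `|k%:~R|
  | inr p => lvl p.1 * (if p.2 == 0 then B0 / 2 ^+ p.1 else B1 / `|p.2%:~R|)
  end.

Let I (t : R) (S : R -> R[i]) (x : R) : R :=
  Defs.Rint (fun y => cre (u t y * cconj (S y) * cexpi (y * x))).

Section Pairing.
Variables (S S' : R -> R[i]) (sigma : R -> R).
Hypotheses (dS : cderiv S S') (Isigma : Rintegrable sigma)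
  (wS : forall y, w y * cabs (S y) <= sigma y).

Lemma u_le t y : 0 <= t <= T -> cabs (u t y) <= `|t| * w y.
Proof.
move=> tT; have := @lip_u t 0 y tT; rewrite lexx ltW// => /(_ isT).
by rewrite u0 subr0 sub0r normrN.
Qed.

Lemma pairing_integrable t x : 0 <= t <= T ->
  Rintegrable (fun y => cre (u t y * cconj (S y) * cexpi (y * x))).
Proof.
move=> tT; apply: (coefficient_integrable (du_ t) dS (kappa := `|t|) Isigma) => y.
apply: (@le_trans _ _ (`|t| * w y * cabs (S y))).
  by rewrite ler_wpM2r ?cabs_ge0 ?u_le.
by rewrite -mulrA ler_wpM2l.
Qed.

Lemma pairing_sub t s x : 0 <= t <= T -> 0 <= s <= T ->
  I t S x - I s S x =
  Defs.Rint (fun y => cre ((u t y - u s y) * cconj (S y) * cexpi (y * x))).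
Proof.
move=> tT sT; rewrite -RintB; [|exact: pairing_integrable|exact: pairing_integrable].
by congr Defs.Rint; apply/funext => y; rewrite !mulrBl cre_sub.
Qed.

Lemma pairing_lip0 t s x : 0 <= t <= T -> 0 <= s <= T ->
  `|I t S x - I s S x| <= `|t - s| * Defs.Rint sigma.
Proof.
move=> tT sT; rewrite pairing_sub// distrC.
apply: (coefficient_bound0 (cderivB (du_ t) (du_ s)) dS) => // y.
apply: (@le_trans _ _ (`|s - t| * w y * cabs (S y))).
  by rewrite ler_wpM2r ?cabs_ge0 ?lip_u.
by rewrite -mulrA ler_wpM2l.
Qed.

Lemma pairing_lip1 rho t s x : Rintegrable rho ->
  (forall y, v y * cabs (S y) + w y * cabs (S' y) <= rho y) ->
  0 <= t <= T -> 0 <= s <= T -> x != 0 ->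
  `|I t S x - I s S x| <= `|t - s| / `|x| * Defs.Rint rho.
Proof.
move=> Irho vS tT sT x0; rewrite pairing_sub// distrC.
apply: (coefficient_bound1 (cderivB (du_ t) (du_ s)) dS Isigma (kappa := `|s - t|)) => // y.
  apply: (@le_trans _ _ (`|s - t| * w y * cabs (S y))).
    by rewrite ler_wpM2r ?cabs_ge0 ?lip_u.
  by rewrite -mulrA ler_wpM2l.
apply: (@le_trans _ _ (`|s - t| * (v y * cabs (S y) + w y * cabs (S' y)))).
  rewrite mulrDr !mulrA; apply: lerD; apply: ler_wpM2r; rewrite ?cabs_ge0//.
    exact: lip_du.
  exact: lip_u.
by rewrite ler_wpM2l.
Qed.

End Pairing.

Let I0 S x : I 0 S x = 0.
Proof.
rewrite /I (_ : (fun y => _) = cst 0); first by rewrite /Defs.Rint integral0.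
by apply/funext => y; rewrite u0 !mul0r.
Qed.

Lemma coef_aE t k : coef t (inl k) = c0 * I t phih k%:~R.
Proof. by rewrite /coef /coef_a cre_mul /= mul0r subr0. Qed.

Lemma coef_a_lip t s k : 0 <= t <= T -> 0 <= s <= T ->
  `|coef t (inl k) - coef s (inl k)| <= `|t - s| * coef_lip (inl k).
Proof.
move=> tT sT; rewrite !coef_aE -mulrBr normrM (ger0_norm (ltW c0_gt0)).
have wS y : w y * cabs (phih y) <= w y * cabs (cconj (phih y)) by rewrite cabs_conj.
rewrite /coef_lip; case: eqP => [->|/eqP k0].
  rewrite mulrCA ler_pM2l//; exact: (pairing_lip0 dphi Iwphi wS).
have k0' : k%:~R != 0 :> R by rewrite intr_eq0.
have := pairing_lip1 dphi Iwphi wS (RintegrableD Ivphi Iwdphi) _ tT sT k0'.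
rewrite RintD// => /(_ _)-H.
rewrite /A1 /A1c -/c0 -!mulrA mulrCA ler_pM2l//.
apply: le_trans (H _) _; first by move=> y; rewrite !cabs_conj.
by rewrite -mulrA ler_wpM2l// mulrC.
Qed.

Section Level.
Variable j : nat.

Let Sj (y : R) : R[i] := psih (y / 2 ^+ j) - psih 0.
Let dSj (y : R) : R[i] := dpsih (y / 2 ^+ j) * cR (2 ^+ j)^-1 - 0.
Let p0 : 0 < 2 ^+ j :> R. Proof. by rewrite exprn_gt0. Qed.

Lemma dSjP : cderiv Sj dSj.
Proof. exact: (cderivB (cderiv_scale _ dpsi) (cderiv_cst _)). Qed.

Lemma Sj_le y : cabs (Sj y) <= Mb / 2 ^+ j * `|y|.
Proof.
apply: le_trans (cabs_mean_value 0 (y / 2 ^+ j) dpsi hM) _.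
by rewrite subr0 normrM normfV (gtr0_norm p0) mulrA mulrAC.
Qed.

Lemma dSj_le y : cabs (dSj y) <= Mb / 2 ^+ j.
Proof.
rewrite /dSj subr0 cabs_mul cabs_cR gtr0_norm ?invr_gt0//.
by rewrite ler_pM2r ?invr_gt0.
Qed.

Let sig (y : R) : R := Mb / 2 ^+ j * (w y * `|y|).
Let rho (y : R) : R := Mb / 2 ^+ j * (w y + `|y| * v y).

Lemma Isig : Rintegrable sig. Proof. exact: RintegrableZ. Qed.

Lemma Irho : Rintegrable rho. Proof. by apply: RintegrableZ; exact: RintegrableD. Qed.

Lemma wSj y : w y * cabs (Sj y) <= sig y.
Proof. by rewrite /sig mulrCA ler_wpM2l ?Sj_le. Qed.

Lemma vSj y : v y * cabs (Sj y) + w y * cabs (dSj y) <= rho y.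
Proof.
rewrite /rho mulrDr addrC; apply: lerD.
  by rewrite mulrC ler_wpM2r ?dSj_le.
by rewrite mulrA [v y * _]mulrC ler_wpM2r ?Sj_le.
Qed.

Lemma pairing_level_split t x : 0 <= t <= T ->
  Rintegrable (fun y => cre (u t y * cconj (psih (y / 2 ^+ j)) * cexpi (y * x))) /\
  I t (fun y => psih (y / 2 ^+ j)) x = I t Sj x + I t (fun=> psih 0) x.
Proof.
move=> tT.
have i1 := pairing_integrable dSjP Isig wSj x tT.
have Iw0 : Rintegrable (fun y => cabs (psih 0) * w y) by exact: RintegrableZ.
have i2 : Rintegrable (fun y => cre (u t y * cconj (psih 0) * cexpi (y * x))).
  apply: (pairing_integrable (cderiv_cst (psih 0)) Iw0 _ x tT) => y.
  by rewrite mulrC.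
have E : (fun y => cre (u t y * cconj (psih (y / 2 ^+ j)) * cexpi (y * x))) =
   (fun y => cre (u t y * cconj (Sj y) * cexpi (y * x)) +
     cre (u t y * cconj (psih 0) * cexpi (y * x))).
  by apply/funext => y; rewrite /Sj !cE /= !cE; ring.
by rewrite /I E; split; [exact: RintegrableD|rewrite RintD].
Qed.

Lemma coef_bE t l : 0 <= t <= T ->
  coef t (inr (j, l)) = c0 * (lvl j * I t (fun y => psih (y / 2 ^+ j)) (l%:~R / 2 ^+ j)).
Proof.
move=> tT; rewrite /coef /coef_b cre_mul /= mul0r subr0; congr (_ * _).
rewrite -RintZ; last by have [] := pairing_level_split (l%:~R / 2 ^+ j) tT.
congr Defs.Rint; apply/funext => y.
by rewrite mulrA !cE /= /lvl; ring.
Qed.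

(** The exponential is Lipschitz in the frequency with constant [|y|], which is integrable against
    [w]. This spreads a nonzero value at one frequency to the dyadic frequencies near it. *)
Lemma pairing_const_lip t x x' : 0 <= t <= T ->
  `|I t (fun=> psih 0) x - I t (fun=> psih 0) x'| <=
  `|t| * cabs (psih 0) * Defs.Rint (fun y => w y * `|y|) * `|x - x'|.
Proof.
move=> tT.
have Iw0 : Rintegrable (fun y => cabs (psih 0) * w y) by exact: RintegrableZ.
have i2 z : Rintegrable (fun y => cre (u t y * cconj (psih 0) * cexpi (y * z))).
  apply: (pairing_integrable (cderiv_cst (psih 0)) Iw0 _ z tT) => y.
  by rewrite mulrC.
rewrite -RintB// mulrAC -RintZ//.
apply: normr_Rint_le.
- by apply: measurable_funB; exact: Rintegrable_measurable.
- exact: RintegrableZ.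
move=> y; rewrite -cre_sub -mulrBr; apply: le_trans (cre_le_cabs _) _.
rewrite !cabs_mul cabs_conj.
have -> : `|t| * cabs (psih 0) * `|x - x'| * (w y * `|y|) =
   (`|t| * w y) * cabs (psih 0) * (`|y| * `|x - x'|) by ring.
apply: ler_pM; rewrite ?mulr_ge0 ?cabs_ge0//.
  by rewrite ler_wpM2r ?cabs_ge0 ?u_le.
exact: cexpi_lipschitz.
Qed.

(** Comparison with time 0, where [u] vanishes. The decay in [j] makes the centred part small at
    fine levels against the part that carries [psih 0]. *)
Lemma pairing_level_le t x : 0 <= t <= T ->
  `|I t Sj x| <= `|t| * (Mb * Defs.Rint (fun y => w y * `|y|)) / 2 ^+ j.
Proof.
move=> tT; have T0' : (0 : R) <= (0 : R) <= T by apply/andP; split => //; exact: ltW.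
have := pairing_lip0 dSjP Isig wSj x tT T0'.
rewrite I0 !subr0 /sig RintZ// => /le_trans; apply.
by rewrite le_eqVlt; apply/orP; left; apply/eqP; ring.
Qed.

Hypothesis vanish : forall t x, 0 <= t <= T -> I t (fun=> psih 0) x = 0.

Lemma coef_b_lip t s l : 0 <= t <= T -> 0 <= s <= T ->
  `|coef t (inr (j, l)) - coef s (inr (j, l))| <= `|t - s| * coef_lip (inr (j, l)).
Proof.
move=> tT sT; rewrite !coef_bE// -mulrBr -mulrBr !normrM (ger0_norm (ltW c0_gt0)).
rewrite (ger0_norm (ltW (lvl_gt0 j))) /coef_lip /= mulrCA [`|t - s| * _]mulrCA.
rewrite ler_pM2l ?lvl_gt0//.
have [_ ->] := pairing_level_split (l%:~R / 2 ^+ j) tT.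
have [_ ->] := pairing_level_split (l%:~R / 2 ^+ j) sT.
rewrite !vanish// !addr0.
case: eqP => [->|/eqP l0].
  apply: (le_trans (ler_wpM2l (ltW c0_gt0) (pairing_lip0 dSjP Isig wSj _ tT sT))).
  rewrite /sig RintZ// /B0 /B0c /c0.
  by rewrite le_eqVlt; apply/orP; left; apply/eqP; ring.
have l0' : l%:~R != 0 :> R by rewrite intr_eq0.
have x0 : l%:~R / 2 ^+ j != 0 :> R by apply: mulf_neq0 => //; rewrite invr_eq0 gt_eqF.
apply: (le_trans (ler_wpM2l (ltW c0_gt0) (pairing_lip1 dSjP Isig wSj Irho vSj tT sT x0))).
rewrite /rho RintZ; last exact: RintegrableD.
rewrite /B1 /B1c /c0 normrM normfV (gtr0_norm p0).
rewrite le_eqVlt; apply/orP; left; apply/eqP.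
have sq0 : sq2pi != 0 :> R by rewrite gt_eqF// -invr_gt0.
by field; rewrite sq0 normr_eq0 l0' gt_eqF.
Qed.

End Level.

(* If [t |-> Re (conj (psih 0) * U_t)] did not vanish at [x0], every fine
   enough level [j] would contain about [2 ^ (j - i)] coefficients of size about
   [2 ^ (- j / 2)], so the squares of the coefficients would not be summable. *)
Lemma pairing_vanish t (K : R) : 0 <= t <= T ->
  (\forall n \near \oo, \sum_(i <- idx n n (fun=> n)) coef t i ^+ 2 <= K) ->
  forall x, I t (fun=> psih 0) x = 0.
Proof.
move=> tT bessel x0; apply/eqP/negPn/negP => V0.
set Wy := Defs.Rint (fun y => w y * `|y|).
have Wy0 : 0 <= Wy.
  by apply: Rintegral_ge0 => y _; rewrite mulr_ge0.
set V := I t (fun=> psih 0) in V0.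
pose a := `|V x0|; have a0 : 0 < a by rewrite normr_gt0.
pose Lam := `|t| * cabs (psih 0) * Wy; pose C1 := `|t| * (Mb * Wy).
have Lam0 : 0 <= Lam by rewrite !mulr_ge0 ?cabs_ge0.
have C10 : 0 <= C1 by rewrite !mulr_ge0.
(* [Lam / 2 ^ i] bounds the change of [V] from [x0] to a frequency within [1 / 2 ^ i], and
   [C1 / 2 ^ i] bounds the centred part on levels [j >= i]; half of [a] survives both. *)
have [i Hi] : exists i : nat, (Lam + C1) / 2 ^+ i <= a / 2.
  exists (Num.trunc ((Lam + C1) / (a / 2))).+1.
  rewrite ler_pdivrMr ?exprn_gt0// mulrC -ler_pdivrMr ?divr_gt0//.
  have /andP[_ /ltW h] := truncn_itv (divr_ge0 (addr_ge0 Lam0 C10) (ltW (divr_gt0 a0 (ltr0n R 2)))).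
  apply: (le_trans h); rewrite -natrX ler_nat ltnW// ltn_expl//.
(* The frequencies [(l0 j + r) / 2 ^ j] with [r < 2 ^ (j - i)] all lie within [1 / 2 ^ i] of
   [x0]. *)
pose l0 (j : nat) : int := Num.floor (x0 * 2 ^+ j).
have big j r : (i <= j)%N -> (r < 2 ^ (j - i))%N ->
    c0 ^+ 2 * (a / 2) ^+ 2 / 2 ^+ j <= coef t (inr (j, l0 j + r%:Z)) ^+ 2.
  move=> ij rj; rewrite coef_bE// [leRHS]exprMn [X in _ <= _ * X]exprMn sqr_lvl.
  rewrite -mulrA ler_pM2l ?exprn_gt0// [leLHS]mulrC ler_pM2l ?invr_gt0 ?exprn_gt0//.
  set x := _%:~R / 2 ^+ j; have [_ ->] := pairing_level_split j x tT.
  rewrite -[leRHS]real_normK ?num_real//; apply: lerXn2r;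
    rewrite ?nnegrE//; first by rewrite divr_ge0// ltW.
  have p0 : 0 < 2 ^+ j :> R by rewrite exprn_gt0.
  have pi0 : 0 < 2 ^+ i :> R by rewrite exprn_gt0.
  have pij : 2 ^+ j = 2 ^+ (j - i) * 2 ^+ i :> R by rewrite -exprD subnK.
  have dx : `|x - x0| <= (2 ^+ i)^-1.
    rewrite -[X in _ <= X]mul1r ler_pdivlMr//.
    have -> : x - x0 = (((l0 j + r%:Z)%:~R - x0 * 2 ^+ j) / 2 ^+ j).
      by rewrite /x mulrBl mulfK ?gt_eqF.
    rewrite normrM normfV (gtr0_norm p0) mulrAC ler_pdivrMr// mul1r [leRHS]pij ler_pM2r//.
    have h2 : (l0 j)%:~R <= x0 * 2 ^+ j := floor_le _.
    have h1 : x0 * 2 ^+ j < (l0 j)%:~R + 1.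
      by have := floorD1_gt (x0 * 2 ^+ j); rewrite intrD.
    have El : (l0 j + r%:Z)%:~R = (l0 j)%:~R + r%:R :> R by rewrite intrD.
    have rr : r%:R + 1 <= 2 ^+ (j - i) :> R by rewrite natr1 -natrX ler_nat.
    have r0 : 0 <= r%:R :> R by [].
    rewrite El ler_norml; move: h1 h2 rr r0.
    move: (x0 * 2 ^+ j) (2 ^+ (j - i)) ((l0 j)%:~R) (r%:R) => y p l' r' h1 h2 rr r0.
    by apply/andP; split; lra.
  have V1 := pairing_const_lip x x0 tT; rewrite -/V -/Wy -/Lam in V1.
  have J1 := pairing_level_le j x tT; rewrite -/Wy -/C1 in J1.
  have J2 : `|I t (fun y => psih (y / 2 ^+ j) - psih 0) x| <= C1 / 2 ^+ i.
    apply: le_trans J1 _; rewrite ler_wpM2l// lef_pV2 ?posrE//.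
    by rewrite ler_eXn2l// ltr1n.
  have V2 : `|V x - V x0| <= Lam / 2 ^+ i.
    by apply: le_trans V1 _; rewrite ler_wpM2l.
  have : a <= `|V x0 - V x| + (`|I t (fun y => psih (y / 2 ^+ j) - psih 0) x + V x| +
      `|I t (fun y => psih (y / 2 ^+ j) - psih 0) x|).
    rewrite /a -{1}(subrK (V x) (V x0)); apply: le_trans (ler_normD _ _) _.
    rewrite lerD2l; set Jx := I t _ x.
    by rewrite -{1}(addrK Jx (V x)) [V x + _]addrC (le_trans (ler_normB _ _)).
  rewrite distrC; move: V2 J2 Hi; rewrite mulrDl; lra.
(* The [2 ^ (j - i)] squares found on level [j], each at least [c0 ^ 2 * (a / 2) ^ 2 / 2 ^ j], add
   up to at least [om], independently of [j]; hence [m] levels exceed [K]. *)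
pose om := c0 ^+ 2 * (a / 2) ^+ 2 / 2 ^+ i.
have om0 : 0 < om by rewrite divr_gt0 ?mulr_gt0 ?exprn_gt0 ?divr_gt0.
pose m := (Num.trunc (Num.max K 0 / om)).+1.
have Km : K < m%:R * om.
  rewrite -ltr_pdivrMr//; apply: (@le_lt_trans _ _ (Num.max K 0 / om)).
    by rewrite ler_pM2r ?invr_gt0// le_max lexx.
  have q0 : 0 <= Num.max K 0 / om by rewrite divr_ge0 ?le_max ?lexx ?orbT// ltW.
  by have /andP[] := truncn_itv q0.
pose s' : seq (int + (nat * int)) :=
  [seq inr (j, l0 j + r%:Z) | j <- iota i m, r <- iota 0 (2 ^ (j - i))].
have us' : uniq s'.
  apply: allpairs_uniq_dep => [|j _|]; try exact: iota_uniq.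
  by move=> [j r] [j' r'] _ _ /= [-> /addrI[->]].
have lower : m%:R * om <= \sum_(p <- s') coef t p ^+ 2.
  rewrite big_allpairs_dep/=.
  apply: (@le_trans _ _ (\sum_(j <- iota i m) om)).
    by rewrite big_const_seq count_predT size_iota iter_addr addr0 mulr_natl.
  rewrite !big_seq; apply: ler_sum => j; rewrite mem_iota => /andP[ij _].
  apply: (@le_trans _ _ (\sum_(r <- iota 0 (2 ^ (j - i))) c0 ^+ 2 * (a / 2) ^+ 2 / 2 ^+ j)).
    rewrite big_const_seq count_predT size_iota iter_addr addr0 -[leRHS]mulr_natl natrX /om.
    rewrite le_eqVlt; apply/orP; left; apply/eqP.
    have -> : 2 ^+ j = 2 ^+ (j - i) * 2 ^+ i :> R by rewrite -exprD subnK.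
    by field; rewrite !expf_neq0.
  rewrite !big_seq; apply: ler_sum => r; rewrite mem_iota => /andP[_ rj].
  exact: big.
(* This sum exceeds every level and every translation index, in absolute value, that occurs in
   [s']. *)
pose n0 := (\sum_(p <- s') (if p is inr q then (q.1 + absz q.2).+1 else 0))%N.
have sub n : (n0 <= n)%N -> {subset s' <= idx n n (fun=> n)}.
  move=> n0n p ps; have := ps; move=> /allpairsPdep[j [r [_ _ E]]].
  rewrite E mem_idx_inr.
  have : ((j + absz (l0 j + r%:Z)%R).+1 <= n0)%N.
    by rewrite /n0 (big_rem p ps)/= E leq_addr.
  by move=> /leq_trans/(_ n0n) h; apply/andP; split;
    [exact: leq_ltn_trans (leq_addr _ _) h|exact: leq_ltn_trans (leq_addl _ _) h].
have [n [nK nn0]] : exists n, \sum_(i <- idx n n (fun=> n)) coef t i ^+ 2 <= K /\ (n0 <= n)%N.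
  near \oo => n; exists n; split; near: n => //; exact: nbhs_infty_ge.
have := sum_subseq_split (fun p => coef t p ^+ 2) (idx_uniq n n (fun=> n)) us' (sub n nn0).
have : 0 <= \sum_(p <- [seq p <- idx n n (fun=> n) | p \notin s']) coef t p ^+ 2.
  by apply: sumr_ge0 => p _; exact: sqr_ge0.
lra.
Unshelve. all: by end_near. Qed.

Lemma coef_at0 i : coef 0 i = 0.
Proof.
case: i => [k|[j l]]; first by rewrite coef_aE I0 mulr0.
have T0' : (0 : R) <= (0 : R) <= T by apply/andP; split => //; exact: ltW.
by rewrite coef_bE// I0 !mulr0.
Qed.

Lemma coef_lipschitz : (forall t x, 0 <= t <= T -> I t (fun=> psih 0) x = 0) ->
  forall i t s, 0 <= t <= T -> 0 <= s <= T ->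
  `|coef t i - coef s i| <= `|t - s| * coef_lip i.
Proof.
move=> van [k|[j l]] t s tT sT; first exact: coef_a_lip.
exact: coef_b_lip.
Qed.

Lemma coef_lip_residual_le (Q : R) (N0 N : nat) (Mj : nat -> nat) (n : nat) :
  0 < Q -> N0_star A1 Q < N0%:R -> N_star B0 B1 Q < N%:R ->
  (forall j, (j < N)%N -> M_star B1 Q < (Mj j)%:R) ->
  (N0 <= n)%N -> (N <= n)%N -> (forall j, (j < N)%N -> (Mj j <= n)%N) ->
  \sum_(i <- [seq i <- idx n n (fun=> n) | i \notin idx N0 N Mj]) coef_lip i ^+ 2 <= Q ^+ 2.
Proof.
move=> Q0 hN0 hN hMj N0n Nn Mn.
have := sum_subseq_split (fun i => coef_lip i ^+ 2) (idx_uniq n n (fun=> n))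
  (idx_uniq N0 N Mj) (idx_subset N0n Nn Mn).
have := @residual_variance_le R A1 B0 B1 Q N0 N Mj n (fun k => coef_lip (inl k) ^+ 2)
  (fun j l => coef_lip (inr (j, l)) ^+ 2) Q0 hN0 hN hMj N0n Nn Mn.
rewrite !idx_sum => H E.
have {}H := H _ _ _ _ _.
apply: (@le_trans _ _ (zsum n (fun k => coef_lip (inl k) ^+ 2) -
  zsum N0 (fun k => coef_lip (inl k) ^+ 2) +
  (\sum_(j < n) zsum n (fun l => coef_lip (inr (j : nat, l)) ^+ 2) -
   \sum_(j < N) zsum (Mj j) (fun l => coef_lip (inr (j : nat, l)) ^+ 2)))).
  move: E; lra.
apply: H.
- by move=> k; rewrite /coef_lip oppr_eq0 rmorphN normrN.
- move=> [//|k] _; rewrite /coef_lip (_ : (k.+1%:Z == 0) = false)//.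
  by rewrite exprMn exprVn -pmulrn ger0_norm.
- by move=> j k; rewrite /coef_lip /= oppr_eq0 rmorphN normrN.
- move=> j; rewrite /coef_lip /= exprMn sqr_lvl.
  have -> : 8 ^+ j = 2 ^+ j ^+ 3 :> R by rewrite -!exprM mulnC exprM; congr (_ ^+ j); ring.
  by field; rewrite expf_neq0.
- move=> j [//|k] _; rewrite /coef_lip /=.
  rewrite exprMn sqr_lvl exprMn exprVn -pmulrn ger0_norm//.
  by rewrite mulrCA mulrA.
Qed.

End Coefficients.

(** For the lower side, [1 - expR z <= expR (- z) - 1], because a positive number and its inverse
    add up to at least 2. *)
Lemma expR_div_dist_le (R : realType) (x y delta : R) : 0 < delta ->
  `|x - y| <= ln (1 + delta) -> `|expR x / expR y - 1| <= delta.
Proof.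
move=> d0 xy; rewrite -expRN -expRD; set z := x - y in xy *.
have eD : expR (ln (1 + delta)) = 1 + delta by rewrite lnK// posrE addr_gt0.
have ez : expR `|z| <= 1 + delta by rewrite -eD ler_expR.
have ezp : expR z <= 1 + delta by apply: le_trans ez; rewrite ler_expR ler_norm.
have ezm : expR (- z) <= 1 + delta.
  by apply: le_trans ez; rewrite ler_expR -normrN ler_norm.
have p0 := expR_gt0 z; have q0 := expR_gt0 (- z).
have pq : expR z * expR (- z) = 1 by rewrite -expRD subrr expR0.
rewrite ler_norml; apply/andP; split; last by lra.
have := sqr_ge0 (expR z - expR (- z)); nra.
Qed.

(** * Mean-square limits and the final estimate *)

Section Assembly.
Context {d : measure_display} {Omega : measurableType d} {R : realType}.
Variable P : probability Omega R.

Lemma E2_ge0 (f : Omega -> R) : (0 <= E2 P f)%E.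
Proof. by apply: integral_ge0 => w _; rewrite lee_fin sqr_ge0. Qed.

Lemma E2_sub_le (f g : Omega -> R) : measurable_fun setT f -> measurable_fun setT g ->
  (E2 P (fun w => (f w - g w)%R) <= 2%:E * E2 P f + 2%:E * E2 P g)%E.
Proof.
move=> mf mg.
have mf2 : measurable_fun setT (fun w => f w ^+ 2) by exact: measurable_funX.
have mg2 : measurable_fun setT (fun w => g w ^+ 2) by exact: measurable_funX.
rewrite /E2 -(@ge0_integralZl_EFin _ _ _ P _ measurableT (fun w => (f w ^+ 2)%:E))//; last 2 first.
- by move=> w _; rewrite lee_fin sqr_ge0.
- exact/measurable_EFinP.
rewrite -(@ge0_integralZl_EFin _ _ _ P _ measurableT (fun w => (g w ^+ 2)%:E))//; last 2 first.
- by move=> w _; rewrite lee_fin sqr_ge0.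
- exact/measurable_EFinP.
rewrite -ge0_integralD//; last 4 first.
- by move=> w _; rewrite mule_ge0// lee_fin sqr_ge0.
- by apply/measurable_EFinP; exact: measurable_funM.
- by move=> w _; rewrite mule_ge0// lee_fin sqr_ge0.
- by apply/measurable_EFinP; exact: measurable_funM.
apply: ge0_le_integral => //.
- by move=> w _; rewrite lee_fin sqr_ge0.
- by apply/measurable_EFinP; apply: measurable_funX; exact: measurable_funB.
- by apply: emeasurable_funD; apply/measurable_EFinP; exact: measurable_funM.
by move=> w _; rewrite -!EFinM -EFinD lee_fin; have := sqr_ge0 (f w + g w); nra.
Qed.

Lemma E2_sub_cvg0 (A B : nat -> Omega -> R) :
  (forall n, measurable_fun setT (A n)) -> (forall n, measurable_fun setT (B n)) ->
  (fun n => E2 P (A n)) @ \oo --> 0%E -> (fun n => E2 P (B n)) @ \oo --> 0%E ->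
  (fun n => E2 P (fun w => A n w - B n w)) @ \oo --> 0%E.
Proof.
move=> mA mB cA cB.
apply: (@squeeze_cvge _ _ _ _ (fun=> 0%E) _
  (fun n => 2%:E * E2 P (A n) + 2%:E * E2 P (B n))%E).
- by apply: nearW => n; rewrite E2_ge0 E2_sub_le.
- exact: cvg_cst.
- rewrite -[X in _ --> X](_ : 2%:E * 0 + 2%:E * 0 = 0)%E; last by rewrite !mule0 adde0.
  by apply: cvgeD => //; apply: cvgeZl.
Qed.

Lemma orthonormal_xi_eta (xi : int -> Omega -> R) (eta : nat -> int -> Omega -> R) :
  (forall k l, (\int[P]_w (xi k w * xi l w)%:E)%E = ((k == l)%:R)%:E) ->
  (forall m n k l, (\int[P]_w (eta m k w * eta n l w)%:E)%E = (((m == n) && (k == l))%:R)%:E) ->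
  (forall k n l, (\int[P]_w (xi k w * eta n l w)%:E)%E = 0%E) ->
  forall i j, (\int[P]_w (xi_eta xi eta i w * xi_eta xi eta j w)%:E = ((i == j)%:R)%:E)%E.
Proof.
move=> h1 h2 h3 [k|[m k]] [l|[n l]] /=; rewrite ?h1 ?h2 ?h3//.
by under eq_integral do rewrite mulrC; rewrite h3.
Qed.

Lemma Xmodel_sum (u : R -> R -> R[i]) (phih psih : R -> R[i])
    (xi : int -> Omega -> R) (eta : nat -> int -> Omega -> R) N0 N M t w :
  Xmodel u phih psih xi eta N0 N M t w =
  \sum_(i <- idx N0 N M) xi_eta xi eta i w * coef u phih psih t i.
Proof. by rewrite idx_sum. Qed.

End Assembly.

Lemma model_size_bound N0 N (M : nat -> nat) n : (N0 + N + \sum_(j < N) M j <= n)%N ->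
  [/\ (N0 <= n)%N, (N <= n)%N & forall j, (j < N)%N -> (M j <= n)%N].
Proof.
move=> nn; split; [lia|lia|] => j jN.
have : (M j <= \sum_(j < N) M j)%N by rewrite (bigD1 (Ordinal jN))//= leq_addr.
lia.
Qed.

Unset Implicit Arguments.

Theorem theorem3 (R : realType) (d : measure_display) (Omega : measurableType d)
  (P : probability Omega R)
  (T theta delta eps : R)
  (hT : 0 < T) (htheta : 0 < theta < 1) (hdelta : 0 < delta) (heps : 0 < eps < 1)
  (X : R -> Omega -> R) (u : R -> R -> R[i])
  (phi psi phih psih : R -> R[i])
  (xi : int -> Omega -> R) (eta : nat -> int -> Omega -> R)
  (* X separable, mean-square continuous, strictly sub-Gaussian, condition RC *)
  (hsep : separable_process P X)
  (hms : ms_continuous P X)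
  (hssg : strictly_sub_gaussian_process P X)
  (hRC : condition_RC P X u)
  (* phi scaling function of an MRA, psi the corresponding wavelet,
     phih, psih their Fourier transforms *)
  (hmra : MRA_scaling phi) (hwav : MRA_wavelet phi psi)
  (hphih : is_FT phi phih) (hpsih : is_FT psi psih)
  (* expansion (E) with independent strictly sub-Gaussian xi, eta *)
  (hE : expansion_E P X u phih psih xi eta)
  (hind : mutually_independent P (xi_eta xi eta))
  (hxi : forall k, strictly_sub_gaussian P (xi k))
  (heta : forall j l, strictly_sub_gaussian P (eta j l))
  (* condition (a) *)
  (du : R -> R -> R[i]) (dphih dpsih : R -> R[i]) (C : R) (u1 u2 : R -> R)
  (ha_phiac : cabs_cont phih)
  (ha_uac : forall t, cabs_cont (u t))
  (ha_du : forall t, cderiv (u t) (du t))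
  (ha_dphi : cderiv phih dphih) (ha_dpsi : cderiv psih dpsih)
  (ha_C : forall y, cabs (dpsih y) <= C)
  (ha_u12 : forall y, 0 <= u1 y /\ 0 <= u2 y)
  (ha_ub : forall t y, cabs (u t y) <= `|t| * u1 y /\ cabs (du t y) <= `|t| * u2 y)
  (ha_int : [/\ Rintegrable (fun y => u1 y * `|y|), Rintegrable u1,
                Rintegrable (fun y => u1 y * cabs (dphih y)),
                Rintegrable (fun y => u1 y * cabs (phih y)) &
                Rintegrable (fun y => u2 y * `|y|) /\
                Rintegrable (fun y => u2 y * cabs (phih y))])
  (ha_lim : forall t : R, 0 <= t <= T ->
     (forall j : nat, vanish_at_infty (fun y => u t y * cconj (psih (y / 2 ^+ j)))) /\
     vanish_at_infty (fun y => u t y * phih y))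
  (* condition (b);  S = conj psih, S_phi = conj phih *)
  (Mb : R) (v w : R -> R)
  (hb_M : forall y, cabs (cconj (dpsih y)) <= Mb)
  (hb_vw : forall y, 0 <= v y /\ 0 <= w y)
  (hb_lip : forall t1 t2 y : R, 0 <= t1 <= T -> 0 <= t2 <= T ->
     cabs (du t1 y - du t2 y) <= `|t2 - t1| * v y /\
     cabs (u t1 y - u t2 y) <= `|t2 - t1| * w y)
  (hb_int : [/\ Rintegrable (fun y => `|y| * v y),
                Rintegrable (fun y => v y * cabs (cconj (phih y))),
                Rintegrable (fun y => w y * cabs (cconj (dphih y))),
                Rintegrable w &
                Rintegrable (fun y => w y * `|y|) /\
                Rintegrable (fun y => w y * cabs (cconj (phih y)))])
  (* the model parameters *)
  (N0 N : nat) (Mj : nat -> nat)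
  (hN0pos : (0 < N0)%N) (hNpos : (0 < N)%N)
  (hMpos : forall j, (j < N)%N -> (0 < Mj j)%N) :
  let eh := eps_hat delta eps in
  let ts := tau_star eh in
  let Q := Qc eh theta T in
  let E2v := E2c u1 u2 phih dphih in
  let F1 := F1c C u1 in
  let F2 := F2c C u1 u2 in
  let A1 := A1c v w phih dphih in
  let B0 := B0c Mb w in
  let B1 := B1c Mb v w in
  let Xhat := Xmodel u phih psih xi eta N0 N Mj in
  Num.max (N0_star A1 Q) (N0_2star E2v ts T) < N0%:R ->
  Num.max (N_star B0 B1 Q) (N_2star F1 F2 ts T) < N%:R ->
  (forall j, (j < N)%N -> Num.max (M_star B1 Q) (M_2star F2 ts T) < (Mj j)%:R) ->
  (exists t : R, 0 <= t <= T /\ (0 < E2 P (fun om => (X t om - Xhat t om)%R))%E) ->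
  (* P{ sup_{t in [0,T]} |Y(t)/hat Y(t) - 1| > delta } <= eps, as an outer
     probability bound *)
  exists A : set Omega, measurable A /\
    [set om | exists t : R, 0 <= t <= T /\
       delta < `|expR (X t om) / expR (Xhat t om) - 1|] `<=` A /\
    (P A <= eps%:E)%E.
Proof.
move=> eh ts Q E2v F1 F2 A1 B0 B1 Xhat hN0 hN hMj _.
have [[X2 _ _ _ _] _] := hRC.
have mX t : measurable_fun setT (X t) by case: (X2 t).
have [_ exi eeta exe cvX] := hE.
have [mZ _] := hind.
have heps0 : 0 < eps by case/andP: heps.
have eh0 : 0 < eh by rewrite /eh /eps_hat mulr_gt0// sqrtr_gt0.
have [Q0 QT1 QT2] := Qc_scaled eh0 htheta hT.
rewrite -/Q in Q0 QT1 QT2.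
have T0T : (0 : R) <= (0 : R) <= T by apply/andP; split => //; exact: ltW.
have TTT : (0 : R) <= T <= T by apply/andP; split => //; exact: ltW.
have u0 y : u 0 y = 0.
  by apply: cabs0_eq; have [+ _] := ha_ub 0 y; rewrite normr0 mul0r.
have hM y : cabs (dpsih y) <= Mb by rewrite -cabs_conj.
have w0 y : 0 <= w y by case: (hb_vw y).
have v0 y : 0 <= v y by case: (hb_vw y).
have lip_du t s y : 0 <= t <= T -> 0 <= s <= T ->
    cabs (du t y - du s y) <= `|s - t| * v y.
  by move=> tT sT; have [] := hb_lip t s y tT sT.
have lip_u t s y : 0 <= t <= T -> 0 <= s <= T ->
    cabs (u t y - u s y) <= `|s - t| * w y.
  by move=> tT sT; have [] := hb_lip t s y tT sT.
have [Iyv Ivphi Iwdphi Iw [Iwy Iwphi]] := hb_int.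
set zeta := xi_eta xi eta.
pose cc := coef u phih psih.
have orth := orthonormal_xi_eta exi eeta exe.
have cvS t : (fun n => E2 P (fun om => X t om -
    \sum_(i <- idx n n (fun=> n)) zeta i om * cc t i)) @ \oo --> 0%E.
  have := cvX t; under eq_fun => n do under eq_fun => om do rewrite Xmodel_sum.
  exact.
have bessel t : exists K, \forall n \near \oo, \sum_(i <- idx n n (fun=> n)) cc t i ^+ 2 <= K.
  apply: (bessel_bounded (mX t) _ mZ orth (fun n => idx_uniq n n (fun=> n)) (cvS t)).
  by case: (X2 t).
have van t x : 0 <= t <= T -> Defs.Rint (fun y =>
    cre (u t y * cconj (psih 0) * cexpi (y * x))) = 0.
  move=> tT; have [K HK] := bessel t.
  exact: (@pairing_vanish R T u du phih psih dpsih Mb w hT u0 ha_du ha_dpsi hM w0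
    lip_u Iw Iwy t K tT HK x).
have lipc i t s : 0 <= t <= T -> 0 <= s <= T ->
    `|cc t i - cc s i| <= `|t - s| * coef_lip phih dphih Mb v w i.
  exact: (@coef_lipschitz R T u du phih psih dphih dpsih Mb v w hT u0 ha_du ha_dphi ha_dpsi hM
    w0 v0 lip_du lip_u Iyv Ivphi Iwdphi Iw Iwy Iwphi van i t s).
have cc0 i : cc 0 i = 0.
  exact: (coef_at0 phih hT u0 ha_du ha_dpsi hM w0 lip_u Iw Iwy).
have [hN0' _] : N0_star A1 Q < N0%:R /\ N0_2star E2v ts T < N0%:R.
  by move: hN0; rewrite gt_max => /andP[].
have [hN' _] : N_star B0 B1 Q < N%:R /\ N_2star F1 F2 ts T < N%:R.
  by move: hN; rewrite gt_max => /andP[].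
have hM' j : (j < N)%N -> M_star B1 Q < (Mj j)%:R.
  by move=> jN; have := hMj j jN; rewrite gt_max => /andP[].
pose hat := idx N0 N Mj.
have XhatE t om : Xhat t om = \sum_(i <- hat) zeta i om * cc t i by rewrite /Xhat Xmodel_sum.
have mterm t i : measurable_fun setT (fun om => zeta i om * cc t i).
  by apply: measurable_funM => //; exact: mZ.
have mXhat t : measurable_fun setT (Xhat t).
  rewrite (_ : Xhat t = (fun om => \sum_(i <- hat) zeta i om * cc t i)).
    exact: measurable_sum_fun.
  by apply/funext => om; rewrite XhatE.
pose Z t om := X t om - Xhat t om.
have mZt t : measurable_fun setT (Z t) by exact: measurable_funB.
have Xhat0 om : Xhat 0 om = 0 by rewrite XhatE big1// => i _; rewrite cc0 mulr0.
have PZ0 : P [set om | Z 0 om != 0] = 0%E.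
  apply: E2_eq0_negligible => //.
  (* At time 0 all partial sums vanish, so the mean-square errors form a constant sequence, equal to
     its limit 0. *)
  have E n : E2 P (fun om => X 0 om - \sum_(i <- idx n n (fun=> n)) zeta i om * cc 0 i) = E2 P (Z 0).
    congr (E2 P _); apply/funext => om; rewrite /Z Xhat0; congr (_ - _).
    by rewrite big1// => i _; rewrite cc0 mulr0.
  have := cvS 0; under eq_fun do rewrite E.
  by move=> c1; apply: (cvg_unique _ (cvg_cst _) c1).
pose rs n := [seq i <- idx n n (fun=> n) | i \notin hat].
pose n0 := (N0 + N + \sum_(j < N) Mj j)%N.
have n0N n := @model_size_bound N0 N Mj n.
have tail s t r : 0 <= s <= T -> 0 <= t <= T -> s != t -> 0 < r ->
    (P [set om | (r <= `|Z t om - Z s om|)%R] <=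
      (2 * expR (- (r ^+ 2 / (2 * (Q * T / T * (t - s)) ^+ 2))))%:E)%E.
  move=> sT tT st r0.
  (* The factor [Q * T / T] anticipates chaining with [q = Q * T]. *)
  rewrite mulfK ?gt_eqF//.
  (* For [n >= n0] the partial sum contains all terms of the model, so the difference of the two
     runs over [rs n], and [Z t - Z s] is the mean-square limit of [S n]. *)
  pose S n om := \sum_(i <- rs n) zeta i om * (cc t i - cc s i).
  have mS n : measurable_fun setT (S n).
    by apply: measurable_sum_fun => i; apply: measurable_funM => //; exact: mZ.
  have v0' : 0 < (Q * (t - s)) ^+ 2.
    rewrite exprn_even_gt0//=; apply: mulf_neq0; first by rewrite gt_eqF.
    by rewrite subr_eq0 eq_sym.
  apply: (subgaussian_tail_limit (S := S) _ mS v0' r0).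
  - exact: measurable_funB.
  - near=> n => lam.
    have nn : (n0 <= n)%N by near: n; exact: nbhs_infty_ge.
    have [a1 a2 a3] := n0N n nn.
    apply: le_trans (independent_mgf_le (fun i => cc t i - cc s i) lam hind
      (filter_uniq _ (idx_uniq n n (fun=> n))) _) _.
      move=> i l; apply: strictly_subG_mgf.
        by case: i => [k|[j k]]; [exact: hxi|exact: heta].
      by rewrite /E2; under eq_integral do rewrite expr2; rewrite orth eqxx.
    rewrite lee_fin ler_expR ler_pM2r// ler_wpM2l ?sqr_ge0//.
    apply: (@le_trans _ _ (\sum_(i <- rs n) (t - s) ^+ 2 * coef_lip phih dphih Mb v w i ^+ 2)).
      apply: ler_sum => i _; rewrite -exprMn -[leLHS]real_normK ?num_real//.
      rewrite -[leRHS]real_normK ?num_real//; apply: lerXn2r; rewrite ?nnegrE//.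
      by apply: le_trans (lipc i t s tT sT) _; rewrite normrM ler_wpM2l// ler_norm.
    rewrite -mulr_sumr exprMn mulrC ler_wpM2r ?sqr_ge0//.
    exact: (coef_lip_residual_le Q0 hN0' hN' hM' a1 a2 a3).
  - have c := E2_sub_cvg0 _ _ (cvS t) (cvS s).
    have {}c := c _ _.
    apply: (@cvg_trans _ ((fun n => E2 P (fun om =>
       (X t om - \sum_(i <- idx n n (fun=> n)) zeta i om * cc t i) -
       (X s om - \sum_(i <- idx n n (fun=> n)) zeta i om * cc s i))) @ \oo)); last first.
      by apply: c => n; apply: measurable_funB => //; exact: measurable_sum_fun.
    apply: near_eq_cvg; near=> n.
    have nn : (n0 <= n)%N by near: n; exact: nbhs_infty_ge.
    have [a1 a2 a3] := n0N n nn.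
    congr (E2 P _); apply/funext => om.
    have sub := idx_subset a1 a2 a3.
    rewrite /Z !XhatE /S.
    rewrite !(sum_subseq_split _ (idx_uniq n n (fun=> n)) (idx_uniq N0 N Mj) sub).
    have -> : \sum_(i <- rs n) zeta i om * (cc t i - cc s i) =
        \sum_(i <- rs n) zeta i om * cc t i - \sum_(i <- rs n) zeta i om * cc s i.
      by rewrite -sumrB; apply: eq_bigr => i _; rewrite mulrBr.
    rewrite -/hat -/(rs n); ring.
have [S0 [Nu [cS0 [dS0 [mNu [PNu sepN]]]]]] := hsep.
pose D := ln (1 + delta).
have D0 : 0 < D by rewrite ln_gt0// ltrDl.
(* The endpoints are added because points of [S0] approximating 0 or [T] may lie outside [[0, T]];
   for interior [t] they eventually lie inside. *)
have cS : countable (S0 `|` [set 0; T]).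
  rewrite (_ : _ `|` _ = \bigcup_(b in [set: bool]) (if b then S0 else [set 0; T])).
    apply: bigcup_countable => [|[] _]; [exact: countableP|exact: cS0|].
    by apply: finite_set_countable; exact: finite_set2.
  apply/seteqP; split => x /=.
    by case=> h; [exists true|exists false].
  by case=> -[] _ h; [left|right].
have QT0 : 0 < Q * T by rewrite mulr_gt0.
have lvl := chaining_level_le hdelta heps0 QT0 QT1 QT2.
have eps1 : eps <= 1 by case/andP: heps => _ /ltW.
have [A [mA PA HA]] := chaining hT QT0 D0 cS mZt PZ0 tail lvl eps1.
exists (A `|` Nu); split; first exact: measurableU.
split; last first.
  apply: le_trans (measureU2 _ mA mNu) _.
  by rewrite [X in (_ + X)%E](_ : _ = 0%E) ?adde0.
move=> om [t [tT]]; apply: contraPP => nA; apply/negP; rewrite -leNgt.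
have nAA : ~ A om by move=> h; apply: nA; left.
have nNN : ~ Nu om by move=> h; apply: nA; right.
apply: expR_div_dist_le => //; rewrite -/(Z t om) -/D.
have bnd := HA om nAA.
have [t0|t0] := eqVneq t 0.
  by apply: bnd => //; right; left.
have [tT'|tT'] := eqVneq t T.
  by apply: bnd => //; right; right.
have tin : 0 < t < T.
  by case/andP: tT => h1 h2; rewrite !lt_neqAle h1 h2 eq_sym t0 tT'.
have [s [Ss [st Xs]]] := sepN om nNN t.
have near_in : \forall n \near \oo, 0 <= s n <= T.
  have : \forall x \near t, 0 <= x <= T.
    near=> x; apply/andP; split; apply: ltW; near: x.
      by apply: lt_nbhsr; case/andP: tin.
    by apply: lt_nbhsl; case/andP: tin.
  by move=> h; exact: st h.
(* [Lw] is a Lipschitz constant on [[0, T]] of the path of the model at [om]. Hence the model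
   converges along [s n], as [X] does by separability, and the bound for [Z (s n) om] passes to
   [Z t om]. *)
pose Lw := \sum_(i <- hat) `|zeta i om| * coef_lip phih dphih Mb v w i.
have Xhs : (fun n => Xhat (s n) om) @ \oo --> Xhat t om.
  have st0 : (fun n => `|t - s n| * Lw) @ \oo --> 0.
    rewrite -[X in _ --> X](mul0r Lw); apply: cvgM; last exact: cvg_cst.
    rewrite -(normr0 R) -(subrr t); apply: cvg_norm.
    by apply: cvgB; [exact: cvg_cst|exact: st].
  apply/cvgrPdist_le => e e0.
  have /cvgrPdist_le/(_ _ e0) := st0 => near_e.
  near=> n.
  have sn : 0 <= s n <= T by near: n.
  have he : `|0 - `|t - s n| * Lw| <= e by near: n.
  apply: (@le_trans _ _ (`|t - s n| * Lw)); last first.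
    by apply: le_trans he; rewrite sub0r normrN ler_norm.
  rewrite !XhatE -sumrB /Lw mulr_sumr; apply: le_trans (ler_norm_sum _ _ _) _.
  apply: ler_sum => i _; rewrite -mulrBr normrM mulrCA ler_wpM2l//.
  exact: lipc.
have cvZ : (fun n => `|Z (s n) om|) @ \oo --> `|Z t om|.
  by apply: cvg_norm; apply: cvgB.
rewrite -(cvg_lim _ cvZ)//; apply: limr_le; first by apply/cvg_ex; exists `|Z t om|.
near=> n; apply: bnd; first by left.
by near: n.
Unshelve. all: by end_near. Qed.
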